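(* Let $M$ and $N$ be connected $C^1$ Finsler manifolds of the same dimension, where $M$ is complete, and let $f:M\to N$ be a locally Lipschitz mapping such that $\partial f(x)$ has maximal rank for all $x\in M$. Assume that there exists $x_0\in M$ such that $$\int_0^\infty m(t)\,dt=\infty,\qquad\text{where}\qquad m(t)=\inf_{x\in\overline{B}_M(x_0,t)} c_x(\partial f(x)),$$ where $c_x(\partial f(x))$ denotes the co-norm of the Clarke generalized differential of $f$ at $x$ and $\overline{B}_M(x_0,t)=\{y\in M: d_M(x_0,y)\le t\}$. Then $f$ is a covering map.
   Context: All manifolds are finite-dimensional. A $C^1$ Finsler manifold is a $C^1$-smooth manifold $M$ with a continuous map $\|\cdot\|_M:TM\to[0,\infty)$ whose restriction $\|\cdot\|_x$ to each tangent space $T_xM$ is a norm. If $M$ is connected, the Finsler distance is $d_M(x,y)=\inf\int_a^b\|\gamma'(t)\|_{\gamma(t)}\,dt$, the infimum over all piecewise $C^1$ paths $\gamma:[a,b]\to M$ joining $x$ to $y$ (it induces the manifold topology). $M$ is complete if $(M,d_M)$ is a complete metric space. A map $f:M\to N$ ($\dim M=m$, $\dim N=n$) is Lipschitz on a neighborhood of $x$ if there are charts $(U,\varphi)$ of $M$ at $x$ and $(V,\psi)$ of $N$ at $f(x)$, $f(U)\subset V$, such that $\psi\circ f\circ\varphi^{-1}$ is Lipschitz on a neighborhood of $\varphi(x)$; $f$ is locally Lipschitz if this holds at every $x\in M$. Clarke generalized differential: for $F$ from an open subset of $\mathbb{R}^m$ to $\mathbb{R}^n$, Lipschitz near $p$,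 $\partial F(p)$ is the convex hull of all limits $\lim_i dF(p_i)$ with $p_i\to p$ and $F$ differentiable at each $p_i$. For $f:M\to N$ Lipschitz on a neighborhood of $x$, $$\partial f(x)=\{d\psi^{-1}(\psi(f(x)))\circ A\circ d\varphi(x): A\in\partial(\psi\circ f\circ\varphi^{-1})(\varphi(x))\}\subset\mathcal{L}(T_xM,T_{f(x)}N),$$ for charts $\varphi$ at $x$ and $\psi$ at $f(x)$; this does not depend on the charts. When $\dim M=\dim N$, $\partial f(x)$ has maximal rank if every $B\in\partial f(x)$ is an invertible linear map $T_xM\to T_{f(x)}N$. The co-norm of $\partial f(x)$ is $c_x(\partial f(x))=\inf_{B\in\partial f(x)}\ \inf\{\|Bv\|_{f(x)}: v\in T_xM,\ \|v\|_x=1\}$. A continuous map $f:M\to N$ is a covering map if every $z\in N$ has an open neighborhood $W$ such that $f^{-1}(W)$ is a disjoint union of open subsets of $M$, each mapped homeomorphically onto $W$ by $f$. *)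

(* Defs.v *)
From HB Require Import structures.
From mathcomp Require Import all_boot all_order all_algebra.
From mathcomp Require Import all_classical all_reals all_analysis.

Set Implicit Arguments.
Unset Strict Implicit.
Unset Printing Implicit Defensive.

Import Order.TTheory GRing.Theory Num.Theory.
Import numFieldNormedType.Exports.

Local Open Scope classical_set_scope.
Local Open Scope ring_scope.

(* Conventions.
   - R^n is 'rV[R]_n.  Its library norm is the sup norm; differentiability and
     the Lipschitz property do not depend on that choice.
   - L(R^m, R^n) is 'M[R]_(m, n) acting on row vectors by v |-> v *m A, as for
     the library's Jacobian 'J F p.  A composite "B after A" is thus A *m B. *)

(* The map and its inverse are total functions; their values outside
   [chart_dom] and outside the image of [chart_dom] are irrelevant. *)
Record chart (R : realType) (n : nat) (M : topologicalType) := Chart {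
  chart_dom : set M;
  chart_map :> M -> 'rV[R]_n;
  chart_inv : 'rV[R]_n -> M;
  chart_dom_open : open chart_dom;
  chart_img_open : open (chart_map @` chart_dom);
  chart_mapK : forall x, chart_dom x -> chart_inv (chart_map x) = x;
  chart_map_continuous :
    forall x, chart_dom x -> {for x, continuous chart_map};
  chart_inv_continuous :
    forall x, chart_dom x -> {for chart_map x, continuous chart_inv}
}.

Definition C1_transition (R : realType) (n : nat) (M : topologicalType)
    (phi psi : chart R n M) : Prop :=
  forall x, chart_dom phi x -> chart_dom psi x ->
    differentiable (psi \o chart_inv phi) (phi x) /\
    {for phi x, continuous (fun p => 'J (psi \o chart_inv phi) p)}.

(* [atlas] is the maximal atlas, so "chart of M" means "element of [atlas]".

   [chart_at] distinguishes one chart around each point.  It only serves to name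
   tangent vectors: T_xM is represented by 'rV[R]_n, the row v standing for the
   tangent vector at x whose coordinates in the chart [chart_at x] are v. *)
Record c1Manifold (R : realType) (n : nat) := C1Manifold {
  carrier :> topologicalType;
  carrier_hausdorff : hausdorff_space carrier;
  atlas : set (chart R n carrier);
  atlas_compatible : forall phi psi,
    atlas phi -> atlas psi -> C1_transition phi psi;
  atlas_maximal : forall phi,
    (forall psi, atlas psi -> C1_transition phi psi /\ C1_transition psi phi) ->
    atlas phi;
  chart_at : carrier -> chart R n carrier;
  chart_at_atlas : forall x, atlas (chart_at x);
  chart_at_dom : forall x, chart_dom (chart_at x) x
}.

(* d phi(x) : T_xM -> R^n *)
Definition dchart (R : realType) (n : nat) (M : c1Manifold R n)
    (phi : chart R n M) (x : M) : 'M[R]_n :=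
  'J (phi \o chart_inv (chart_at x)) (chart_at x x).

(* d phi^{-1}(phi(x)) : R^n -> T_xM *)
Definition dchart_inv (R : realType) (n : nat) (M : c1Manifold R n)
    (phi : chart R n M) (x : M) : 'M[R]_n :=
  'J (chart_at x \o chart_inv phi) (phi x).

(* [fnorm_continuous] is continuity on TM: for each chart (U, phi) the map
   (x, v) |-> d phi^{-1}(phi(x)) v is the local trivialization U x R^n -> TU
   through which the topology of TM is defined. *)
Record finslerManifold (R : realType) (n : nat) := FinslerManifold {
  base :> c1Manifold R n;
  fnorm : base -> 'rV[R]_n -> R;
  fnorm_ge0 : forall x v, 0 <= fnorm x v;
  fnorm_eq0 : forall x v, fnorm x v = 0 -> v = 0;
  fnormZ : forall x (a : R) v, fnorm x (a *: v) = `|a| * fnorm x v;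
  fnormD : forall x v w, fnorm x (v + w) <= fnorm x v + fnorm x w;
  fnorm_continuous : forall phi : chart R n base, atlas phi ->
    forall x v, chart_dom phi x ->
    {for (x, v), continuous (fun q : base * 'rV[R]_n =>
       fnorm q.1 (q.2 *m dchart_inv phi q.1))}
}.

Section Distance.
Context {R : realType} {n : nat}.

Definition C1_curve_at (M : c1Manifold R n) (g : R -> M) (t : R) : Prop :=
  {for t, continuous g} /\
  forall phi : chart R n M, atlas phi -> chart_dom phi (g t) ->
    (\forall s \near t, derivable (phi \o g) s 1) /\
    {for t, continuous (derive1 (phi \o g))}.

(* C^1 on the closed interval [a, b]: restriction of a curve that is C^1 at every
   point of [a, b], endpoints included. *)
Definition C1_path (M : c1Manifold R n) (gamma : R -> M) (a b : R) : Prop :=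
  exists g : R -> M, forall t, a <= t <= b -> g t = gamma t /\ C1_curve_at g t.

Inductive piecewise_C1 (M : c1Manifold R n) (gamma : R -> M) : R -> R -> Prop :=
| piecewise_C1_one a b :
    a < b -> C1_path gamma a b -> piecewise_C1 gamma a b
| piecewise_C1_cat a c b :
    piecewise_C1 gamma a c -> piecewise_C1 gamma c b -> piecewise_C1 gamma a b.

(* gamma'(t) in T_{gamma(t)}M; for a piecewise C^1 path it is meaningful except at
   the finitely many break points and endpoints, which do not affect the length *)
Definition velocity (M : c1Manifold R n) (gamma : R -> M) (t : R) : 'rV[R]_n :=
  derive1 (chart_at (gamma t) \o gamma) t.

Definition finsler_length (M : finslerManifold R n) (gamma : R -> M) (a b : R)
    : \bar R :=
  (\int[@lebesgue_measure R]_(t in `[a, b]%classic)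
     (fnorm (gamma t) (velocity gamma t))%:E)%E.

Definition finsler_dist (M : finslerManifold R n) (x y : M) : \bar R :=
  ereal_inf [set l : \bar R | exists (gamma : R -> M) (a b : R),
    [/\ piecewise_C1 gamma a b, gamma a = x, gamma b = y
      & l = finsler_length gamma a b]].

Definition finsler_closed_ball (M : finslerManifold R n) (x : M) (t : R) : set M :=
  [set y | (finsler_dist x y <= t%:E)%E].

Definition finsler_complete (M : finslerManifold R n) : Prop :=
  forall u : nat -> M,
    (forall e : R, 0 < e -> exists K : nat, forall i j : nat,
       (K <= i)%N -> (K <= j)%N -> (finsler_dist (u i) (u j) < e%:E)%E) ->
    exists l : M, forall e : R, 0 < e -> exists K : nat, forall i : nat,
       (K <= i)%N -> (finsler_dist (u i) l < e%:E)%E.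

End Distance.

Section Clarke.
Context {R : realType}.

Definition local_rep (m n : nat) (M : c1Manifold R m) (N : c1Manifold R n)
    (f : M -> N) (phi : chart R m M) (psi : chart R n N)
    : 'rV[R]_m -> 'rV[R]_n :=
  psi \o f \o chart_inv phi.

Definition lipschitz_near (m n : nat) (M : c1Manifold R m) (N : c1Manifold R n)
    (f : M -> N) (x : M) : Prop :=
  exists (phi : chart R m M) (psi : chart R n N),
    [/\ atlas phi, atlas psi, chart_dom phi x, chart_dom psi (f x)
      & f @` chart_dom phi `<=` chart_dom psi /\
        exists2 W : set 'rV[R]_m, nbhs (phi x) W
          & [lipschitz (local_rep f phi psi) p | p in W]].

Definition locally_lipschitz (m n : nat) (M : c1Manifold R m)
    (N : c1Manifold R n) (f : M -> N) : Prop :=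
  forall x, lipschitz_near f x.

Definition convex_hull (V : lmodType R) (S : set V) : set V :=
  [set x | exists (k : nat) (c : 'I_k -> R) (s : 'I_k -> V),
     [/\ forall i, 0 <= c i, \sum_(i < k) c i = 1, forall i, S (s i)
       & x = \sum_(i < k) c i *: s i]].

Definition clarke (m n : nat) (F : 'rV[R]_m -> 'rV[R]_n) (p : 'rV[R]_m)
    : set 'M[R]_(m, n) :=
  convex_hull [set A : 'M[R]_(m, n) | exists u : nat -> 'rV[R]_m,
    [/\ u @ \oo --> p, forall i, differentiable F (u i)
      & (fun i => 'J F (u i)) @ \oo --> A]].

Definition clarke_in_charts (m n : nat) (M : c1Manifold R m)
    (N : c1Manifold R n) (phi : chart R m M) (psi : chart R n N)
    (f : M -> N) (x : M) : set 'M[R]_(m, n) :=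
  [set dchart phi x *m A *m dchart_inv psi (f x)
     | A in clarke (local_rep f phi psi) (phi x)].

(* The set does not depend on the charts at x and f(x) when f is Lipschitz near x;
   the distinguished ones are used. *)
Definition clarke_diff (m n : nat) (M : c1Manifold R m) (N : c1Manifold R n)
    (f : M -> N) (x : M) : set 'M[R]_(m, n) :=
  clarke_in_charts (chart_at x) (chart_at (f x)) f x.

Definition maximal_rank (n : nat) (M N : c1Manifold R n) (f : M -> N) (x : M)
    : Prop :=
  forall B, clarke_diff f x B -> B \in unitmx.

(* Extended-real valued, since the unit sphere is empty in dimension 0. *)
Definition conorm (m n : nat) (M : finslerManifold R m)
    (N : finslerManifold R n) (f : M -> N) (x : M) : \bar R :=
  ereal_inf [set ereal_inf [set (fnorm (f x) (v *m B))%:E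
                              | v in [set v | fnorm x v = 1]]
               | B in clarke_diff f x].

End Clarke.

Definition homeomorphic_onto (X Y : topologicalType) (f : X -> Y) (U : set X)
    (W : set Y) : Prop :=
  {within U, continuous f} /\
  exists g : Y -> X,
    [/\ {within W, continuous g},
        forall x, U x -> W (f x) /\ g (f x) = x
      & forall y, W y -> U (g y) /\ f (g y) = y].

Definition covering_map (X Y : topologicalType) (f : X -> Y) : Prop :=
  continuous f /\
  forall z : Y, exists2 W : set Y, open W /\ W z &
    exists (I : Type) (U : I -> set X),
      [/\ forall i, open (U i), trivIset setT U, f @^-1` W = \bigcup_i U i
        & forall i, homeomorphic_onto f (U i) W].

(* Main.v *)
(* If c is smaller than the co-norm of the Clarke differential of f at x, then
   near x, in the distinguished charts, |f(z) - f(y)| >= c |z - y| for the Finsler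
   norms at f(x) and x, and f is open at x; so f is a local homeomorphism.  Both
   facts follow from Rademacher's theorem and convex separation: the derivatives
   of f near x lie in a convex neighbourhood of the Clarke differential on which
   a bound almost as good as c persists.

   Consequently, along a lift sigma of a C^1 curve the distance r = d(x0, sigma)
   grows at a rate at most C / m(r).  As the integral of m diverges, r stays
   bounded, so sigma is Lipschitz, hence Cauchy by completeness, and extends: every
   chart segment of N lifts from every point over its origin.  Over a ball in a
   chart the endpoints of the lifts of the radii form the sheets.

   Lebesgue measure on R^n is avoided in Rademacher's theorem: the exceptional
   set lies in a union of Borel sets that are null on all lines in a coordinate
   direction, which are handled by density points in dimension one. *)

Require Import Defs.
From HB Require Import structures.
From mathcomp Require Import all_boot all_order all_algebra.
From mathcomp Require Import all_classical all_reals all_analysis.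
From mathcomp Require Import measurable_realfun.
From mathcomp Require Import ring lra.

Set Implicit Arguments.
Unset Strict Implicit.
Unset Printing Implicit Defensive.

Import Order.TTheory GRing.Theory Num.Theory.
Import numFieldNormedType.Exports.

Local Open Scope classical_set_scope.
Local Open Scope ring_scope.

(** * Lipschitz functions on the line *)

(** A lift is only Lipschitz, as [f] is, so it has no velocity in general and no length integral.
    Its motion is measured by the change of [finsler_dist p] along it, for every base point [p]: the
    lower bound on [f] in charts gives local estimates, and real induction adds them up.

    The lower bound and openness are vector statements, while the calculus at hand is scalar and
    lives on lines. Convex separation supplies one covector that works for all derivatives near the
    point at once, and the mean value inequality is applied to [F] paired with it. That inequality
    needs segments that meet the non-differentiability set in a null set; Tonelli's theorem finds
    them among the parallels close to a given segment.

    In Rademacher's theorem the difficulty is to assemble partial derivatives, which are not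
    continuous, into a derivative. Where the set of points with nearly the same approximations is
    not porous, every small displacement along the next axis ends close to such a point, and the
    Lipschitz bound covers the rest.

    The function [m] enters through its values at the integers, halved to make the co-norm bound
    strict. *)

Lemma exists_pos_lt2 (R : realType) (a b : R) : 0 < a -> 0 < b ->
  exists e, [/\ 0 < e, e < a & e < b].
Proof.
by case: (ltP a b) => ab a0 b0; [exists (a / 2)|exists (b / 2)]; split; lra.
Qed.

Lemma exists_pos_lt_sub (R : realType) (d a b : R) : 0 < d -> a < b ->
  exists e, [/\ 0 < e, e < d & e < b - a].
Proof. by move=> d0 ab; apply: exists_pos_lt2; rewrite ?subr_gt0. Qed.

Section lipschitz_line.
Context {R : realType}.
Notation mu := (@lebesgue_measure R).

Lemma lebesgue_ae_imply (P Q : R -> Prop) :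
  {ae mu, forall x, P x} -> (forall x, P x -> Q x) -> {ae mu, forall x, Q x}.
Proof.
move=> [N [mN N0 subN]] PQ; exists N; split => //.
by apply: subset_trans subN => x; exact: contra_not (PQ x).
Qed.

Lemma lebesgue_ae_and (P Q : R -> Prop) :
  {ae mu, forall x, P x} -> {ae mu, forall x, Q x} ->
  {ae mu, forall x, P x /\ Q x}.
Proof.
move=> [N [mN N0 subN]] [N' [mN' N'0 subN']]; exists (N `|` N'); split.
- exact: measurableU.
- exact: null_set_setU.
- by move=> x /= /not_andP[/subN|/subN']; [left|right].
Qed.

Lemma cumulative_of_monotone (G : R -> R) :
  {homo G : x y / x <= y} -> continuous G ->
  exists Gc : cumulative R R, Gc = G :> (R -> R).
Proof.
move=> ndG cG.
have rcG : right_continuous G.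
  by move=> x; apply: cvg_at_right_filter; exact: cG.
pose m := isCumulative.Build R _ R G ndG rcG.
pose Gc : cumulative R R := HB.pack G m.
by exists Gc.
Qed.

Lemma stieltjes_ocitv (G : cumulative R R) (a b : R) : a <= b ->
  lebesgue_stieltjes_measure G `]a, b]%classic = (G b - G a)%:E.
Proof.
move=> ab; rewrite /lebesgue_stieltjes_measure /measure_extension.
rewrite measurable_mu_extE/=; last exact: is_ocitv.
by rewrite wlength_itv_bnd.
Qed.

(* The Stieltjes measures of G and id - G add up to Lebesgue measure, so each of
   them is absolutely continuous. *)
Lemma stieltjes_dominated (G1 G2 : cumulative R R)
    (G12 : forall x, G1 x + G2 x = x) (A : set (measurableTypeR R)) :
  measurable A -> mu A = 0%E -> lebesgue_stieltjes_measure G1 A = 0%E.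
Proof.
move=> mA A0.
pose nu := measure_add (@lebesgue_stieltjes_measure R G1)
                       (@lebesgue_stieltjes_measure R G2).
have nuE B : nu B = (lebesgue_stieltjes_measure G1 B +
    lebesgue_stieltjes_measure G2 B)%E by exact: measure_addE.
have muE : mu A = nu A.
  apply: lebesgue_stieltjes_measure_unique => // X /ocitvP[->|[[a b] /= ab ->]].
    by rewrite !measure0.
  rewrite [LHS]stieltjes_ocitv ?ltW// [RHS]nuE !stieltjes_ocitv ?ltW//.
  by rewrite -EFinD; congr EFin; rewrite addrACA -opprD !G12.
move: A0; rewrite muE nuE => /eqP.
by rewrite padde_eq0// => /andP[/eqP].
Qed.

(** Since [x - G x] is nondecreasing too, the Stieltjes measure of [G] is absolutely continuous; [h]
    is its Radon-Nikodym density on []a, b]]. *)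
Lemma nonexpansive_primitive (G : R -> R) (ndG : {homo G : x y / x <= y})
    (G_le : forall x y, x <= y -> G y - G x <= y - x) (a b : R) (ab : a < b) :
  exists2 h : R -> R, mu.-integrable setT (EFin \o h) &
    forall x, a <= x <= b -> (G x - G a)%:E = (\int[mu]_(t in `]a, x]) (h t)%:E)%E.
Proof.
have G_lip x y : `|G x - G y| <= `|x - y|.
  wlog xy : x y / x <= y => [H|].
    by have [/H//|/ltW/H] := leP x y; rewrite distrC (distrC y).
  rewrite distrC (distrC x) !ger0_norm ?subr_ge0//; [exact: G_le|exact: ndG].
have cG : continuous G.
  move=> x; apply/cvgrPdist_lt => e e0; near=> y.
  apply: le_lt_trans (G_lip _ _) _; near: y; exact: cvgr_dist_lt.
have [G1 G1E] := cumulative_of_monotone ndG cG.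
have [G2 G2E] : exists Gc : cumulative R R, Gc = (fun x => x - G x) :> (R -> R).
  apply: cumulative_of_monotone => [x y xy|x].
    by have := G_le _ _ xy; lra.
  by apply: cvgB; [exact: cvg_id|exact: cG].
have mD : measurable (`]a, b]%classic : set (measurableTypeR R)) by [].
have Dfin : (lebesgue_stieltjes_measure G1 `]a, b]%classic < +oo)%E.
  by rewrite stieltjes_ocitv ?ltW// ltry.
pose nu := charge_of_finite_measure (mfrestr mD Dfin).
have numu : nu `<< mu.
  apply/null_content_dominatesP => A mA A0.
  rewrite /nu /= /mfrestr /mrestr.
  apply: (@stieltjes_dominated G1 G2) => //.
  - by move=> x; rewrite G1E G2E addrC subrK.
  - exact: measurableI.
  - apply/eqP; rewrite -measure_le0 -[X in (_ <= X)%E]A0.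
    by apply: le_measure; rewrite ?inE//; exact: measurableI.
pose h := Radon_Nikodym nu mu.
have hfin x : h x \is a fin_num by exact: Radon_Nikodym_fin_num.
exists (fine \o h).
  have -> : EFin \o (fine \o h) = h by apply/funext => x /=; rewrite fineK.
  exact: Radon_Nikodym_integrable.
move=> x /andP[ax xb].
under eq_integral do rewrite /= fineK//.
rewrite -Radon_Nikodym_integral//= /mfrestr /mrestr setIidl.
  by rewrite stieltjes_ocitv// G1E.
by apply: subset_itvl; rewrite bnd_simp.
Unshelve. all: by end_near. Qed.

(** Lebesgue differentiation of the indefinite integral identifies the density [h] with the
    derivative of [G] almost everywhere. *)
Lemma nonexpansive_FTC (G : R -> R) (ndG : {homo G : x y / x <= y})
    (G_le : forall x y, x <= y -> G y - G x <= y - x) (a b : R) (ab : a < b) :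
  exists h : R -> R, [/\ mu.-integrable setT (EFin \o h),
    (G b - G a)%:E = (\int[mu]_(t in `]a, b]) (h t)%:E)%E &
    {ae mu, forall x, a < x < b -> derivable G x 1 /\ derive1 G x = h x}].
Proof.
have [h ih hE] := nonexpansive_primitive ndG G_le ab.
exists h; split => //; first by rewrite hE// lexx ltW.
have iI D : measurable D -> mu.-integrable D (EFin \o h).
  by move=> mD; apply: integrableS ih.
pose F y := (\int[mu]_(t in `]a, y]) (h t))%R.
have hl : locally_integrable [set: R] h.
  by rewrite -(patch_setT (fun=> 0) h); apply: integrable_locally.
have := @FTC1 R h (BRight a) (fun y => iI _ (measurable_itv _)) hl.
move=> /lebesgue_ae_imply; apply => x Fx /andP[ax xb].
have [dF F'] := Fx ax.
have FG : \forall y \near x, F y + G a = G y.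
  near=> y.
  have ayb : a <= y <= b.
    by apply/andP; split; apply: ltW; near: y; [exact: lt_nbhsr|exact: lt_nbhsl].
  by rewrite /F /Rintegral -hE//= subrK.
have dFa : derivable (fun y => F y + G a) x 1.
  by apply: derivableD; [exact: dF|exact: derivable_cst].
split; first exact: (near_eq_derivable FG dFa).
rewrite derive1E -(near_eq_derive _ FG) deriveD; [|exact: dF|exact: derivable_cst].
by rewrite derive_cst addr0 -derive1E.
Unshelve. all: by end_near. Qed.

Lemma nonexpansive_derivable_ae (G : R -> R) (ndG : {homo G : x y / x <= y})
    (G_le : forall x y, x <= y -> G y - G x <= y - x) :
  {ae mu, forall x, derivable G x 1}.
Proof.
suff : {ae mu, forall x, forall k : nat, - k.+1%:R < x < k.+1%:R -> derivable G x 1}.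
  move=> /lebesgue_ae_imply; apply => x /(_ (Num.bound `|x|)); apply.
  by rewrite -ltr_norml (lt_trans (archi_boundP (normr_ge0 x)))// ltr_nat.
apply: ae_foralln => k.
have [|h [_ _]] := @nonexpansive_FTC G ndG G_le (- k.+1%:R) k.+1%:R.
  by rewrite gtrN// ltr0Sn.
by move=> /lebesgue_ae_imply; apply => x H /H[].
Qed.

Lemma nonexpansive_derive_ge (G : R -> R) (ndG : {homo G : x y / x <= y})
    (G_le : forall x y, x <= y -> G y - G x <= y - x) (a b s : R) (ab : a < b) :
  {ae mu, forall x, a < x < b -> derivable G x 1 -> s <= derive1 G x} ->
  s * (b - a) <= G b - G a.
Proof.
move=> sG; have [h [ih hE hG]] := nonexpansive_FTC ndG G_le ab.
have [N [mN N0 subN]] : mu.-negligible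
    (~` [set x | a < x < b -> s <= h x]).
  apply: lebesgue_ae_imply (lebesgue_ae_and sG hG) _ => x [sx Gx] xab.
  by have [d <-] := Gx xab; exact: sx.
have iI D : measurable D -> mu.-integrable D (EFin \o h).
  by move=> mD; apply: integrableS ih.
(* The integral runs over []a, b]], while the bound on the derivative holds only for [x < b]. *)
pose N' := N `|` [set b].
have mN' : measurable N' by exact: measurableU.
have N'0 : mu N' = 0%E.
  by apply: null_set_setU => //; exact: lebesgue_measure_set1.
rewrite -lee_fin hE (@negligible_integral _ _ _ _ _ N')//; last exact: iI.
have mD : measurable (`]a, b]%classic `\` N') by exact: measurableD.
have muD : mu (`]a, b]%classic `\` N') = (b - a)%:E.
  have : mu (`]a, b]%classic `&` N') = 0%E.
    by apply: (subset_measure0 _ mN' _ N'0) => //; exact: measurableI.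
  move=> DN0; have : mu `]a, b]%classic =
      (mu (`]a, b]%classic `\` N') + mu (`]a, b]%classic `&` N'))%E.
    exact: measureDI.
  rewrite DN0 adde0 => <-.
  by rewrite lebesgue_measure_itv/= lte_fin ab -EFinB.
apply: (@le_trans _ _ (\int[mu]_(x in `]a, b] `\` N') (cst s%:E) x)%E).
  by rewrite integral_cst// [X in (_ <= _ * X)%E]muD.
apply: le_integral => //.
- apply/integrableP; split; first exact: measurable_cst.
  by rewrite /= integral_cst// [X in (_ * X)%E]muD -EFinM ltry.
- exact: iI.
move=> x; rewrite inE /= in_itv/= => -[/andP[ax xb] /not_orP[Nx xbN]].
rewrite lee_fin; apply: contrapT => sx; apply: Nx; apply: subN => /= H.
by apply/sx/H; rewrite ax lt_neqAle xb andbT; apply/eqP.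
Qed.

(** Adding a multiple of the identity makes a Lipschitz function monotone. The normalisation
    [G x = (g x / K + x) / 2] brings the slopes into [[0, 1]], so that both [G] and [id - G] are
    nondecreasing. *)
Lemma lipschitz_slope (g : R -> R) (L : R)
    (g_lip : forall s t, `|g s - g t| <= L * `|s - t|) :
  exists G : R -> R, exists2 K, 0 < K & [/\ g = (fun x => K * (2 * G x - x)),
    {homo G : x y / x <= y} & forall x y, x <= y -> G y - G x <= y - x].
Proof.
pose K := `|L| + 1.
have K0 : 0 < K by rewrite ltr_wpDl.
have gK s t : `|g s - g t| <= K * `|s - t|.
  apply: le_trans (g_lip _ _) _; rewrite ler_wpM2r//.
  by rewrite (le_trans (ler_norm _))// lerDl.
pose G x := (g x / K + x) / 2.
have GB x y : G y - G x = ((g y - g x) / K + (y - x)) / 2 by rewrite /G; lra.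
have gyx x y : x <= y -> - (y - x) <= (g y - g x) / K <= y - x.
  move=> xy; have := gK y x; rewrite (ger0_norm (_ : 0 <= y - x)) ?subr_ge0//.
  by rewrite ler_norml ler_pdivrMr// ler_pdivlMr// mulNr (mulrC K).
exists G, K => //; split => [|x y xy|x y xy].
- by apply/funext => x; rewrite /G; field; rewrite gt_eqF.
- by rewrite -subr_ge0 GB; have := gyx _ _ xy; lra.
- by rewrite GB; have := gyx _ _ xy; lra.
Qed.

Lemma is_derive_slope (G : R -> R) (K x : R) : derivable G x 1 ->
  is_derive x 1 (fun x => K * (2 * G x - x)) (K * (2 * derive1 G x - 1)).
Proof.
move=> dG; have G' : is_derive x 1 G (derive1 G x).
  by rewrite derive1E; exact/derivableP.
have d2 : is_derive x 1 (2 \*: G) (2 *: derive1 G x) by exact: is_deriveZ.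
have d3 : is_derive x 1 (2 \*: G - id) (2 *: derive1 G x - 1) by exact: is_deriveB.
exact: (is_deriveZ K d3).
Qed.

Lemma lipschitz_derivable_ae (g : R -> R) (L : R)
    (g_lip : forall s t, `|g s - g t| <= L * `|s - t|) :
  {ae mu, forall x, derivable g x 1}.
Proof.
have [G [K K0 [-> ndG G_le]]] := lipschitz_slope g_lip.
have := nonexpansive_derivable_ae ndG G_le; move=> /lebesgue_ae_imply; apply => x dG.
by case: (is_derive_slope K dG).
Qed.

Lemma lipschitz_derive_ge (g : R -> R) (L : R)
    (g_lip : forall s t, `|g s - g t| <= L * `|s - t|) (a b s : R) (ab : a < b) :
  {ae mu, forall x, a < x < b -> derivable g x 1 -> s <= derive1 g x} ->
  s * (b - a) <= g b - g a.
Proof.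
have [G [K K0 [-> ndG G_le]]] := lipschitz_slope g_lip => gs.
(* The slope of [G] that corresponds to the slope [s] of [g]. *)
have : (s / K + 1) / 2 * (b - a) <= G b - G a.
  apply: (nonexpansive_derive_ge ndG G_le ab).
  apply: lebesgue_ae_imply gs _ => x + xab dG => /(_ xab).
  have dK := is_derive_slope K dG.
  rewrite derive1E (@derive_val _ _ _ _ _ _ _ dK).
  move=> /(_ (@ex_derive _ _ _ _ _ _ _ dK)) sK.
  have : s / K <= 2 * derive1 G x - 1 by rewrite ler_pdivrMr// mulrC.
  by rewrite !derive1E; lra.
move=> H; have := ler_wpM2l (ltW K0) H.
have -> : K * ((s / K + 1) / 2 * (b - a)) = (s + K) / 2 * (b - a).
  by field; rewrite gt_eqF.
by lra.
Qed.
End lipschitz_line.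

(** * Porous sets and Fubini on lines *)

Section porous.
Context {R : realType}.
Notation mu := (@lebesgue_measure R).

Definition porous_at (A : set R) (c t : R) := forall d, 0 < d ->
  exists s, 0 < `|s| < d /\ forall u, `|u - (t + s)| < c * `|s| -> ~ A u.

(** A hole of radius [c * |s|] centred at [t + s] lies in the ball of radius [|s| * (1 + c)] around
    [t] and takes up the fraction [c / (1 + c)] of it. At a porous point the density of [A] is thus
    not 1, against Lebesgue's density theorem. *)
Lemma porous_negligible (A : set R) (c : R) : measurable A -> 0 < c <= 1 ->
  mu.-negligible [set t | A t /\ porous_at A c t].
Proof.
move=> mA /andP[c0 c1].
have [N [mN N0 subN]] := lebesgue_density mA.
exists N; split => //; apply: subset_trans subN => t /= [At Pt] /fine_cvgP[fin].
rewrite indicE mem_set//= => cv1.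
have q1 : 1 - c / (1 + c) < 1 by rewrite gtrBl divr_gt0// addr_gt0.
have [d /= d0 dH] := cvgr_gt _ cv1 _ q1.
(* As [c <= 1], halving [d] keeps the radius [|s| * (1 + c)] of the surrounding ball below [d]. *)
have [s [/andP[s0 sd] sA]] := Pt (d / 2) ltac:(by rewrite divr_gt0).
pose r := `|s| * (1 + c).
have r0 : 0 < r by rewrite mulr_gt0// addr_gt0.
have rd : r < d.
  rewrite /r; have : `|s| * (1 + c) <= `|s| * 2 by rewrite ler_wpM2l//; lra.
  by lra.
have := dH r; rewrite /ball_/= sub0r normrN gtr0_norm// => /(_ rd r0).
rewrite /= => dens; have : fine (mu (A `&` ball t r) / mu (ball t r))
    <= 1 - c / (1 + c); last by rewrite leNgt dens.
pose B := ball t r `\` ball (t + s) (c * `|s|).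
have mB : measurable B by apply: measurableD; exact: measurable_ball.
have subB : A `&` ball t r `<=` B.
  move=> u [Au tu]; split => //; rewrite /ball/= distrC => H.
  exact: (sA u).
have muB : mu B = (r *+ 2 - (c * `|s|) *+ 2)%:E.
  have sub : ball (t + s) (c * `|s|) `<=` ball t r.
    move=> u; rewrite /ball/= => H.
    have -> : t - u = (t + s - u) - s by lra.
    apply: le_lt_trans (ler_normB _ _) _.
    by rewrite /r mulrDr mulr1 addrC ltrD2l mulrC.
  have cs0 : 0 <= c * `|s| by rewrite mulr_ge0// ltW.
  rewrite /B measureD//; [|exact: measurable_ball|exact: measurable_ball|].
    rewrite setIidr// [X in (X - _)%E]lebesgue_measure_ball ?ltW//.
    by rewrite [X in (_ - X)%E]lebesgue_measure_ball.
  by rewrite [X in (X < _)%E]lebesgue_measure_ball ?ltW// ltry.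
have le1 : (mu (A `&` ball t r) <= (r *+ 2 - (c * `|s|) *+ 2)%:E)%E.
  rewrite -muB le_measure// ?inE//.
  by apply: measurableI => //; exact: measurable_ball.
have fA : mu (A `&` ball t r) \is a fin_num.
  by rewrite ge0_fin_numE//; apply: le_lt_trans le1 _; rewrite ltry.
rewrite /= [X in (_ / X)%E]lebesgue_measure_ball ?(ltW r0)//.
rewrite inver mulrn_eq0/= gt_eqF//= fineM// ler_pdivrMr ?mulrn_wgt0//=.
rewrite -lee_fin fineK//; apply: le_trans le1 _; rewrite lee_fin.
rewrite le_eqVlt; apply/orP; left; apply/eqP.
by rewrite /r; field; rewrite gt_eqF// addr_gt0.
Qed.
End porous.

(** * Sets that are null on coordinate lines, and Tonelli's theorem *)

Section fubini_model.
Context {R : realType}.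
Notation mu := (@lebesgue_measure R).

Definition borelV n : set (set 'rV[R]_n) := <<s [set A | open A] >>.

Definition row_cons n (t : R) (z : 'rV[R]_n) : 'rV[R]_n.+1 :=
  \row_i oapp (z 0) t (unlift ord0 i).

Lemma row_cons0 n t (z : 'rV[R]_n) : row_cons t z 0 ord0 = t.
Proof. by rewrite mxE unlift_none. Qed.

Lemma row_consS n t (z : 'rV[R]_n) k : row_cons t z 0 (lift ord0 k) = z 0 k.
Proof. by rewrite mxE liftK. Qed.

Definition null_on_lines n (i : 'I_n) (E : set 'rV[R]_n) :=
  forall x, mu.-negligible [set t | E (x + t *: delta_mx 0 i)].

Lemma line_coord n (x : 'rV[R]_n) s (k i : 'I_n) :
  (x + s *: delta_mx 0 k) 0 i = x 0 i + s * (i == k)%:R.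
Proof. by rewrite !mxE. Qed.

Lemma row_cons_line0 n t (z : 'rV[R]_n) :
  row_cons t z = row_cons 0 z + t *: delta_mx 0 ord0.
Proof.
apply/rowP => i; rewrite line_coord.
have [k ->|->] := unliftP ord0 i.
  by rewrite !row_consS eq_sym (negbTE (neq_lift _ _)) mulr0 addr0.
by rewrite !row_cons0 eqxx mulr1 add0r.
Qed.

Lemma row_cons_lineS n t (z : 'rV[R]_n) (k : 'I_n) s :
  row_cons t (z + s *: delta_mx 0 k) =
  row_cons t z + s *: delta_mx 0 (lift ord0 k).
Proof.
apply/rowP => i; rewrite line_coord.
have [j ->|->] := unliftP ord0 i.
  by rewrite !row_consS line_coord (inj_eq lift_inj).
by rewrite !row_cons0 (negbTE (neq_lift _ _)) mulr0 addr0.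
Qed.

Lemma row_cons_near n t (z : 'rV[R]_n) (O : set 'rV[R]_n.+1) :
  open O -> O (row_cons t z) -> exists2 e, 0 < e &
    forall t' z', `|t - t'| < e -> ball z e z' -> O (row_cons t' z').
Proof.
move=> oO Ox; have /nbhs_ballP[e /= e0 eO] : nbhs (row_cons t z) O.
  exact: open_nbhs_nbhs.
exists e => // t' z' tt' [_ zz']; apply: eO; split => // i j.
rewrite (ord1 i); have [k ->|->] := unliftP ord0 j.
  by rewrite !row_consS; exact: zz'.
by rewrite !row_cons0.
Qed.

Lemma row_cons_continuous n t : continuous (@row_cons n t).
Proof.
move=> z A /nbhs_ballP[e /= e0 eA]; apply/nbhs_ballP; exists e => //.
move=> z' [_ zz']; apply: eA; split => // i j.
rewrite (ord1 i); have [k ->|->] := unliftP ord0 j.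
  by rewrite !row_consS; exact: zz'.
by rewrite !row_cons0; exact: ballxx.
Qed.

Lemma borelV_preimage m n (h : 'rV[R]_m -> 'rV[R]_n) (E : set 'rV[R]_n) :
  continuous h -> borelV E -> borelV (h @^-1` E).
Proof.
move=> ch; move: E; apply: smallest_sub => /=.
  split.
  - by rewrite /= preimage_set0; exact: sigma_algebra0.
  - move=> A; rewrite /= setTD preimage_setC -setTD; exact: sigma_algebraCD.
  - by move=> F; rewrite /= preimage_bigcup; exact: sigma_algebra_bigcup.
move=> A oA; apply: sub_sigma_algebra; exact: open_comp.
Qed.

(* Stands for Lebesgue measure on R^n, which the library does not provide as a
   measure on row vectors. *)
Definition fubini_model n d (T : measurableType d)
    (nu : {sigma_finite_measure set T -> \bar R}) (iota : T -> 'rV[R]_n) :=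
  [/\ forall E, borelV E -> measurable (iota @^-1` E),
      forall O, open O -> O !=set0 -> (0 < nu (iota @^-1` O))%E &
      forall i E, borelV E -> null_on_lines i E -> nu (iota @^-1` E) = 0%E].

Lemma preimage_open_borel n d (T : measurableType d) (iota : T -> 'rV[R]_n) :
  (forall O, open O -> measurable (iota @^-1` O)) ->
  forall E, borelV E -> measurable (iota @^-1` E).
Proof.
move=> mO E; move: E; apply: smallest_sub => //=; split => /=.
- by rewrite preimage_set0.
- by move=> A mA; rewrite setTD preimage_setC; exact: measurableC.
- by move=> F mF; rewrite preimage_bigcup; exact: bigcupT_measurable.
Qed.

Section step.
Context (n : nat) d (T : measurableType d).
Variables (nu : {sigma_finite_measure set T -> \bar R}) (iota : T -> 'rV[R]_n).
Hypothesis model : fubini_model nu iota.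

Let iotaS (p : R * T) : 'rV[R]_n.+1 := row_cons p.1 (iota p.2).

Lemma step_measurable E : borelV E -> measurable (iotaS @^-1` E).
Proof.
move: E; apply: preimage_open_borel => O oO.
(* [U p q] is the largest open set whose product with []p, q[] fits into [O]. It is open whatever
   the number of sets [V], so only the rational endpoints have to be countable. *)
pose U (p q : rat) : set 'rV[R]_n := \bigcup_(V in [set V | open V /\
  forall t z, ratr p < t < ratr q -> V z -> O (row_cons t z)]) V.
have -> : iotaS @^-1` O = \bigcup_p \bigcup_q
    (`]ratr p, ratr q[%classic `*` iota @^-1` U p q).
  apply/seteqP; split => [[t y] /= Oty|[t y] [p _ [q _]]].
    have [e e0 eO] := row_cons_near oO Oty.
    have [p /[!in_itv]/= /andP[p1 p2]] : exists p, ratr p \in `]t - e, t[%R.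
      by apply: rat_in_itvoo; rewrite gtrBl.
    have [q /[!in_itv]/= /andP[q1 q2]] : exists q, ratr q \in `]t, t + e[%R.
      by apply: rat_in_itvoo; rewrite ltrDl.
    exists p => //; exists q => //; split => /=; first by rewrite in_itv/= p2.
    exists (ball (iota y) e); last exact: ballxx.
    split; first exact: ball_open.
    move=> t' z /andP[pt tq]; apply: eO.
    by rewrite ltr_distlC (lt_trans p1 pt) (lt_trans tq q2).
  rewrite /= in_itv/= => -[/= tpq [V [_ VO] Vy]]; exact: VO.
apply: bigcupT_measurable_rat => p; apply: bigcupT_measurable_rat => q.
apply: measurableX => //; case: model => mE _ _; apply: mE.
by apply: sub_sigma_algebra; apply: bigcup_open => V [].
Qed.

(** For direction 0 the sections at fixed [y] are null by hypothesis; for a later direction the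
    sections at fixed [t] are null by the model one dimension lower. Tonelli's theorem exchanges the
    two orders, so that in either case almost every line in direction 0 meets [E] in a null set. *)
Lemma step_null (i : 'I_n.+1) E : borelV E -> null_on_lines i E ->
  (\int[nu]_y mu (ysection (iotaS @^-1` E) y) = 0)%E /\
  (mu \x nu)%E (iotaS @^-1` E) = 0%E.
Proof.
move=> bE lE; have mE := step_measurable bE.
have eqG := indic_fubini_tonelli mu nu mE.
rewrite indic_fubini_tonelli_FE// indic_fubini_tonelli_GE// in eqG.
have prodE : (mu \x nu)%E (iotaS @^-1` E) =
  (\int[nu]_y mu (ysection (iotaS @^-1` E) y))%E := eqG.
have {eqG} := eqG.
suff prod0 : (mu \x nu)%E (iotaS @^-1` E) = 0%E by rewrite -prodE.
have [k ik|i0] := unliftP ord0 i.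
  rewrite /product_measure1; apply: integral0_eq => t _ /=.
  have -> : xsection (iotaS @^-1` E) t = iota @^-1` (row_cons t @^-1` E).
    by rewrite xsectionE.
  case: model => _ _ nullE; apply: (nullE k).
    exact: (borelV_preimage (@row_cons_continuous _ _)).
  move=> z; have := lE (row_cons t z); rewrite ik.
  by under eq_set do rewrite -row_cons_lineS.
rewrite prodE; apply: integral0_eq => y _ /=.
have := lE (row_cons 0 (iota y)); rewrite i0.
under eq_set do rewrite -row_cons_line0.
move/(negligibleP) => H; rewrite ysectionE; apply: H.
by have := measurable_ysection y mE; rewrite ysectionE.
Qed.

Lemma step_model : exists d' (T' : measurableType d')
    (nu' : {sigma_finite_measure set T' -> \bar R}) (iota' : T' -> 'rV[R]_n.+1),
  fubini_model nu' iota'.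
Proof.
(* The library's own sigma-finite instance for [\x] is shadowed by the one for
   subprobabilities, so it is rebuilt from its mixins. *)
pose prod := HB.pack_for {sigma_finite_measure set (measurableTypeR R * T)%type -> \bar R}
  (mu \x nu)%E
  (lebesgue_integral_fubini.measure_function_Measure_isSigmaFinite__to__measure_function_isSFinite mu nu)
  (lebesgue_integral_fubini.measure_function_Measure_isSigmaFinite__to__measure_function_isSigmaFinite mu nu).
exists _, _, prod, iotaS; split.
- exact: step_measurable.
- move=> O oO [x Ox].
  have xE : x = row_cons (x 0 ord0) (\row_k x 0 (lift ord0 k)).
    apply/rowP => j; have [k ->|->] := unliftP ord0 j.
      by rewrite row_consS mxE.
    by rewrite row_cons0.
  rewrite xE in Ox; have [e e0 eO] := row_cons_near oO Ox.
  set t := x 0 ord0 in Ox eO; set z := \row_k _ in Ox eO.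
  case: model => mE posO _.
  have oB : open (ball z e) by exact: ball_open.
  have mB : measurable (iota @^-1` ball z e).
    by apply: mE; exact: sub_sigma_algebra.
  apply: (@lt_le_trans _ _ ((mu \x nu)%E (ball t e `*` iota @^-1` ball z e))).
    rewrite product_measure1E//; last exact: measurable_ball.
    apply: mule_gt0.
      by rewrite [ltRHS]lebesgue_measure_ball ?ltW// lte_fin mulrn_wgt0.
    by apply: posO => //; exists z; exact: ballxx.
  apply: le_measure; rewrite ?inE.
  + by apply: measurableX => //; exact: measurable_ball.
  + by apply: step_measurable; exact: sub_sigma_algebra.
  + by move=> [t' y] [/= ? ?]; exact: eO.
- by move=> i E bE lE; have [] := step_null bE lE.
Qed.

(** The exceptional [y] form a null set for [nu], which cannot contain the preimage of [O], as that
    has positive measure. *)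
Lemma step_exists (E : 'I_n.+1 -> set 'rV[R]_n.+1) (O : set 'rV[R]_n) :
  (forall i, borelV (E i)) -> (forall i, null_on_lines i (E i)) ->
  open O -> O !=set0 -> exists2 y, O y &
    mu.-negligible [set t | exists i, E i (row_cons t y)].
Proof.
move=> bE lE oO O0; case: (model) => mE posO _.
have ae0 i : {ae nu, forall y, mu (ysection (iotaS @^-1` (E i)) y) = 0%E}.
  have [int0 _] := step_null (bE i) (lE i).
  have mi := step_measurable (bE i).
  have := (ae_eq_integral_abs nu measurableT (measurable_fun_ysection mu mi)).1.
  rewrite /=; under eq_integral do rewrite gee0_abs//.
  move=> /(_ int0); apply: filterS => y; exact.
have {}ae0 : {ae nu, forall y, forall i, mu (ysection (iotaS @^-1` (E i)) y) = 0%E}.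
  by apply: filter_forall.
have [y Oy y0] : exists2 y, O (iota y) &
    forall i, mu (ysection (iotaS @^-1` (E i)) y) = 0%E.
  apply: contrapT => noy; case: ae0 => N [mN N0 subN].
  have : nu (iota @^-1` O) = 0%E.
    apply: subset_measure0 N0 => //.
      by apply: mE; exact: sub_sigma_algebra.
    by move=> y Oy; apply: subN => /= H; apply: noy; exists y.
  by have := posO O oO O0 => /[swap] ->; rewrite ltxx.
exists (iota y) => //.
have : {ae mu, forall t, forall i, ~ E i (row_cons t (iota y))}.
  have FF := ae_filter_ringOfSetsType mu.
  apply: (@filter_forall _ _ _ _ FF) => i.
  exists (ysection (iotaS @^-1` (E i)) y); split; [|exact: y0|].
    exact: measurable_ysection (step_measurable (bE i)).
  by move=> t /= /contrapT; rewrite ysectionE.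
by apply: negligibleS => t /= [i Ei] /(_ i).
Qed.
End step.

Lemma fubini_model_exists n : exists d (T : measurableType d)
    (nu : {sigma_finite_measure set T -> \bar R}) (iota : T -> 'rV[R]_n),
  fubini_model nu iota.
Proof.
elim: n => [|n [d [T [nu [iota model]]]]]; last exact: step_model model.
(* In dimension 0 there is one point and no coordinate direction, so any nonzero measure will do. *)
pose delta : {sigma_finite_measure set (measurableTypeR R) -> \bar R} :=
  @dirac _ (measurableTypeR R) 0 R.
exists _, _, delta, (fun=> 0); split.
- by apply: preimage_open_borel => O _; rewrite preimage_cst; case: ifPn.
- move=> O _ [x Ox]; rewrite preimage_cst mem_set.
    by rewrite /= diracT.
  by have -> : 0 = x by apply/rowP => -[].
- by case.
Qed.

(** What later sections take from the model: every line in direction 0 has parallels, as close as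
    desired, that meet all the sets [E i] in null sets. *)
Lemma exists_line_null n (E : 'I_n.+1 -> set 'rV[R]_n.+1) (O : set 'rV[R]_n) :
  (forall i, borelV (E i)) -> (forall i, null_on_lines i (E i)) ->
  open O -> O !=set0 -> exists2 y, O y &
    mu.-negligible [set t | exists i, E i (row_cons t y)].
Proof.
have [d [T [nu [iota model]]]] := fubini_model_exists n.
move=> bE lE oO O0; exact: (step_exists model bE lE oO O0).
Qed.
End fubini_model.

(** * Sup norms of matrices and differentiability by estimates *)

Section matrix_norm.
Context {R : realType}.

Lemma mx_entry_le m n (A : 'M[R]_(m, n)) i j : `|A i j| <= `|A|.
Proof.
rewrite [leRHS]/Num.Def.normr /= mx_normrE.
exact: (le_bigmax _ (fun ij : 'I_m * 'I_n => `|A ij.1 ij.2|) (i, j)).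
Qed.

Lemma mx_norm_le m n (A : 'M[R]_(m, n)) e :
  0 <= e -> (forall i j, `|A i j| <= e) -> `|A| <= e.
Proof.
move=> e0 Ae; rewrite [leLHS]/Num.Def.normr /= mx_normrE.
by apply/bigmax_leP; split => // -[i j] _; exact: Ae.
Qed.

Lemma norm_mulmx_le p m n (u : 'M[R]_(p, m)) (A : 'M[R]_(m, n)) :
  `|u *m A| <= m%:R * `|A| * `|u|.
Proof.
apply: mx_norm_le => [|i j]; first by rewrite !mulr_ge0.
rewrite mxE (le_trans (ler_norm_sum _ _ _))//.
apply: (@le_trans _ _ (\sum_(k < m) `|A| * `|u|)).
  by apply: ler_sum => k _; rewrite normrM mulrC ler_pM// mx_entry_le.
by rewrite sumr_const card_ord -[leLHS]mulr_natl mulrA.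
Qed.

Lemma norm_delta_mx n (i : 'I_n) : `|delta_mx 0 i : 'rV[R]_n| = 1.
Proof.
apply/eqP; rewrite eq_le; apply/andP; split.
  apply: mx_norm_le => // a j; rewrite mxE.
  by case: (_ && _); rewrite ?normr0 ?normr1.
by have := mx_entry_le (delta_mx 0 i : 'rV[R]_n) 0 i; rewrite mxE !eqxx normr1.
Qed.

Lemma lipschitz_continuous (V W : normedModType R) (f : V -> W) K :
  (forall x y, `|f x - f y| <= K * `|x - y|) -> continuous f.
Proof.
move=> fK x; apply/cvgrPdist_lt => e e0.
have K0 : 0 < `|K| + 1 by rewrite ltr_wpDl.
near=> y; apply: le_lt_trans (fK x y) _.
apply: (@le_lt_trans _ _ ((`|K| + 1) * `|x - y|)).
  by rewrite ler_wpM2r// (le_trans (ler_norm _))// lerDl.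
rewrite -ltr_pdivlMl// mulrC; near: y.
by apply: cvgr_dist_lt => //; rewrite divr_gt0.
Unshelve. all: by end_near. Qed.

Lemma mulmxr_continuous m n (A : 'M[R]_(m, n)) :
  continuous (fun u : 'rV[R]_m => u *m A).
Proof.
apply: (@lipschitz_continuous _ _ _ (m%:R * `|A|)) => x y.
by rewrite -mulmxBl norm_mulmx_le.
Qed.

Lemma differentiable_epsP (V W : normedModType R) (F : V -> W) x
    (df : {linear V -> W}) : continuous df ->
  (forall e, 0 < e -> exists2 d, 0 < d &
    forall h, `|h| < d -> `|F (x + h) - F x - df h| <= e * `|h|) <->
  differentiable F x /\ 'd F x = df :> (V -> W).
Proof.
move=> cdf; split=> [FA|[dF JA] e e0].
  have FA' : F \o shift x = cst (F x) + df +o_ 0 id.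
    apply/eqaddoP => e e0; have [d d0 H] := FA _ e0.
    apply/nbhs_ballP; exists d => //= h; rewrite -ball_normE /= sub0r normrN => hd.
    by have := H _ hd; rewrite (addrC x) -addrA -opprD; exact.
  have dE := diff_unique cdf FA'.
  split=> //; apply/diff_locallyP; split; first by rewrite dE.
  by rewrite dE.
have /diff_locallyP[_ /eqaddoP/(_ _ e0)] := dF.
move=> /nbhs_ballP[d /= d0 H]; exists d => // h hd.
have /H : ball (0 : V) d h by rewrite -ball_normE /= sub0r normrN.
by rewrite -JA (addrC x) -addrA -opprD; exact.
Qed.

Lemma differentiable_mxP m n (F : 'rV[R]_m -> 'rV[R]_n) x (A : 'M[R]_(m, n)) :
  (forall e, 0 < e -> exists2 d, 0 < d &
    forall h, `|h| < d -> `|F (x + h) - F x - h *m A| <= e * `|h|) <->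
  differentiable F x /\ 'J F x = A.
Proof.
rewrite (@differentiable_epsP _ _ F x (mulmxr A) (@mulmxr_continuous _ _ A)).
split=> -[dF dE]; split=> //.
  by apply/row_matrixP => i; rewrite !rowE /jacobian mul_rV_lin1 dE.
by apply/funext => h; rewrite -dE /= /jacobian mul_rV_lin1.
Qed.
Lemma line_continuous n (q v : 'rV[R]_n) : continuous (fun s : R => q + s *: v).
Proof.
apply: (@lipschitz_continuous _ _ _ `|v|) => s t.
by rewrite opprD addrACA subrr add0r -scalerBl normrZ mulrC.
Qed.

Lemma segment_in_ball m (p q q' : 'rV[R]_m) (s r : R) : 0 <= s <= 1 ->
  `|q - p| < r -> `|q' - p| < r -> `|q + s *: (q' - q) - p| < r.
Proof.
move=> /andP[s0 s1] qr qr'.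
have -> : q + s *: (q' - q) - p = (1 - s) *: (q - p) + s *: (q' - p).
  by apply/rowP => j; rewrite !mxE; ring.
apply: le_lt_trans (ler_normD _ _) _; rewrite !normrZ.
rewrite (ger0_norm s0) ger0_norm ?subr_ge0//.
have [->|sn0] := eqVneq s 0; first by rewrite mul0r addr0 subr0 mul1r.
have sp : 0 < s by rewrite lt_def sn0.
have : s * `|q' - p| < s * r by rewrite ltr_pM2l.
have : (1 - s) * `|q - p| <= (1 - s) * r.
  by apply: ler_wpM2l; [rewrite subr_ge0|exact: ltW].
lra.
Qed.

End matrix_norm.

(** * Exceptional sets and porosity along a coordinate direction *)

Section line_null.
Context {R : realType}.
Notation mu := (@lebesgue_measure R).

Lemma exists_invSn_lt (d : R) : 0 < d -> exists k : nat, k.+1%:R^-1 < d.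
Proof.
move=> d0; have [k _ kd] := near_infty_natSinv_lt (PosNum d0).
by exists k; exact: (kd k (leqnn k)).
Qed.

Lemma bigcup_unpickle (I : countType) T (S : I -> set T) :
  \bigcup_j S j = \bigcup_k oapp S set0 (unpickle k).
Proof.
apply/seteqP; split => [x [j _ Sx]|x [k _]].
  by exists (pickle j) => //; rewrite pickleK.
by case: (unpickle k) => //= j Sx; exists j.
Qed.

Lemma borelVE n (E : set 'rV[R]_n) :
  borelV E = @measurable _ (g_sigma_algebraType [set A : set 'rV[R]_n | open A]) E.
Proof. by []. Qed.

Lemma borelV_open n (E : set 'rV[R]_n) : open E -> borelV E.
Proof. by move=> oE; exact: sub_sigma_algebra. Qed.

Lemma borelV_setC n (E : set 'rV[R]_n) : borelV E -> borelV (~` E).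
Proof. by rewrite !borelVE; exact: measurableC. Qed.

Lemma borelV_closed n (E : set 'rV[R]_n) : closed E -> borelV E.
Proof.
move=> cE; rewrite -(setCK E); apply: borelV_setC; apply: borelV_open.
exact: closed_openC.
Qed.

Lemma borelV_setI n (E F : set 'rV[R]_n) :
  borelV E -> borelV F -> borelV (E `&` F).
Proof. by rewrite !borelVE; exact: measurableI. Qed.

Lemma borelV_bigcup n (I : countType) (E : I -> set 'rV[R]_n) :
  (forall j, borelV (E j)) -> borelV (\bigcup_j E j).
Proof.
move=> bE; rewrite bigcup_unpickle borelVE; apply: bigcupT_measurable => k.
by case: (unpickle k) => [j|] /=; [exact: bE|exact: measurable0].
Qed.

Lemma borelV_bigcap n (I : countType) (E : I -> set 'rV[R]_n) :
  (forall j, borelV (E j)) -> borelV (\bigcap_j E j).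
Proof.
move=> bE; rewrite -(setCK (\bigcap_j _)) setC_bigcap; apply: borelV_setC.
by apply: borelV_bigcup => j; exact: borelV_setC.
Qed.

(* A substitute for Lebesgue null sets of R^n that needs only one-dimensional
   measure theory. *)
Definition line_null n (S : set 'rV[R]_n) := exists E : 'I_n -> set 'rV[R]_n,
  [/\ forall i, borelV (E i), forall i, null_on_lines i (E i) &
      S `<=` \bigcup_i E i].

Lemma line_null_sub n (A B : set 'rV[R]_n) :
  A `<=` B -> line_null B -> line_null A.
Proof. by move=> AB [E [bE nE /(subset_trans AB)]]; exists E. Qed.

Lemma line_null_bigcup n (I : countType) (S : I -> set 'rV[R]_n) :
  (forall j, line_null (S j)) -> line_null (\bigcup_j S j).
Proof.
move=> /choice[E HE]; exists (fun i => \bigcup_j E j i); split => [i|i x|x].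
- by apply: borelV_bigcup => j; case: (HE j).
- rewrite bigcup_unpickle.
  apply: (@negligibleS _ _ _ mu (\bigcup_k [set t |
      oapp (E^~ i) set0 (unpickle k) (x + t *: delta_mx 0 i)])).
    by move=> t [k _ Et]; exists k.
  apply: negligible_bigcup => k; case: (unpickle k) => [j|] /=.
    by case: (HE j) => _ /(_ i x).
  exact: negligible_set0.
- by move=> [j _]; case: (HE j) => _ _ /[apply] -[i _ Ex]; exists i => //; exists j.
Qed.

Lemma line_null_setU n (A B : set 'rV[R]_n) :
  line_null A -> line_null B -> line_null (A `|` B).
Proof.
move=> nA nB; apply: (@line_null_sub _ _ (\bigcup_(b : bool) if b then A else B)).
  by move=> x [Ax|Bx]; [exists true|exists false].
by apply: line_null_bigcup => -[].
Qed.

Lemma line_null1 n i (E : set 'rV[R]_n) :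
  borelV E -> null_on_lines i E -> line_null E.
Proof.
move=> bE nE; exists (fun j => if j == i then E else set0); split => [j|j x|x Ex].
- by case: ifP => // _; exact: sigma_algebra0.
- by case: eqP => [->|_]; [exact: nE|exact: negligible_set0].
- by exists i => //; rewrite eqxx.
Qed.

(** The hole is a full ball of R^n, and the strict inequality [c * |s| < e] leaves room to move [x]:
    at a fixed scale [d] the existence of a hole is an open condition, which makes the porous points
    of a closed set a Borel set. *)
Definition porous_along n (i : 'I_n) (c : R) (A : set 'rV[R]_n) x :=
  A x /\ forall d, 0 < d -> exists s e, [/\ 0 < `|s| < d, c * `|s| < e &
    forall y, `|y - (x + s *: delta_mx 0 i)| < e -> ~ A y].

(** A line in direction [i] cuts every hole centred on it in a one-dimensional hole, so the porous
    points on the line form a null set. *)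
Lemma porous_along_null n (i : 'I_n) (c : R) (A : set 'rV[R]_n) :
  closed A -> 0 < c <= 1 -> line_null (porous_along i c A).
Proof.
move=> cA c01; apply: (@line_null1 _ i) => [|x].
  pose O k := [set x | exists s e, [/\ 0 < `|s| < k.+1%:R^-1, c * `|s| < e &
    forall y, `|y - (x + s *: delta_mx 0 i)| < e -> ~ A y]].
  have -> : porous_along i c A = A `&` \bigcap_(k : nat) O k.
    apply/seteqP; split => x [Ax Px]; split => //.
      by move=> k _; apply: Px; rewrite invr_gt0.
    move=> d d0; have [k kd] := exists_invSn_lt d0.
    by have [s [e [/andP[s0 sk] se H]]] := Px k I; exists s, e; split => //;
      rewrite s0 (lt_trans sk).
  apply: borelV_setI; first exact: borelV_closed.
  apply: borelV_bigcap => k; apply: borelV_open.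
  rewrite openE => x [s [e [sk se H]]]; apply/nbhs_ballP.
  exists ((e - c * `|s|) / 2); first by rewrite /= divr_gt0// subr_gt0.
  move=> x'; rewrite -ball_normE /= => xx'.
  exists s, (e - (e - c * `|s|) / 2); split => //; first by lra.
  move=> y ye; apply: H.
  have -> : y - (x + s *: delta_mx 0 i) =
      (y - (x' + s *: delta_mx 0 i)) - (x - x').
    by move: (s *: _) => v; apply/rowP => j; rewrite !mxE; ring.
  by apply: le_lt_trans (ler_normB _ _) _; lra.
apply: negligibleS (porous_negligible _ c01 : mu.-negligible
    [set t | [set t | A (x + t *: delta_mx 0 i)] t /\
       porous_at [set t | A (x + t *: delta_mx 0 i)] c t]).
  move=> t [At Pt]; split => // d d0; have [s [e [sd se H]]] := Pt d d0.
  exists s; split => // u us; apply: H; apply: le_lt_trans se.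
  have -> : x + u *: delta_mx 0 i - (x + t *: delta_mx 0 i + s *: delta_mx 0 i)
      = (u - (t + s)) *: delta_mx 0 i.
    by apply/rowP => j; rewrite !mxE; ring.
  by rewrite normrZ norm_delta_mx mulr1 ltW.
apply: closed_measurable.
exact: ((continuous_closedP _).1 (@line_continuous _ _ x (delta_mx 0 i)) _ cA).
Qed.
End line_null.

(** * Rademacher's theorem *)

Section rademacher.
Context {R : realType}.
Notation mu := (@lebesgue_measure R).

Lemma rat_mx_approx m n (A : 'M[R]_(m, n)) (e : R) : 0 < e ->
  exists B : 'M[rat]_(m, n), `|map_mx ratr B - A| <= e.
Proof.
move=> e0; have /choice[q qP] : forall ij : 'I_m * 'I_n,
    exists q : rat, ratr q \in `](A ij.1 ij.2), (A ij.1 ij.2 + e)[%R.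
  by move=> ij; apply: rat_in_itvoo; rewrite ltrDl.
exists (\matrix_(i, j) q (i, j)); apply: mx_norm_le => [|i j]; first exact: ltW.
rewrite !mxE; have := qP (i, j); rewrite in_itv/= => /andP[q1 q2].
by rewrite ger0_norm ?subr_ge0 ?ltW// ltrBlDl.
Qed.

Lemma closed_norm_family (J : Type) (P : J -> Prop) (V W : normedModType R)
    (F : V -> W) (u : J -> V) (c : J -> W) (r : J -> R) (L : R)
    (F_lip : forall x y, `|F x - F y| <= L * `|x - y|) :
  closed [set x | forall j, P j -> `|F (x + u j) - F x - c j| <= r j].
Proof.
have -> : [set x | forall j, P j -> `|F (x + u j) - F x - c j| <= r j] =
    \bigcap_(j in P) [set x | `|F (x + u j) - F x - c j| <= r j] by [].
apply: closed_bigI => j _.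
have cg : continuous (fun x => `|F (x + u j) - F x - c j| : R).
  apply: (@lipschitz_continuous _ _ _ _ (L + L)) => x y.
  apply: le_trans (ler_dist_dist _ _) _.
  have -> : F (x + u j) - F x - c j - (F (y + u j) - F y - c j) =
      (F (x + u j) - F (y + u j)) - (F x - F y).
    rewrite opprB addrA addrNK !opprB [in LHS](addrC (F y)) addrACA.
    by rewrite (addrC (- F x)).
  apply: le_trans (ler_normB _ _) _; rewrite mulrDl lerD//.
  by apply: le_trans (F_lip _ _) _; rewrite opprD addrACA subrr addr0.
exact: ((continuous_closedP _).1 cg _ (@closed_le R (r j))).
Qed.

Section lipschitz_map.
Variables (n m : nat) (F : 'rV[R]_n -> 'rV[R]_m) (L : R).
Hypothesis L0 : 0 <= L.
Hypothesis F_lip : forall x y, `|F x - F y| <= L * `|x - y|.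

Definition dir_approx (i : 'I_n) (b : 'rV[R]_m) (e d : R) (x : 'rV[R]_n) :=
  forall t, `|t| < d ->
    `|F (x + t *: delta_mx 0 i) - F x - t *: b| <= e * `|t|.

Definition first_coords (k : nat) (h : 'rV[R]_n) :=
  forall i : 'I_n, (k <= i)%N -> h 0 i = 0.

Definition sub_approx (k : nat) (a : 'M[R]_(n, m)) (e d : R) (x : 'rV[R]_n) :=
  forall h, first_coords k h /\ `|h| < d ->
    `|F (x + h) - F x - h *m a| <= e * `|h|.

Lemma closed_dir_approx i b e d : closed (dir_approx i b e d).
Proof. exact: closed_norm_family. Qed.

Lemma closed_sub_approx k a e d : closed (sub_approx k a e d).
Proof. exact: closed_norm_family. Qed.

(** A substitute for the existence of the partial derivative. With rational [b] and scales
    [1 / (q + 1)] it is built from countably many closed conditions, so it is Borel. *)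
Definition dir_good (i : 'I_n) (x : 'rV[R]_n) := forall p : nat,
  exists (q : nat) (b : 'rV[rat]_m),
    dir_approx i (map_mx ratr b) p.+1%:R^-1 q.+1%:R^-1 x.

Lemma dir_good_line (i : 'I_n) (x : 'rV[R]_n) (t : R) :
  derivable (fun t : R => F (x + t *: delta_mx 0 i)) t 1 ->
  dir_good i (x + t *: delta_mx 0 i).
Proof.
pose G (t : R) := F (x + t *: delta_mx 0 i).
move=> /derivable1_diffP; rewrite -/G => dG p.
have cdG : continuous ('d G t) by exact: diff_continuous.
have e0 : 0 < p.+1%:R^-1 / 2 :> R by rewrite divr_gt0// invr_gt0.
have [_ /(_ (conj dG erefl))] := differentiable_epsP G t cdG.
move=> /(_ _ e0)[d d0 dP].
have [q qd] := exists_invSn_lt d0.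
have [b bP] := rat_mx_approx ('d G t 1) e0.
exists q, b => s sq.
have -> : F (x + t *: delta_mx 0 i + s *: delta_mx 0 i) -
    F (x + t *: delta_mx 0 i) - s *: map_mx ratr b =
    (G (t + s) - G t - 'd G t s) - s *: (map_mx ratr b - 'd G t 1).
  have -> : 'd G t s = s *: 'd G t 1 by rewrite -linearZ/= [s *: _]mulr1.
  by rewrite /G scalerDl addrA scalerBr opprB addrA addrNK.
apply: le_trans (ler_normB _ _) _; rewrite normrZ.
rewrite (splitr p.+1%:R^-1) mulrDl lerD//.
  by apply: dP; exact: lt_trans sq _.
by rewrite mulrC ler_wpM2r.
Qed.

Lemma dir_good_null i : line_null (~` dir_good i).
Proof.
apply: (@line_null1 _ _ i) => [|x].
  apply: borelV_setC.
  have -> : dir_good i = \bigcap_(p : nat) \bigcup_(qb : nat * 'rV[rat]_m)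
      dir_approx i (map_mx ratr qb.2) p.+1%:R^-1 qb.1.+1%:R^-1.
    apply/seteqP; split => x Hx p.
      by move=> _; have [q [b H]] := Hx p; exists (q, b).
    by have [[q b] _ H] := Hx p I; exists q, b.
  apply: borelV_bigcap => p; apply: borelV_bigcup => qb.
  by apply: borelV_closed; exact: closed_dir_approx.
have dG (j : 'I_m) : {ae mu, forall t,
    derivable (fun t : R => F (x + t *: delta_mx 0 i) 0 j) t 1}.
  apply: (@lipschitz_derivable_ae _ _ L) => s t.
  have -> : F (x + s *: delta_mx 0 i) 0 j - F (x + t *: delta_mx 0 i) 0 j =
      (F (x + s *: delta_mx 0 i) - F (x + t *: delta_mx 0 i)) 0 j by rewrite !mxE.
  apply: le_trans (mx_entry_le _ _ _) _; apply: le_trans (F_lip _ _) _.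
  have -> : x + s *: delta_mx 0 i - (x + t *: delta_mx 0 i) =
      (s - t) *: delta_mx 0 i by apply/rowP => k; rewrite !mxE; ring.
  by rewrite normrZ norm_delta_mx mulr1.
have : {ae mu, forall t, forall j : 'I_m,
    derivable (fun t : R => F (x + t *: delta_mx 0 i) 0 j) t 1}.
  have FF := ae_filter_ringOfSetsType mu.
  exact: (@filter_forall _ _ _ _ FF).
apply: negligibleS => t /= ngood dFj; apply: ngood; apply: dir_good_line.
by apply/derivable_mxP => a j; rewrite (ord1 a).
Qed.

Definition sub_good (k : nat) (x : 'rV[R]_n) := forall e, 0 < e ->
  exists a d, 0 < d /\ sub_approx k a e d x.

(* If x + s e_i is close to a point y of the approximation set A containing x,
   then F (x + h' + s e_i) - F x is F (y + h') - F y plus F (x + s e_i) - F x up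
   to a Lipschitz error. *)
Lemma sub_good_step (i : 'I_n) x : sub_good i x -> dir_good i x ->
  (forall p q (a : 'M[rat]_(n, m)) (b : 'rV[rat]_m),
    ~ porous_along i p.+1%:R^-1
      (sub_approx i (map_mx ratr a) p.+1%:R^-1 q.+1%:R^-1 `&`
       dir_approx i (map_mx ratr b) p.+1%:R^-1 q.+1%:R^-1) x) ->
  sub_good i.+1 x.
Proof.
move=> sx dx npx e e0.
have K0 : 0 < 2 + 4 * L by rewrite ltr_wpDr// mulr_ge0.
(* The errors add up to [2 + 4 * L] times [c * |h|]: one [c] for each of the two approximations, and
   [2 * L * c] for each of the two Lipschitz errors made when [x + s e_i] is replaced by [y]. *)
have [p pe] : exists p : nat, p.+1%:R^-1 < e / (2 + 4 * L).
  by apply: exists_invSn_lt; exact: divr_gt0.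
set c : R := p.+1%:R^-1 in pe.
have c0 : 0 < c by rewrite invr_gt0.
have ce : (2 + 4 * L) * c <= e by rewrite mulrC -ler_pdivlMr// ltW.
have c20 : 0 < c / 2 by rewrite divr_gt0.
have [a0 [d [d0 a0P]]] := sx _ c20.
have n0 : 0 < n%:R :> R by rewrite ltr0n (leq_ltn_trans _ (ltn_ord i)).
have [a aP] := rat_mx_approx a0 (divr_gt0 c20 n0).
have [q' [b bP]] := dx p.
have [q qd] : exists q : nat, q.+1%:R^-1 < Num.min d q'.+1%:R^-1.
  by apply: exists_invSn_lt; rewrite lt_min d0 invr_gt0/=.
move: qd; rewrite lt_min => /andP[qd qq'].
set A := sub_approx i (map_mx ratr a) c q.+1%:R^-1 `&`
         dir_approx i (map_mx ratr b) c q.+1%:R^-1.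
have Ax : A x.
  split; last by move=> t tq; apply: bP; exact: lt_trans tq _.
  move=> h [hi hq]; have := a0P h (conj hi (lt_trans hq qd)).
  have -> : F (x + h) - F x - h *m map_mx ratr a =
      (F (x + h) - F x - h *m a0) - h *m (map_mx ratr a - a0).
    by rewrite mulmxBr opprB addrA addrNK.
  move=> H; apply: le_trans (ler_normB _ _) _.
  rewrite (splitr c) mulrDl lerD//.
  apply: le_trans (norm_mulmx_le _ _) _; rewrite ler_wpM2r//.
  by rewrite mulrC -ler_pdivlMr.
(* Non-porosity, read positively: for small [s], points of [A] lie at distance about [c * |s|] from
   [x + s e_i]. *)
have [d1 d10 d1P] : exists2 d1, 0 < d1 & forall s e', 0 < `|s| < d1 ->
    c * `|s| < e' -> exists2 y, `|y - (x + s *: delta_mx 0 i)| < e' & A y.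
  apply: contrapT => H; apply: (npx p q a b); split => // d1 d10.
  apply: contrapT => H1; apply: H; exists d1 => // s e' sd se'.
  apply: contrapT => H2; apply: H1; exists s, e'; split => // y ye Ay.
  by apply: H2; exists y.
(* The matrix [a] with its row [i] replaced by [b]. *)
pose a' := map_mx ratr a +
  delta_mx i 0 *m (map_mx ratr b - row i (map_mx ratr a)) : 'M[R]_(n, m).
exists a', (Num.min d1 q.+1%:R^-1); split; first by rewrite lt_min d10 invr_gt0/=.
move=> h []; rewrite lt_min => hi /andP[hd1 hq].
pose s := h 0 i; pose h' := h - s *: delta_mx 0 i.
have sh : `|s| <= `|h| by exact: mx_entry_le.
have h'h : `|h'| <= `|h|.
  apply: mx_norm_le => // z j; rewrite (ord1 z) !mxE eqxx /=.
  have [->|ji] := eqVneq j i; first by rewrite mulr1 subrr normr0.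
  by rewrite mulr0 subr0; exact: mx_entry_le.
have h'i : first_coords i h'.
  move=> j ij; rewrite !mxE eqxx /=; have [->|ji] := eqVneq j i.
    by rewrite mulr1 subrr.
  rewrite mulr0 subr0; apply: hi; rewrite ltn_neqAle ij andbT.
  by apply: contra ji => /eqP ij'; apply/eqP/val_inj.
have hE : h = h' + s *: delta_mx 0 i by rewrite subrK.
have ha' : h *m a' = h' *m map_mx ratr a + s *: map_mx ratr b.
  have h'0 : h' *m (delta_mx i 0 : 'cV[R]_n) = 0.
    by apply/rowP => j; rewrite (ord1 j) -colE !mxE !eqxx mulr1 subrr.
  rewrite {1}hE mulmxDl /a' !mulmxDr !mulmxA h'0 !mul0mx !addr0; congr (_ + _).
  rewrite -!scalemxAl mul_delta_mx.
  have -> : (delta_mx 0 0 : 'M[R]_1) = 1%:M.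
    by apply/matrixP => u v; rewrite !ord1 !mxE.
  by rewrite !mul1mx -rowE -!scalerDr addrC subrK.
have [s0|s0] := eqVneq s 0.
  have -> : h = h' by rewrite /h' s0 scale0r subr0.
  rewrite (_ : h' *m a' = h' *m map_mx ratr a); last first.
    by have := ha'; rewrite hE s0 !scale0r !addr0.
  have := Ax.1 h' (conj h'i (le_lt_trans h'h hq)).
  move=> /le_trans; apply; rewrite ler_wpM2r// (le_trans _ ce)//.
  by rewrite ler_peMl ?ltW//; have := L0; lra.
have sd1 : 0 < `|s| < d1 by rewrite normr_gt0 s0 (le_lt_trans sh).
have cs : c * `|s| < 2 * c * `|s|.
  by rewrite -mulrA ltr_pMl ?ltr1n// mulr_gt0// normr_gt0.
have [y yx [ya _]] := d1P _ _ sd1 cs.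
have T1 := Ax.2 s (le_lt_trans sh hq).
have T2 := ya h' (conj h'i (le_lt_trans h'h hq)).
have T3 := F_lip (x + h) (y + h').
have T4 := F_lip (x + s *: delta_mx 0 i) y.
have E3 : `|x + h - (y + h')| = `|y - (x + s *: delta_mx 0 i)|.
  rewrite distrC; congr `|_|; rewrite {1}hE; move: (h') (s *: _) => u v.
  by apply/rowP => j; rewrite !mxE; ring.
rewrite E3 in T3; rewrite (distrC (x + s *: delta_mx 0 i) y) in T4.
have T34 : L * `|y - (x + s *: delta_mx 0 i)| <= 2 * L * c * `|h|.
  apply: (@le_trans _ _ (L * (2 * c * `|s|))).
    by rewrite ler_wpM2l// ltW.
  have : L * c * `|s| <= L * c * `|h| by rewrite ler_wpM2l// mulr_ge0// ltW.
  by lra.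
have -> : F (x + h) - F x - h *m a' =
    (F (x + s *: delta_mx 0 i) - F x - s *: map_mx ratr b) +
    (F (y + h') - F y - h' *m map_mx ratr a) +
    (F (x + h) - F (y + h')) - (F (x + s *: delta_mx 0 i) - F y).
  rewrite ha'; move: (F _) (F _) (F _) (F _) (F _) (s *: _) (_ *m _) => *.
  by apply/rowP => j; rewrite !mxE; ring.
apply: le_trans (ler_normB _ _) _.
have := ler_normD (F (x + s *: delta_mx 0 i) - F x - s *: map_mx ratr b +
    (F (y + h') - F y - h' *m map_mx ratr a)) (F (x + h) - F (y + h')).
have := ler_normD (F (x + s *: delta_mx 0 i) - F x - s *: map_mx ratr b)
    (F (y + h') - F y - h' *m map_mx ratr a).
have cs' : c * `|s| <= c * `|h| by rewrite ler_wpM2l// ltW.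
have ch' : c * `|h'| <= c * `|h| by rewrite ler_wpM2l// ltW.
have ceh : (2 + 4 * L) * c * `|h| <= e * `|h| by rewrite ler_wpM2r.
lra.
Qed.

(** Coordinates are adjoined one at a time. Each one costs the points without a partial derivative
    in its direction and countably many porous sets, one for every accuracy, scale and choice of
    rational data. *)
Lemma sub_good_null k : (k <= n)%N -> line_null (~` sub_good k).
Proof.
elim: k => [_|k IH kn].
  exists (fun=> set0); split => [i|i x|x ng]; first exact: sigma_algebra0.
    exact: negligible_set0.
  exfalso; apply: ng => e e0; exists 0, 1; split => // h [hk _].
  have -> : h = 0 by apply/rowP => i; rewrite hk// mxE.
  by rewrite addr0 mul0mx subrr subr0 !normr0 mulr0.
pose i := Ordinal kn.
pose S (w : (nat * nat) * ('M[rat]_(n, m) * 'rV[rat]_m)) :=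
  porous_along i w.1.1.+1%:R^-1
    (sub_approx i (map_mx ratr w.2.1) w.1.1.+1%:R^-1 w.1.2.+1%:R^-1 `&`
     dir_approx i (map_mx ratr w.2.2) w.1.1.+1%:R^-1 w.1.2.+1%:R^-1).
apply: (@line_null_sub _ _ _ (~` sub_good k `|` (~` dir_good i `|` \bigcup_w S w))).
  move=> x /= ng; apply: contrapT => /not_orP[/contrapT gx /not_orP[/contrapT dx nS]].
  apply: ng; apply: (@sub_good_step i) => // p q a b Hp; apply: nS.
  by exists ((p, q), (a, b)).
apply: line_null_setU; first exact/IH/ltnW.
apply: line_null_setU; first exact: dir_good_null.
apply: line_null_bigcup => w; apply: porous_along_null.
  by apply: closedI; [exact: closed_sub_approx|exact: closed_dir_approx].
by rewrite invr_gt0 ltr0Sn/= invf_le1// ler1n.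
Qed.

Lemma sub_approx_close x a e d a' e' d' : 0 < d -> 0 < d' ->
  0 <= e -> 0 <= e' -> sub_approx n a e d x -> sub_approx n a' e' d' x ->
  `|a - a'| <= e + e'.
Proof.
move=> d0 d'0 e0 e'0 Ha Ha'; apply: mx_norm_le => [|i j]; first exact: addr_ge0.
have [t [t0 td td']] := exists_pos_lt2 d0 d'0.
pose h : 'rV[R]_n := t *: delta_mx 0 i.
have hE : `|h| = t by rewrite normrZ norm_delta_mx mulr1 gtr0_norm.
have hn : first_coords n h by move=> k; rewrite leqNgt ltn_ord.
rewrite -hE in td td'.
have := Ha h (conj hn td); have := Ha' h (conj hn td'); rewrite hE => H' H.
have : `|h *m (a - a')| <= (e + e') * t.
  have -> : h *m (a - a') = (F (x + h) - F x - h *m a') - (F (x + h) - F x - h *m a).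
    by rewrite mulmxBr opprB [RHS]addrC addrA addrNK.
  by apply: le_trans (ler_normB _ _) _; rewrite mulrDl addrC lerD.
rewrite -scalemxAl -rowE normrZ gtr0_norm// mulrC ler_pM2r//.
by apply: le_trans; have := mx_entry_le (row i (a - a')) 0 j; rewrite mxE.
Qed.

(** Goodness provides one matrix for each accuracy. Two approximations at the same point differ by
    at most the sum of their errors, so these matrices form a Cauchy sequence, and its limit is the
    Jacobian. *)
Lemma sub_good_differentiable x : sub_good n x -> differentiable F x.
Proof.
move=> gx; have /choice[ad adP] : forall k : nat, exists ad : 'M[R]_(n, m) * R,
    0 < ad.2 /\ sub_approx n ad.1 k.+1%:R^-1 ad.2 x.
  move=> k; have [|a [d adP]] := gx k.+1%:R^-1; first by rewrite invr_gt0.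
  by exists (a, d).
pose a k := (ad k).1.
have close j k : (k <= j)%N -> `|a k - a j| <= 2 * k.+1%:R^-1.
  move=> kj; have [dk aPk] := adP k; have [dj aPj] := adP j.
  apply: le_trans (sub_approx_close dk dj _ _ aPk aPj) _; rewrite ?invr_ge0//.
  by rewrite mulr_natl mulr2n lerD2l lef_pV2 ?posrE// ler_nat.
have cva : cvgn a.
  apply: cauchy_cvg; apply: cauchy_exP => e e0.
  have [k ke] := exists_invSn_lt (divr_gt0 e0 (ltr0n R 2)).
  exists (a k), k => // j /= kj; rewrite -ball_normE /=.
  by apply: le_lt_trans (close _ _ kj) _; rewrite mulrC -ltr_pdivlMr.
have lim_close k : `|a k - limn a| <= 3 * k.+1%:R^-1.
  have k0 : 0 < k.+1%:R^-1 :> R by rewrite invr_gt0.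
  have /cvgrPdist_le/(_ _ k0)[N _ HN] := cva.
  have := HN (maxn N k) (leq_maxl _ _); have := close _ _ (leq_maxr N k).
  move=> H1 H2; rewrite -(subrK (a (maxn N k)) (a k)) -addrA.
  apply: le_trans (ler_normD _ _) _; rewrite (distrC _ (limn a)).
  by move: k.+1%:R^-1 H1 H2 => c; lra.
suff : differentiable F x /\ 'J F x = limn a by case.
apply/differentiable_mxP => e e0.
have K0 : 0 < 1 + 3 * n%:R :> R by rewrite ltr_pwDl// mulr_ge0.
have [k ke] := exists_invSn_lt (divr_gt0 e0 K0).
have [dk aPk] := adP k; exists (ad k).2 => // h hd.
have hn : first_coords n h by move=> i; rewrite leqNgt ltn_ord.
have -> : F (x + h) - F x - h *m limn a =
    (F (x + h) - F x - h *m a k) + h *m (a k - limn a).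
  by rewrite mulmxBr addrA addrNK.
apply: le_trans (ler_normD _ _) _.
have H1 := aPk h (conj hn hd).
have H2 := norm_mulmx_le h (a k - limn a).
have H3 : n%:R * `|a k - limn a| * `|h| <= n%:R * (3 * k.+1%:R^-1) * `|h|.
  by rewrite ler_wpM2r// ler_wpM2l.
have H4 : k.+1%:R^-1 * (1 + 3 * n%:R) * `|h| <= e * `|h|.
  by rewrite ler_wpM2r// -ler_pdivlMr// ltW.
by rewrite -/(a k) in H1; move: k.+1%:R^-1 H1 H3 H4 => c; lra.
Qed.

Theorem rademacher : line_null [set x | ~ differentiable F x].
Proof.
apply: line_null_sub (sub_good_null (leqnn n)) => x.
exact: contra_not (@sub_good_differentiable x).
Qed.
End lipschitz_map.
End rademacher.

(** * Mean value inequality *)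

Section mean_value.
Context {R : realType}.
Notation mu := (@lebesgue_measure R).

Lemma differentiable_mx_affine k n m (F : 'rV[R]_n -> 'rV[R]_m) (x : 'rV[R]_n)
    (T : 'M[R]_(k, n)) (y : 'rV[R]_k) (A : 'M[R]_(n, m)) :
  differentiable F (x + y *m T) /\ 'J F (x + y *m T) = A ->
  differentiable (fun y => F (x + y *m T)) y /\
  'J (fun y => F (x + y *m T)) y = T *m A.
Proof.
move=> /differentiable_mxP FA; apply/differentiable_mxP => e e0.
have K0 : 0 < k%:R * `|T| + 1 by rewrite ltr_wpDl// mulr_ge0.
have [d d0 H] := FA _ (divr_gt0 e0 K0).
exists (d / (k%:R * `|T| + 1)); first exact: divr_gt0.
move=> h; rewrite ltr_pdivlMr// => hd.
have hT : `|h *m T| <= (k%:R * `|T| + 1) * `|h|.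
  by apply: le_trans (norm_mulmx_le _ _) _; rewrite ler_wpM2r// lerDl.
rewrite mulmxDl addrA mulmxA; apply: le_trans (H _ _) _.
  by apply: le_lt_trans hT _; rewrite mulrC.
apply: le_trans (ler_wpM2l _ hT) _; first by rewrite divr_ge0// ltW.
by rewrite mulrA divfK// gt_eqF.
Qed.

Lemma differentiable_mx_near n m (F G : 'rV[R]_n -> 'rV[R]_m) x A (r : R) :
  0 < r -> (forall h, `|h| < r -> F (x + h) = G (x + h)) ->
  differentiable F x /\ 'J F x = A -> differentiable G x /\ 'J G x = A.
Proof.
move=> r0 FG /differentiable_mxP FA; apply/differentiable_mxP => e e0.
have [d d0 H] := FA _ e0; exists (Num.min d r); first by rewrite lt_min d0.
move=> h; rewrite lt_min => /andP[hd hr]; rewrite -FG//.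
by have := FG 0; rewrite addr0 normr0 => <-//; exact: H.
Qed.

Lemma is_derive_epsP (W : normedModType R) (g : R -> W) (u : R) (D : W) :
  (forall e, 0 < e -> exists2 d, 0 < d &
    forall s, `|s| < d -> `|g (u + s) - g u - s *: D| <= e * `|s|) ->
  is_derive u 1 g D.
Proof.
have lin : linear (fun s : R => s *: D).
  by move=> a x y; rewrite scalerDl scalerA.
pose lm := GRing.isLinear.Build _ _ _ _ _ lin.
pose df : {linear R -> W} := HB.pack (fun s : R => s *: D) lm.
have cdf : continuous df.
  apply: (@lipschitz_continuous _ _ _ _ `|D|) => x y.
  by rewrite /= -scalerBl normrZ mulrC.
move=> /(differentiable_epsP g u cdf)[dg gE].
split; first exact: diff_derivable.
by rewrite deriveE// gE /= scale1r.
Qed.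

(** If the inequality failed on one segment, it would by continuity fail on all nearby parallel
    ones, namely for [z'] in the open set [O']. On one of these [F] is differentiable at almost
    every point, and the one-dimensional bound applies to [F] paired with [w]. *)
Lemma mean_value_first n m (F : 'rV[R]_n.+1 -> 'rV[R]_m) (L : R) (L0 : 0 <= L)
    (F_lip : forall x y, `|F x - F y| <= L * `|x - y|)
    (O : set 'rV[R]_n.+1) (oO : open O)
    (cO : forall a b, O a -> O b ->
       forall t, 0 <= t <= 1 -> O (a + t *: (b - a)))
    (w : 'cV[R]_m) (s : R)
    (Os : forall q, O q -> differentiable F q ->
       s <= ((delta_mx 0 0 : 'rV[R]_n.+1) *m 'J F q *m w) 0 0)
    (x0 t : R) (z : 'rV[R]_n) (t0 : 0 < t) :
  O (row_cons x0 z) -> O (row_cons (x0 + t) z) ->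
  s * t <= ((F (row_cons (x0 + t) z) - F (row_cons x0 z)) *m w) 0 0.
Proof.
move=> Oz Otz; rewrite leNgt; apply/negP => lt_st.
pose G (z : 'rV[R]_n) : R :=
  ((F (row_cons (x0 + t) z) - F (row_cons x0 z)) *m w) 0 0.
have cF : continuous F by exact: (lipschitz_continuous F_lip).
have cG : continuous G.
  move=> z'; rewrite /G.
  apply: (@continuous_comp _ _ _ (fun z => (F (row_cons (x0 + t) z) -
    F (row_cons x0 z)) *m w) (fun M : 'M[R]_1 => M 0 0)); last exact: coord_continuous.
  apply: (@continuous_comp _ _ _ (fun z => F (row_cons (x0 + t) z) -
    F (row_cons x0 z)) (fun u => u *m w)); last exact: mulmxr_continuous.
  apply: continuousB; apply: continuous_comp; try exact: cF;
    exact: row_cons_continuous.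
pose O' : set 'rV[R]_n := (row_cons x0 @^-1` O) `&`
  ((row_cons (x0 + t) @^-1` O) `&` (G @^-1` [set y | y < s * t])).
have oO' : open O'.
  apply: openI; [|apply: openI]; apply: open_comp => //.
  - by move=> ? _; exact: row_cons_continuous.
  - by move=> ? _; exact: row_cons_continuous.
have [E [bE nE subE]] := rademacher L0 F_lip.
have [z' [Oz' [Otz' Gz']] nz'] :=
  exists_line_null bE nE oO' (ex_intro _ z (conj Oz (conj Otz lt_st))).
move: Gz'; rewrite /= ltNge => /negP; apply.
pose g (u : R) : R := (F (row_cons u z') *m w) 0 0.
have gE : G z' = g (x0 + t) - g x0 by rewrite /G /g mulmxBl !mxE.
have rcB (u v : R) : row_cons u z' - row_cons v z' = (u - v) *: delta_mx 0 0.
  by rewrite (row_cons_line0 u) (row_cons_line0 v) opprD addrACA subrr add0r scalerBl.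
have g_lip u v : `|g u - g v| <= (m%:R * `|w| * L) * `|u - v|.
  have -> : g u - g v = ((F (row_cons u z') - F (row_cons v z')) *m w) 0 0.
    by rewrite /g mulmxBl !mxE.
  apply: le_trans (mx_entry_le _ _ _) _; apply: le_trans (norm_mulmx_le _ _) _.
  rewrite -[leRHS]mulrA ler_wpM2l ?mulr_ge0//; apply: le_trans (F_lip _ _) _.
  by rewrite rcB normrZ norm_delta_mx mulr1.
rewrite gE; have -> : s * t = s * (x0 + t - x0) by rewrite addrC addKr.
apply: (lipschitz_derive_ge g_lip); first by rewrite ltrDl.
have : {ae mu, forall u, forall i, ~ E i (row_cons u z')}.
  by apply: negligibleS nz' => u /= /existsNP[i /contrapT Ei]; exists i.
move=> /lebesgue_ae_imply; apply => u nEu /andP[xu ux] _.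
have dF : differentiable F (row_cons u z').
  by apply: contrapT => /subE[i _]; exact: nEu.
have Ou : O (row_cons u z').
  have := cO _ _ Oz' Otz' ((u - x0) / t).
  have -> : row_cons x0 z' + (u - x0) / t *: (row_cons (x0 + t) z' - row_cons x0 z')
      = row_cons u z'.
    rewrite rcB scalerA (addrC x0) addrK divfK ?gt_eqF// -rcB addrC subrK//.
  apply; rewrite divr_ge0 ?subr_ge0 ?(ltW xu) ?(ltW t0)//= ler_pdivrMr// mul1r.
  by rewrite lerBlDl ltW.
apply: le_trans (Os _ Ou dF) _; rewrite le_eqVlt; apply/orP; left; apply/eqP.
have /differentiable_mxP dA := conj dF (erefl ('J F (row_cons u z'))).
have gD : is_derive u 1 g (((delta_mx 0 0 : 'rV[R]_n.+1) *m 'J F (row_cons u z') *m w) 0 0).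
  apply: is_derive_epsP => e e0.
  have K0 : 0 < m%:R * `|w| + 1 by rewrite ltr_wpDl// mulr_ge0.
  have [d d0 H] := dA _ (divr_gt0 e0 K0); exists d => // h hd.
  have hE : `|h *: (delta_mx 0 0 : 'rV[R]_n.+1)| = `|h|.
    by rewrite normrZ norm_delta_mx mulr1.
  have := H (h *: delta_mx 0 0); rewrite hE => /(_ hd).
  have -> : row_cons u z' + h *: delta_mx 0 0 = row_cons (u + h) z'.
    by rewrite (addrC u) -[RHS](subrK (row_cons u z')) rcB addrK addrC.
  set B := _ - _ - _ => HB.
  have -> : g (u + h) - g u - h *: ((delta_mx 0 0 : 'rV[R]_n.+1) *m
      'J F (row_cons u z') *m w) 0 0
      = (B *m w) 0 0.
    by rewrite /B /g !mulmxBl -!scalemxAl !mxE.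
  apply: le_trans (mx_entry_le _ _ _) _; apply: le_trans (norm_mulmx_le _ _) _.
  apply: (@le_trans _ _ ((m%:R * `|w| + 1) * `|B|)).
    by rewrite ler_wpM2r// lerDl.
  by rewrite mulrC -ler_pdivlMr// mulrAC.
by rewrite derive1E (@derive_val _ _ _ _ _ _ _ gD).
Qed.
End mean_value.

Section mean_value_local.
Context {R : realType}.

(** For [r >= 0], the coordinatewise projection onto the closed sup-norm ball. As it is
    nonexpansive, composing with it extends a map that is Lipschitz on a ball to the whole space
    with the same constant. *)
Definition clampV n (p : 'rV[R]_n) (r : R) (x : 'rV[R]_n) : 'rV[R]_n :=
  \row_i Num.max (p 0 i - r) (Num.min (x 0 i) (p 0 i + r)).

Lemma max_nonexpansive (b s t : R) : `|Num.max b s - Num.max b t| <= `|s - t|.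
Proof.
rewrite ler_norml; have := ler_norm (s - t); have := ler_norm (t - s).
rewrite (distrC t); have := normr_ge0 (s - t).
by case: (leP b s); case: (leP b t) => *; apply/andP; split; lra.
Qed.

Lemma min_nonexpansive (b s t : R) : `|Num.min s b - Num.min t b| <= `|s - t|.
Proof.
rewrite ler_norml; have := ler_norm (s - t); have := ler_norm (t - s).
rewrite (distrC t); have := normr_ge0 (s - t).
by case: (leP s b); case: (leP t b) => *; apply/andP; split; lra.
Qed.

Lemma clampV_nonexpansive n (p : 'rV[R]_n) r x y :
  `|clampV p r x - clampV p r y| <= `|x - y|.
Proof.
apply: mx_norm_le => // a i; rewrite (ord1 a) !mxE.
apply: le_trans (_ : `|(x - y) 0 i| <= _); last exact: mx_entry_le.
rewrite !mxE; apply: le_trans (max_nonexpansive _ _ _) (min_nonexpansive _ _ _).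
Qed.

Lemma clampV_in n (p : 'rV[R]_n) r x : 0 <= r -> `|clampV p r x - p| <= r.
Proof.
move=> r0; apply: mx_norm_le => // a i; rewrite (ord1 a) !mxE ler_norml.
case: (leP (x 0 i)) => ?; case: (leP (p 0 i - r)) => ? //; try (apply/andP; split); lra.
Qed.

Lemma clampV_id n (p : 'rV[R]_n) r x : `|x - p| <= r -> clampV p r x = x.
Proof.
move=> xp; apply/rowP => i; rewrite !mxE.
have := le_trans (mx_entry_le (x - p) 0 i) xp; rewrite !mxE ler_norml.
case: (leP (x 0 i)) => ?; case: (leP (p 0 i - r)) => ? //; try (apply/andP; split); lra.
Qed.

(** The rank normal form of a nonzero row has rank one, so [v] is a multiple of the first row of the
    invertible matrix [row_ebase v]. The matrix [T] is the change of coordinates that turns [v] into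
    the first axis. *)
Lemma row_extend_unitmx n (v : 'rV[R]_n.+1) : v != 0 ->
  exists2 T, T \in unitmx & v = delta_mx 0 0 *m T.
Proof.
move=> v0; pose c := col_ebase v 0 0.
have vE : v = c *: (delta_mx 0 0 *m row_ebase v).
  have -> : c *: (delta_mx 0 0 *m row_ebase v) =
    col_ebase v *m pid_mx (\rank v) *m row_ebase v; last by rewrite mulmx_ebase.
  rewrite scalemxAl; congr (_ *m _); rewrite rank_rV v0.
  apply/rowP => j; rewrite !mxE big_ord_recl big_ord0 addr0 -/c !mxE; congr (_ * _).
  by rewrite eqxx eq_sym/= andbC; case: j => -[].
have c0 : c != 0 by apply: contraNneq v0 => c0; rewrite vE c0 scale0r.
exists (c *: row_ebase v); last by rewrite -scalemxAr.
by rewrite unitmxZ ?unitfE// row_ebase_unit.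
Qed.

(** Clamping makes [F] globally Lipschitz, and a linear change of coordinates turns [v] into the
    first basis vector; this brings the claim to [mean_value_first]. *)
Lemma mean_value_local n m (F : 'rV[R]_n -> 'rV[R]_m) (p : 'rV[R]_n) (r L : R)
    (L0 : 0 <= L)
    (F_lip : forall x y, `|x - p| < r -> `|y - p| < r -> `|F x - F y| <= L * `|x - y|)
    (w : 'cV[R]_m) (s : R) (v : 'rV[R]_n) (v0 : v != 0)
    (Fs : forall q, `|q - p| < r -> differentiable F q ->
       s <= (v *m 'J F q *m w) 0 0)
    (x : 'rV[R]_n) :
  `|x - p| < r -> `|x + v - p| < r -> s <= ((F (x + v) - F x) *m w) 0 0.
Proof.
case: n => [|n] in F p F_lip v v0 Fs x * => [|xr xvr].
  by have : v == 0 by [apply/eqP/rowP => -[]]; rewrite (negbTE v0).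
(* Strictly between the distances of both endpoints and [r]: on the open ball of radius [r'] the
   clamped map coincides with [F] near every point, so it has the same derivatives. *)
pose r' := (Num.max `|x - p| `|x + v - p| + r) / 2.
have [r'r [xr' xvr']] : r' < r /\ `|x - p| < r' /\ `|x + v - p| < r'.
  by rewrite /r'; case: (leP `|x - p|) => ?; split; [|split| |split]; lra.
have r'0 : 0 < r' by apply: le_lt_trans xr'.
pose F1 y := F (clampV p r' y).
have F1_lip y z : `|F1 y - F1 z| <= L * `|y - z|.
  apply: le_trans (F_lip _ _ _ _) _; rewrite ?(le_lt_trans (clampV_in _ _ (ltW _)))//.
  by rewrite ler_wpM2l// clampV_nonexpansive.
have F1E y : `|y - p| < r' -> F1 y = F y by move=> yr; rewrite /F1 clampV_id// ltW.
have [T uT vE] := row_extend_unitmx v0.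
pose F2 y := F1 (x + y *m T).
pose K := n.+1%:R * `|T|; have K0 : 0 <= K by rewrite mulr_ge0.
have F2_lip y z : `|F2 y - F2 z| <= L * K * `|y - z|.
  apply: le_trans (F1_lip _ _) _; rewrite -mulrA ler_wpM2l//.
  by rewrite opprD addrACA subrr add0r -mulmxBl norm_mulmx_le.
pose O := [set y : 'rV[R]_n.+1 | `|x + y *m T - p| < r'].
have oO : open O.
  have cg : continuous (fun y : 'rV[R]_n.+1 => `|x + y *m T - p| : R).
    apply: (@lipschitz_continuous _ _ _ _ K) => y z.
    apply: le_trans (ler_dist_dist _ _) _.
    have -> : x + y *m T - p - (x + z *m T - p) = (y - z) *m T.
      by rewrite mulmxBl opprB addrA addrNK opprD addrACA subrr add0r.
    exact: norm_mulmx_le.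
  by apply: (@open_comp _ _ _ [set t | t < r']) => [y _|]; [exact: cg|exact: open_lt].
have cO a b : O a -> O b -> forall t, 0 <= t <= 1 -> O (a + t *: (b - a)).
  move=> Oa Ob t t01; rewrite /O/=.
  have -> : x + (a + t *: (b - a)) *m T = x + a *m T + t *: (x + b *m T - (x + a *m T)).
    by rewrite mulmxDl -scalemxAl mulmxBl addrA opprD addrACA subrr add0r.
  exact: segment_in_ball.
have := @mean_value_first _ _ _ F2 (L * K) (mulr_ge0 L0 K0) F2_lip O oO cO w s
  _ 0 1 0 ltr01.
have rc0 : row_cons 0 0 = 0 :> 'rV[R]_n.+1.
  by apply/rowP => j; rewrite !mxE; case: unlift => //= k; rewrite mxE.
have rc1 : row_cons 1 0 = delta_mx 0 0 :> 'rV[R]_n.+1.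
  by rewrite row_cons_line0 rc0 add0r scale1r.
rewrite add0r mulr1 rc0 rc1 /F2 -vE mul0mx addr0 !F1E//; apply.
- move=> q Oq dq; have /= := Fs (x + q *m T) (lt_trans Oq r'r).
  pose y := x + q *m T.
  have [d1 J1] : differentiable F1 y /\ 'J F1 y = invmx T *m 'J F2 q.
    have -> : F1 = fun y => F2 (- x *m invmx T + y *m invmx T).
      apply/funext => z; rewrite /F2 -mulmxDl mulmxKV// addrA subrr add0r//.
    apply: differentiable_mx_affine.
    by rewrite -mulmxDl /y addrA addNr add0r mulmxK.
  have [d2 J2] : differentiable F y /\ 'J F y = invmx T *m 'J F2 q.
    apply: (@differentiable_mx_near _ _ _ F1 F y _ (r' - `|y - p|)).
    + by rewrite subr_gt0.
    + move=> h hr; apply: F1E; rewrite addrAC.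
      by apply: le_lt_trans (ler_normD _ _) _; rewrite -ltrBrDl.
    + by [].
  by move=> /(_ d2); rewrite J2 vE -[delta_mx 0 0 *m T *m _]mulmxA mulKVmx.
- by rewrite /O /= mul0mx addr0.
- by rewrite /O /= -vE.
Qed.
End mean_value_local.

(** * Clarke's inverse function theorem *)

Section separation.
Context {R : realType}.

Definition dotv n (u v : 'rV[R]_n) : R := (u *m v^T) 0 0.

Lemma dotvE n (u v : 'rV[R]_n) : dotv u v = \sum_i u 0 i * v 0 i.
Proof. by rewrite /dotv mxE; apply: eq_bigr => i _; rewrite mxE. Qed.

Lemma dotvC n (u v : 'rV[R]_n) : dotv u v = dotv v u.
Proof. by rewrite !dotvE; apply: eq_bigr => i _; rewrite mulrC. Qed.

Lemma dotvDr n (u v w : 'rV[R]_n) : dotv u (v + w) = dotv u v + dotv u w.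
Proof. by rewrite /dotv linearD/= mulmxDr mxE. Qed.

Lemma dotvZr n t (u v : 'rV[R]_n) : dotv u (t *: v) = t * dotv u v.
Proof. by rewrite /dotv linearZ/= -scalemxAr mxE. Qed.

Lemma dotvDl n (u v w : 'rV[R]_n) : dotv (v + w) u = dotv v u + dotv w u.
Proof. by rewrite !(dotvC _ u) dotvDr. Qed.

Lemma dotvZl n t (u v : 'rV[R]_n) : dotv (t *: v) u = t * dotv v u.
Proof. by rewrite !(dotvC _ u) dotvZr. Qed.

Lemma dotvNr n (u v : 'rV[R]_n) : dotv u (- v) = - dotv u v.
Proof. by rewrite -scaleN1r dotvZr mulN1r. Qed.

Lemma dotv_le n (u v : 'rV[R]_n) : `|dotv u v| <= n%:R * `|u| * `|v|.
Proof.
apply: le_trans (mx_entry_le _ _ _) _; apply: le_trans (norm_mulmx_le _ _) _.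
rewrite mulrAC ler_wpM2l ?mulr_ge0//.
by apply: mx_norm_le => // i j; rewrite mxE mx_entry_le.
Qed.

Lemma norm_sqr_le_dotv n (u : 'rV[R]_n) : `|u| ^+ 2 <= dotv u u.
Proof.
have d0 : 0 <= dotv u u.
  by rewrite dotvE sumr_ge0// => i _; rewrite -expr2 sqr_ge0.
rewrite -(sqr_sqrtr d0) lerXn2r ?nnegrE ?sqrtr_ge0//.
apply: mx_norm_le => [|a i]; first exact: sqrtr_ge0.
rewrite (ord1 a) -sqrtr_sqr ler_sqrt// dotvE (bigD1 i)//= -expr2 lerDl.
by rewrite sumr_ge0// => j _; rewrite -expr2 sqr_ge0.
Qed.

Lemma dotv_gt0 n (u : 'rV[R]_n) : u != 0 -> 0 < dotv u u.
Proof.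
by move=> u0; apply: lt_le_trans (norm_sqr_le_dotv u); rewrite exprn_gt0 ?normr_gt0.
Qed.

Definition convexV (V : lmodType R) (D : set V) :=
  forall a b, D a -> D b -> forall t, 0 <= t <= 1 -> D (a + t *: (b - a)).

(* An almost nearest point w of D to the origin separates D from the origin;
   the given vector u0 is used when D is empty. *)
Lemma convex_separation n (D : set 'rV[R]_n) (K k : R) (u0 : 'rV[R]_n) :
  u0 != 0 -> convexV D -> (forall d, D d -> `|d| <= K) -> 0 < k ->
  (forall d, D d -> k <= dotv d d) ->
  exists2 w, w != 0 & forall d, D d -> k / 2 <= dotv w d.
Proof.
move=> u00 cD DK k0 Dk; have [D0|] := pselect (D !=set0); last first.
  by move=> noD; exists u0 => // d Dd; exfalso; apply: noD; exists d.
pose E := [set dotv d d | d in D].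
have E_inf : has_inf E.
  by split; [case: D0 => d Dd; exists (dotv d d), d|exists k => _ [d Dd <-]; exact: Dk].
pose M : R := n%:R * (2 * K) * (2 * K) + 1.
have M0 : 0 < M.
  by rewrite ltr_wpDl// -mulrA mulr_ge0//; have := sqr_ge0 (2 * K); rewrite expr2.
(* On the segment from [w] to [d], the quadratic term at parameter [s] is at most [s * (k / 2)].
   With [w] chosen within [s * (k / 2)] of the infimum, the linear term yields
   [dotv w d > dotv w w - k / 2], which is at least [k / 2]. *)
pose s := Num.min 1 (k / (2 * M)).
have s0 : 0 < s by rewrite lt_min ltr01 divr_gt0// mulr_gt0.
have s1 : s <= 1 by rewrite ge_min lexx.
have sM : s * M <= k / 2.
  have : s <= k / (2 * M) by rewrite ge_min lexx orbT.
  by rewrite ler_pdivlMr ?mulr_gt0//; lra.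
have [_ [w Dw <-] wE] := inf_adherent (mulr_gt0 s0 (divr_gt0 k0 (ltr0n R 2))) E_inf.
exists w => [|d Dd].
  apply: contraTneq (Dk w Dw) => ->.
  by rewrite -ltNge dotvE big1// => i _; rewrite mxE mul0r.
have Mle : dotv (d - w) (d - w) <= M.
  apply: le_trans (ler_norm _) _; apply: le_trans (dotv_le _ _) _.
  have dw : `|d - w| <= 2 * K.
    apply: le_trans (ler_normB _ _) _; have := DK _ Dd; have := DK _ Dw; lra.
  apply: (@le_trans _ _ (n%:R * (2 * K) * (2 * K))); last by rewrite /M lerDl.
  by rewrite -[leLHS]mulrA -[leRHS]mulrA ler_wpM2l// ler_pM.
have inf_le : inf E <= dotv (w + s *: (d - w)) (w + s *: (d - w)).
  apply: ge_inf; first by case: E_inf.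
  by exists (w + s *: (d - w)) => //; apply: cD => //; rewrite s1 ltW.
have wk := Dk _ Dw.
rewrite !dotvDl !dotvDr !dotvZl !dotvZr (dotvC (d - w) w) in inf_le.
rewrite dotvDr dotvNr in inf_le.
have ss : s * (s * dotv (d - w) (d - w)) <= s * (k / 2).
  by rewrite ler_wpM2l ?(ltW s0)//; apply: le_trans sM; rewrite ler_wpM2l// ltW.
have : 0 < s * (k / 2 + 2 * (dotv w d - dotv w w) + k / 2).
  by move: inf_le wE ss; set X := dotv (d - w) _; lra.
by rewrite pmulr_rgt0//; lra.
Qed.
End separation.

Lemma unit_sphere_compact (R : realType) n :
  compact [set v : 'rV[R]_n | `|v| = 1].
Proof.
apply: bounded_closed_compact.
  by exists 1; split=> // x x1 v /= ->; exact: ltW.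
have cn : continuous (fun v : 'rV[R]_n => `|v| : R).
  apply: (@lipschitz_continuous _ _ _ _ 1) => u v; rewrite mul1r.
  exact: ler_dist_dist.
exact: ((continuous_closedP _).1 cn _ (@closed_eq R 1)).
Qed.

Lemma closed_ball_compact (R : realType) n (p : 'rV[R]_n) (r : R) :
  compact [set v : 'rV[R]_n | `|v - p| <= r].
Proof.
apply: bounded_closed_compact.
  exists (r + `|p|); split=> [|x rx v /= vr]; first exact: num_real.
  apply: le_trans _ (ltW rx); rewrite -(subrK p v).
  by apply: le_trans (ler_normD _ _) _; rewrite lerD2r.
have cn : continuous (fun v : 'rV[R]_n => `|v - p| : R).
  apply: (@lipschitz_continuous _ _ _ _ 1) => u v; rewrite mul1r.
  by apply: le_trans (ler_dist_dist _ _) _; rewrite opprB addrA addrNK.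
exact: ((continuous_closedP _).1 cn _ (@closed_le R r)).
Qed.

(** * Equivalence of norms on R^n *)

Section norms.
Context {R : realType}.

Definition is_norm n (a : 'rV[R]_n -> R) :=
  [/\ forall v, 0 <= a v, forall v, a v = 0 -> v = 0,
      forall t v, a (t *: v) = `|t| * a v & forall v w, a (v + w) <= a v + a w].

Variables (n : nat) (a : 'rV[R]_n -> R).
Hypothesis na : is_norm a.

Lemma is_norm0 : a 0 = 0.
Proof. by case: na => _ _ aZ _; rewrite -(scale0r 0) aZ normr0 mul0r. Qed.

Lemma is_normN v : a (- v) = a v.
Proof. by case: na => _ _ aZ _; rewrite -scaleN1r aZ normrN1 mul1r. Qed.

Lemma is_normB v w : a v - a w <= a (v - w).
Proof. by case: na => _ _ _ aD; rewrite lerBlDr -{1}(subrK w v) aD. Qed.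

Lemma is_norm_gt0 v : v != 0 -> 0 < a v.
Proof.
case: na => a0 aE _ _ v0; rewrite lt_neqAle a0 andbT eq_sym.
by apply: contra v0 => /eqP/aE ->.
Qed.

Lemma is_norm_le : exists2 C, 0 < C & forall v, a v <= C * `|v|.
Proof.
have [a0 _ aZ aD] := na.
exists (\sum_(i < n) a (delta_mx 0 i) + 1).
  by rewrite ltr_wpDl// sumr_ge0.
move=> v; apply: (@le_trans _ _ ((\sum_(i < n) a (delta_mx 0 i)) * `|v|)); last first.
  by rewrite ler_wpM2r// lerDl.
rewrite {1}(row_sum_delta v) mulr_suml.
elim/big_ind2 : _ => [|x u y t xu yt|i _].
- by rewrite is_norm0.
- by apply: le_trans (aD _ _) _; exact: lerD.
- by rewrite aZ mulrC ler_wpM2l// mx_entry_le.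
Qed.

Lemma is_norm_continuous : continuous a.
Proof.
have [C C0 aC] := is_norm_le.
apply: (@lipschitz_continuous _ _ _ _ C) => v w; rewrite ler_norml.
have H1 := is_normB v w; have H2 := is_normB w v; have H3 := aC (v - w).
rewrite -(opprB v w) is_normN in H2.
by apply/andP; split; lra.
Qed.

Lemma is_norm_ge : exists2 c, 0 < c & forall v, c * `|v| <= a v.
Proof.
have [a0 aE aZ aD] := na.
pose S := [set v : 'rV[R]_n | `|v| = 1].
have cS : compact S by exact: unit_sphere_compact.
(* The sphere is empty in dimension 0, where any constant works. *)
have [S0|noS] := pselect (S !=set0); last first.
  exists 1 => // v; have [->|v0] := eqVneq v 0; first by rewrite normr0 mulr0.
  exfalso; apply: noS; exists (`|v|^-1 *: v).
  by rewrite /S /= normrZ normfV normr_id mulVf// normr_eq0.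
have [w Sw wmin] := EVT_min_rV S0 cS (continuous_subspaceT is_norm_continuous).
rewrite inE in Sw; exists (a w).
  apply: is_norm_gt0; apply/eqP => w0; move: Sw.
  by rewrite w0 /S/= normr0 => /eqP; rewrite eq_sym oner_eq0.
move=> v; have [->|v0] := eqVneq v 0; first by rewrite normr0 mulr0.
have nv : 0 < `|v| by rewrite normr_gt0.
have := wmin (`|v|^-1 *: v).
rewrite inE /S /= normrZ normfV normr_id mulVf ?gt_eqF// => /(_ erefl).
by rewrite aZ normfV normr_id mulrC ler_pdivlMr.
Qed.
End norms.

(** * Convex neighbourhoods of the Clarke differential *)

Section clarke_neighborhood.
Context {R : realType}.

Lemma convex_hull_convex (V : lmodType R) (S : set V) : convexV (convex_hull S).
Proof.
move=> _ _ [k [c [s [c0 c1 Ss ->]]]] [k' [c' [s' [c'0 c'1 S's ->]]]] t /andP[t0 t1].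
exists (k + k')%N,
  (fun i => match fintype.split i with inl j => (1 - t) * c j | inr j => t * c' j end),
  (fun i => match fintype.split i with inl j => s j | inr j => s' j end).
have sl (j : 'I_k) : fintype.split (lshift k' j) = inl j := unsplitK (inl j).
have sr (j : 'I_k') : fintype.split (rshift k j) = inr j := unsplitK (inr j).
split => [i||i|].
- by case: fintype.split => j; rewrite mulr_ge0// subr_ge0.
- rewrite big_split_ord; under eq_bigr do rewrite sl.
  under [X in _ + X = _]eq_bigr do rewrite sr.
  by rewrite -!mulr_sumr c1 c'1 !mulr1 subrK.
- by case: fintype.split => j.
rewrite big_split_ord; under [in RHS]eq_bigr do rewrite sl -scalerA.
under [X in _ = _ + X]eq_bigr do rewrite sr -scalerA.
rewrite -!scaler_sumr scalerBl scale1r scalerBr.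
by rewrite addrAC -addrA.
Qed.

Lemma convex_hull_norm (V : normedModType R) (S : set V) (K : R) :
  (forall A, S A -> `|A| <= K) -> forall A, convex_hull S A -> `|A| <= K.
Proof.
move=> SK _ [k [c [s [c0 c1 Ss ->]]]].
apply: le_trans (ler_norm_sum _ _ _) _.
apply: (@le_trans _ _ (\sum_(i < k) c i * K)); last by rewrite -mulr_suml c1 mul1r.
by apply: ler_sum => i _; rewrite normrZ ger0_norm// ler_wpM2l// SK.
Qed.

Lemma convex_hull_sub (V : lmodType R) (S : set V) : S `<=` convex_hull S.
Proof.
move=> x Sx; exists 1%N, (fun=> 1), (fun=> x); split => //; rewrite ?big_ord1//.
by rewrite scale1r.
Qed.

Lemma cvg_invSn (V : normedModType R) (u : nat -> V) (l : V) :
  (forall k, `|l - u k| < k.+1%:R^-1) -> u @ \oo --> l.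
Proof.
move=> ul; apply/cvgrPdist_lt => e e0; have [k ke] := exists_invSn_lt e0.
exists k => // j /= kj; apply: lt_trans (ul j) _; apply: le_lt_trans ke.
by rewrite lef_pV2 ?posrE// ler_nat.
Qed.

(** Bolzano-Weierstrass, through [mxvec]. The indices [s k] need not increase; [k <= s k] suffices
    for passing to limits. *)
Lemma bounded_mx_subsequence m n (A : nat -> 'M[R]_(m, n)) (K : R) :
  (forall k, `|A k| <= K) -> exists l, exists2 s : nat -> nat,
    (forall k, (k <= s k)%N) & forall k, `|l - A (s k)| < k.+1%:R^-1.
Proof.
move=> AK; have K0 : 0 <= K by apply: le_trans (AK 0%N).
pose B k := mxvec (A k).
have BK k : `|B k| <= K.
  apply: mx_norm_le => // i j; rewrite (ord1 i).
  by case/mxvec_indexP: j => a b; rewrite mxvecE (le_trans (mx_entry_le _ _ _)).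
have cK := @closed_ball_compact R _ (0 : 'rV[R]_(m * n)) K.
have {}BK k : `|B k - 0| <= K by rewrite subr0.
have [l [_ cl]] := cK (B @ \oo) _ (ex_intro2 _ _ 0%N I (fun k _ => BK k)).
exists (vec_mx l).
have /choice[s sP] : forall k : nat, exists j, (k <= j)%N /\ `|l - B j| < k.+1%:R^-1.
  move=> k; have [] := cl [set B j | j in [set j | (k <= j)%N]] (ball l k.+1%:R^-1).
  - by exists k => // j kj; exists j.
  - by apply: nbhsx_ballx; rewrite invr_gt0.
  by move=> _ [[j kj <-]]; rewrite -ball_normE /= => lB; exists j.
exists s => k; have [ks lB] := sP k => //.
apply: le_lt_trans lB; apply: mx_norm_le => // i j.
have -> : (vec_mx l - A (s k)) i j = (l - B (s k)) 0 (mxvec_index i j).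
  by rewrite !mxE /B mxvecE.
exact: mx_entry_le.
Qed.

Variables (n m : nat) (F : 'rV[R]_n -> 'rV[R]_m) (p : 'rV[R]_n) (r0 L : R).
Hypothesis (r00 : 0 < r0) (L0 : 0 <= L).
Hypothesis F_lip :
  forall x y, `|x - p| < r0 -> `|y - p| < r0 -> `|F x - F y| <= L * `|x - y|.

Lemma jacobian_norm_le q : `|q - p| < r0 -> differentiable F q -> `|'J F q| <= L.
Proof.
move=> qr dF; apply: mx_norm_le => // i j.
apply/ler_addgt0Pr => e e0.
have /differentiable_mxP/(_ _ e0)[d d0 H] := conj dF (erefl ('J F q)).
have [t [t0 td tr]] := exists_pos_lt_sub d0 qr.
pose h : 'rV[R]_n := t *: delta_mx 0 i.
have hE : `|h| = t by rewrite normrZ norm_delta_mx mulr1 gtr0_norm.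
have := H h; rewrite hE => /(_ td) H1.
have H2 : `|F (q + h) - F q| <= L * t.
  have qh : `|q + h - p| < r0.
    by rewrite addrAC; apply: le_lt_trans (ler_normD _ _) _; rewrite hE -ltrBrDl.
  by have := F_lip qh qr; rewrite [X in L * `|X|]addrC addKr hE.
have : `|h *m 'J F q| <= (L + e) * t.
  have -> : h *m 'J F q = (F (q + h) - F q) - (F (q + h) - F q - h *m 'J F q).
    by rewrite opprB addrC addrNK.
  by apply: le_trans (ler_normB _ _) _; rewrite mulrDl lerD.
rewrite -scalemxAl -rowE normrZ gtr0_norm// mulrC ler_pM2r//.
by apply: le_trans; have := mx_entry_le (row i ('J F q)) 0 j; rewrite mxE.
Qed.

(** Upper semicontinuity of the Clarke differential: derivatives at points tending to [p] that
    stayed away from it would, being bounded by [L], have a cluster point, which belongs to it by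
    definition. *)
Lemma jacobian_near_clarke (e : R) : 0 < e -> exists2 d, 0 < d <= r0 &
  forall q, `|q - p| < d -> differentiable F q ->
    exists2 A, clarke F p A & `|'J F q - A| <= e.
Proof.
move=> e0; apply: contrapT => H.
have /choice[u uP] : forall k : nat, exists q, [/\ `|q - p| < Num.min r0 k.+1%:R^-1,
    differentiable F q & forall A, clarke F p A -> ~ `|'J F q - A| <= e].
  move=> k; apply: contrapT => H1; apply: H.
  exists (Num.min r0 k.+1%:R^-1).
    by rewrite lt_min r00 invr_gt0 ltr0Sn/= ge_min lexx.
  move=> q qk dq; apply: contrapT => H2; apply: H1; exists q; split => // A cA JA.
  by apply: H2; exists A.
have up k : `|u k - p| < k.+1%:R^-1.
  by have [] := uP k; rewrite lt_min => /andP[].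
have Jb k : `|'J F (u k)| <= L.
  by have [] := uP k; rewrite lt_min => /andP[ur _] dq _; exact: jacobian_norm_le.
have [A [s ks As]] := bounded_mx_subsequence Jb.
have cA : clarke F p A.
  apply: convex_hull_sub; exists (u \o s); split.
  - apply: cvg_invSn => k; rewrite distrC; apply: lt_le_trans (up _) _.
    by rewrite lef_pV2 ?posrE// ler_nat ltnS.
  - by move=> k; have [] := uP (s k).
  - exact: cvg_invSn.
have [k ke] := exists_invSn_lt e0.
have [_ _ /(_ A cA)] := uP (s k); apply; rewrite distrC.
by apply: ltW; exact: lt_trans (As k) ke.
Qed.

Lemma clarke_norm_le A : clarke F p A -> `|A| <= L.
Proof.
apply: convex_hull_norm => {}A [u [up du JA]].
apply/ler_addgt0Pr => e e0.
have /cvgrPdist_lt/(_ _ e0)[N1 _ H1] := JA.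
have /cvgrPdist_lt/(_ _ r00)[N2 _ H2] := up.
pose N := maxn N1 N2.
have := H1 N (leq_maxl _ _); have := H2 N (leq_maxr _ _) => /= H3 H4.
rewrite -(subrK ('J F (u N)) A) addrC; apply: le_trans (ler_normD _ _) _.
by rewrite lerD ?(ltW H4)// jacobian_norm_le// distrC.
Qed.

Lemma clarke_convex_neighborhood (a : 'rV[R]_n -> R) (b : 'rV[R]_m -> R)
    (na : is_norm a) (nb : is_norm b) (c0 c1 : R) :
  c1 < c0 ->
  (forall A v, clarke F p A -> c0 * a v <= b (v *m A)) ->
  exists (S : set 'M[R]_(n, m)) (d K : R), [/\ 0 < d <= r0, convexV S,
    forall A, S A -> `|A| <= K,
    forall A v, S A -> c1 * a v <= b (v *m A) &
    forall q, `|q - p| < d -> differentiable F q -> S ('J F q)].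
Proof.
move=> c10 Hc.
have [C C0 bC] := is_norm_le nb.
have [c cpos ac] := is_norm_ge na.
have n0 : 0 < n.+1%:R :> R by [].
(* Replacing [A] by a matrix within [e] changes [b (v *m A)] by at most [C * n * e * |v|], which
   this choice keeps below [(c0 - c1) * a v]. The factor [n.+1] keeps the denominator positive in
   dimension 0. *)
pose e := (c0 - c1) * c / (C * n.+1%:R).
have e0 : 0 < e by rewrite divr_gt0// mulr_gt0// subr_gt0.
have [d dr dP] := jacobian_near_clarke e0.
exists [set B | exists2 A, clarke F p A & `|B - A| <= e], d, (L + e); split => //.
- move=> B1 B2 [A1 cA1 BA1] [A2 cA2 BA2] t t01; exists (A1 + t *: (A2 - A1)).
    exact: convex_hull_convex.
  have -> : B1 + t *: (B2 - B1) - (A1 + t *: (A2 - A1)) =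
      (1 - t) *: (B1 - A1) + t *: (B2 - A2).
    by apply/matrixP => i j; rewrite !mxE; ring.
  case/andP: t01 => t0 t1.
  apply: le_trans (ler_normD _ _) _; rewrite !normrZ (ger0_norm t0).
  rewrite ger0_norm ?subr_ge0//.
  have -> : e = (1 - t) * e + t * e by ring.
  by rewrite lerD// ler_wpM2l// subr_ge0.
- move=> B [A cA BA]; rewrite -(subrK A B) addrC.
  by apply: le_trans (ler_normD _ _) _; rewrite lerD// clarke_norm_le.
- move=> B v [A cA BA].
  have -> : v *m B = v *m A - (- (v *m (B - A))).
    by rewrite opprK -mulmxDr addrC subrK.
  have H1 := Hc A v cA.
  have H2 := is_normB nb (v *m A) (- (v *m (B - A))).
  rewrite is_normN// in H2.
  have H3 := bC (v *m (B - A)); have H4 := norm_mulmx_le v (B - A).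
  have H5 : b (v *m (B - A)) <= (c0 - c1) * a v.
    apply: le_trans H3 _; apply: (@le_trans _ _ (C * (n.+1%:R * e * `|v|))).
      rewrite ler_wpM2l ?(ltW C0)//; apply: le_trans H4 _.
      by rewrite ler_wpM2r// ler_pM// ler_nat.
    have -> : C * (n.+1%:R * e * `|v|) = (c0 - c1) * (c * `|v|).
      by rewrite /e; field; rewrite (gt_eqF C0) (addrC 1) natr1 pnatr_eq0.
    by rewrite ler_wpM2l// subr_ge0 ltW.
  by move: H1 H2 H5; lra.
Qed.
End clarke_neighborhood.

Lemma dotv_continuous (R : realType) (V : normedModType R) n (G : V -> 'rV[R]_n) :
  continuous G -> continuous (fun x => dotv (G x) (G x) : R).
Proof.
move=> cG; have -> : (fun x => dotv (G x) (G x) : R) =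
    fun x => \sum_i G x 0 i * G x 0 i by apply/funext => x; rewrite dotvE.
move=> x; apply: cvg_big => [|i _]; first exact: add_continuous.
by apply: cvgM; exact: (continuous_comp (cG x) (@coord_continuous _ _ _ 0 i _)).
Qed.

Lemma dotv_sqrD (R : realType) n (u v : 'rV[R]_n) :
  dotv (u + v) (u + v) = dotv u u + 2 * dotv v u + dotv v v.
Proof. by rewrite dotvDl !dotvDr (dotvC u v); ring. Qed.

(** * Lower Lipschitz bound and openness from a convex set of derivatives *)

Section clarke_inverse.
Context {R : realType}.
Variables (n : nat) (F : 'rV[R]_n -> 'rV[R]_n) (p : 'rV[R]_n) (d L K c1 : R).
Variables (a b : 'rV[R]_n -> R) (S : set 'M[R]_n).
Hypotheses (d0 : 0 < d) (L0 : 0 <= L) (na : is_norm a) (nb : is_norm b).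
Hypothesis F_lip :
  forall x y, `|x - p| < d -> `|y - p| < d -> `|F x - F y| <= L * `|x - y|.
Hypotheses (cS : convexV S) (SK : forall A, S A -> `|A| <= K).
Hypothesis S_ge : forall A v, S A -> c1 * a v <= b (v *m A).
Hypothesis FS : forall q, `|q - p| < d -> differentiable F q -> S ('J F q).

Lemma mulmx_trE (u w : 'rV[R]_n) : (u *m w^T) 0 0 = dotv u w.
Proof. by []. Qed.

(** If [z0 = F y - F x] were too small, all the vectors [v *m B - z] with [B] in [S] and
    [b z <= c2 * a v] would stay away from 0. A covector [w] separating them makes every derivative
    along [v] exceed [dotv w z0] by a fixed amount, and by the mean value inequality [dotv w z0]
    would exceed itself. *)
Lemma lower_lipschitz (c2 : R) x y : 0 <= c2 < c1 ->
  `|x - p| < d -> `|y - p| < d -> c2 * a (y - x) <= b (F y - F x).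
Proof.
move=> /andP[c20 c21] xd yd; pose v := y - x; rewrite -/v.
have [v0|v0] := eqVneq v 0.
  by rewrite v0 is_norm0// mulr0; case: nb.
rewrite leNgt; apply/negP => lt_b; pose z0 := F y - F x.
have av := is_norm_gt0 na v0.
pose D := [set e | exists B z, [/\ S B, b z <= c2 * a v & e = v *m B - z]].
have [C C0 bC] := is_norm_le nb.
have [c cpos cb] := is_norm_ge nb.
(* A lower bound for the sup norm on [D]: the [b] norm is at least [(c1 - c2) * a v] there, and [b]
   is at most [C] times the sup norm. *)
pose eta := (c1 - c2) * a v / C.
have eta0 : 0 < eta by rewrite divr_gt0// mulr_gt0// subr_gt0.
have [w _ wD] : exists2 w, w != 0 & forall e, D e -> eta ^+ 2 / 2 <= dotv w e.
  apply: (@convex_separation _ _ D (n%:R * `|v| * K + c2 * a v / c) _ v) => //.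
  - move=> _ _ [B1 [z1 [SB1 z1b ->]]] [B2 [z2 [SB2 z2b ->]]] t t01.
    exists (B1 + t *: (B2 - B1)), (z1 + t *: (z2 - z1)); split.
    + exact: cS.
    + case/andP: t01 => t0 t1.
      have -> : z1 + t *: (z2 - z1) = (1 - t) *: z1 + t *: z2.
        by rewrite scalerBl scale1r scalerBr addrA addrAC.
      case: nb => _ _ bZ bD; apply: le_trans (bD _ _) _; rewrite !bZ.
      rewrite ger0_norm ?subr_ge0// (ger0_norm t0).
      have -> : c2 * a v = (1 - t) * (c2 * a v) + t * (c2 * a v) by ring.
      by rewrite lerD// ler_wpM2l// subr_ge0.
    + rewrite mulmxDr -scalemxAr mulmxBr.
      by move: (v *m B1) (v *m B2) => ? ?; apply/rowP => j; rewrite !mxE; ring.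
  - move=> _ [B [z [SB zb ->]]]; apply: le_trans (ler_normB _ _) _; apply: lerD.
      apply: le_trans (norm_mulmx_le _ _) _; rewrite mulrAC ler_wpM2l ?mulr_ge0//.
      exact: SK.
    by rewrite ler_pdivlMr// mulrC (le_trans (cb _)).
  - by rewrite exprn_gt0.
  - move=> _ [B [z [SB zb ->]]]; apply: le_trans (norm_sqr_le_dotv _).
    rewrite lerXn2r ?nnegrE ?(ltW eta0)//.
    rewrite /eta ler_pdivrMr// mulrC (mulrC _ C).
    have := bC (v *m B - z); have := is_normB nb (v *m B) z; have := S_ge v SB.
    by move: zb; rewrite mulrC; lra.
have k0 : 0 < eta ^+ 2 by rewrite exprn_gt0.
have : dotv w z0 + eta ^+ 2 / 2 <= dotv z0 w.
  have xv : x + v = y by rewrite addrC subrK.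
  have := @mean_value_local _ _ _ F p d L L0 F_lip w^T (dotv w z0 + eta ^+ 2 / 2)
    v v0 _ x xd.
  rewrite xv mulmx_trE; apply => // q qd dq.
  rewrite mulmx_trE (dotvC (v *m _)) -lerBrDl -dotvNr -dotvDr.
  by apply: wD; exists ('J F q), z0; split; [exact: FS|exact: ltW|].
by rewrite dotvC; lra.
Qed.

Hypothesis c10 : 0 < c1.

Lemma S_unitmx B : S B -> B \in unitmx.
Proof.
move=> SB; rewrite -row_free_unit -kermx_eq0; apply/eqP/row_matrixP => i.
rewrite row0; set u := row i _; have uB : u *m B = 0.
  by apply/sub_kermxP; exact: row_sub.
have := S_ge u SB; rewrite uB is_norm0//.
case: (na) => a0 aE _ _; rewrite pmulr_rle0// => au; apply: aE.
by apply/eqP; rewrite eq_le au a0.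
Qed.

(** Pair [u *m B^T] with [v = u *m invmx B]: the result is [dotv u u], while the lower bound on [S]
    gives [|v| <= C * |u| / (c1 * c)] for all [B] at once. *)
Lemma transpose_lower_bound u : u != 0 ->
  exists2 k, 0 < k & forall B, S B -> k <= dotv (u *m B^T) (u *m B^T).
Proof.
move=> u0; have [C C0 bC] := is_norm_le nb.
have [c cpos ac] := is_norm_ge na.
have nu : 0 < `|u| by rewrite normr_gt0.
have n0 : 0 < n%:R :> R.
  rewrite ltr0n lt0n; apply: contraNneq u0 => n0; apply/eqP/rowP => j.
  by exfalso; case: j; rewrite n0.
pose Q := n%:R * (C * `|u| / (c1 * c)).
have Q0 : 0 < Q by rewrite mulr_gt0// divr_gt0// mulr_gt0.
exists ((dotv u u / Q) ^+ 2); first by rewrite exprn_gt0// divr_gt0// dotv_gt0.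
move=> B SB; apply: le_trans (norm_sqr_le_dotv _).
rewrite lerXn2r ?nnegrE ?divr_ge0 ?(ltW Q0) ?(ltW (dotv_gt0 u0))//.
rewrite ler_pdivrMr//; pose v := u *m invmx B.
have vB : v *m B = u by rewrite mulmxKV// S_unitmx.
have -> : dotv u u = dotv (u *m B^T) v.
  by rewrite /dotv -[in RHS]mulmxA -trmx_mul vB.
apply: le_trans (ler_norm _) _; apply: le_trans (dotv_le _ _) _.
rewrite (mulrC n%:R) -mulrA ler_wpM2l// /Q ler_wpM2l ?(ltW n0)//.
rewrite ler_pdivlMr ?mulr_gt0// mulrC -mulrA.
apply: le_trans (_ : c1 * a v <= _); first by rewrite ler_wpM2l ?(ltW c10)//.
by apply: le_trans (S_ge v SB) _; rewrite vB.
Qed.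

Variable theta : R.
Hypothesis theta0 : 0 < theta.
Hypothesis F_theta : forall x, `|x - p| < d -> theta * `|x - p| <= `|F x - F p|.

(* A minimiser of the distance from F x to y over a small ball is interior, and
   a direction that separates the transposed derivatives applied to F x - y from
   0 would decrease that distance. *)
Lemma clarke_surjective (rho : R) : 0 < rho < d ->
  exists2 delta, 0 < delta & forall y, `|y - F p| < delta ->
    exists2 x, `|x - p| < rho & F x = y.
Proof.
move=> /andP[rho0 rhod].
(* On the sphere of radius [rho] the sup norm of [F x - y] is at least
   [theta * rho - delta = (n + 1) * delta], whereas at [p] the squared Euclidean norm is at most
   [n * delta ^ 2]. So the minimum is not attained on the sphere. *)
pose delta := theta * rho / n.+2%:R.
have delta0 : 0 < delta by rewrite divr_gt0// mulr_gt0.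
exists delta => // y yd.
pose G x := F (clampV p rho x) - y.
have clampd x : `|clampV p rho x - p| < d.
  by apply: le_lt_trans rhod; exact: clampV_in (ltW rho0).
have cG : continuous (fun x => dotv (G x) (G x) : R).
  have cG' : continuous G.
    apply: (@lipschitz_continuous _ _ _ _ L) => x x'.
    have -> : G x - G x' = F (clampV p rho x) - F (clampV p rho x').
      by rewrite /G opprB addrA addrNK.
    apply: le_trans (F_lip (clampd _) (clampd _)) _.
    by rewrite ler_wpM2l// clampV_nonexpansive.
  exact: dotv_continuous.
pose A := [set x : 'rV[R]_n | `|x - p| <= rho].
have A0 : A !=set0 by exists p; rewrite /A/= subrr normr0 ltW.
have cA : compact A by exact: closed_ball_compact.
have [x Ax xmin] := EVT_min_rV A0 cA (continuous_subspaceT cG).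
rewrite inE in Ax.
have GA z : A z -> G z = F z - y by move=> Az; rewrite /G clampV_id.
have xint : `|x - p| < rho.
  rewrite lt_neqAle [_ <= _]Ax andbT; apply/eqP => xr.
  have xd : `|x - p| < d by rewrite xr.
  have := xmin p; rewrite inE => /(_ _); rewrite /A /= subrr normr0 => /(_ (ltW rho0)).
  rewrite !GA//; last by rewrite /A /= subrr normr0 ltW.
  apply/negP; rewrite -ltNge.
  apply: lt_le_trans (norm_sqr_le_dotv _).
  apply: (@le_lt_trans _ _ (n%:R * delta ^+ 2)).
    apply: le_trans (ler_norm _) _; apply: le_trans (dotv_le _ _) _.
    by rewrite -mulrA -expr2 ler_wpM2l// lerXn2r ?nnegrE ?(ltW delta0)// distrC ltW.
  have H : n.+1%:R * delta <= `|F x - y|.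
    have := F_theta xd; rewrite xr => H1.
    have : theta * rho = n.+2%:R * delta.
      by rewrite /delta [RHS]mulrC divfK// pnatr_eq0.
    have : `|F x - F p| <= `|F x - y| + `|y - F p|.
      by apply: le_trans (ler_normD _ _); rewrite addrA addrNK.
    by rewrite -[n.+2%:R]natr1; move: n.+1%:R => N; lra.
  apply: (@lt_le_trans _ _ ((n.+1%:R * delta) ^+ 2)).
    rewrite [ltRHS]exprMn ltr_pM2r ?exprn_gt0// -natrX ltr_nat.
    by rewrite -mulnn leq_pmulr.
  by rewrite lerXn2r ?nnegrE// mulr_ge0// ltW.
exists x => //; apply/eqP; rewrite -subr_eq0; apply/negPn/negP.
set u := F x - y => u0.
have xd : `|x - p| < d by exact: lt_trans rhod.
have [k k0 kP] := transpose_lower_bound u0.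
pose D := [set u *m B^T | B in S].
have [h h0 hD] : exists2 h, h != 0 & forall e, D e -> k / 2 <= dotv h e.
  apply: (@convex_separation _ _ D (n%:R * `|u| * K) _ u) => //.
  - move=> _ _ [B1 SB1 <-] [B2 SB2 <-] t t01.
    exists (B1 + t *: (B2 - B1)); first exact: cS.
    by rewrite linearD/= linearZ/= linearB/= mulmxDr -scalemxAr mulmxBr.
  - move=> _ [B SB <-]; apply: le_trans (norm_mulmx_le _ _) _.
    rewrite mulrAC ler_wpM2l ?mulr_ge0//; apply: le_trans (SK SB).
    by apply: mx_norm_le => // i j; rewrite mxE mx_entry_le.
  - by move=> _ [B SB <-]; exact: kP.
have nh : 0 < `|h| by rewrite normr_gt0.
pose M := n%:R * (L * `|h|) ^+ 2 + 1.
have M0 : 0 < M by rewrite ltr_wpDl// mulr_ge0// sqr_ge0.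
have r'0 : 0 < (rho - `|x - p|) / `|h| by rewrite divr_gt0// subr_gt0.
(* A step of length [tau] against [h] lowers the squared distance by [tau * k] to first order and
   raises it by less than [tau ^ 2 * M]. The second bound on [tau] keeps the new point in the
   ball. *)
have [tau [tau0]] := exists_pos_lt2 (divr_gt0 k0 M0) r'0.
rewrite !ltr_pdivlMr// => tauM tauh.
pose v := - tau *: h.
have nv : `|v| = tau * `|h| by rewrite normrZ normrN gtr0_norm.
have v0 : v != 0 by rewrite -normr_gt0 nv mulr_gt0.
have xvr : `|x + v - p| < rho.
  by rewrite addrAC; apply: le_lt_trans (ler_normD _ _) _; rewrite nv -ltrBrDl.
have xvd : `|x + v - p| < d by exact: lt_trans rhod.
pose De := F (x + v) - F x.
have dec : tau * (k / 2) <= - dotv De u.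
  rewrite -dotvNr -mulmx_trE; apply: (mean_value_local L0 F_lip v0) => //.
  move=> q qd dq; rewrite mulmx_trE dotvNr /v -scalemxAl dotvZl mulNr opprK.
  rewrite ler_pM2l//; have -> : dotv (h *m 'J F q) u = dotv h (u *m ('J F q)^T).
    by rewrite /dotv trmx_mul trmxK mulmxA.
  by apply: hD; exists ('J F q) => //; exact: FS.
have DeL : dotv De De <= n%:R * (L * `|h|) ^+ 2 * tau ^+ 2.
  apply: le_trans (ler_norm _) _; apply: le_trans (dotv_le _ _) _.
  rewrite -[leLHS]mulrA -[leRHS]mulrA ler_wpM2l// -expr2 -exprMn.
  rewrite lerXn2r ?nnegrE ?mulr_ge0 ?(ltW tau0)//.
  have := F_lip xvd xd; rewrite [X in L * `|X|]addrC addKr nv -/De.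
  by rewrite mulrA mulrAC.
have := xmin (x + v); rewrite inE => /(_ (ltW xvr)).
rewrite !GA//; last exact: ltW.
have -> : F (x + v) - y = u + De by rewrite /u /De [RHS]addrC addrA addrNK.
rewrite -/u dotv_sqrD => H.
have : tau * (tau * M) < tau * k by rewrite ltr_pM2l.
have : tau ^+ 2 = tau * tau by rewrite expr2.
rewrite /M; move: (n%:R * _) DeL dec H => X; set Y := dotv De u.
set Z := dotv De De; set U := dotv u u => *.
nra.
Qed.
End clarke_inverse.

(** * Finsler lengths and distances *)

Section charts.
Context {R : realType} {n : nat} {M : c1Manifold R n}.
Implicit Types (phi psi : chart R n M).

Definition chart_img phi : set 'rV[R]_n := phi @` chart_dom phi.

Lemma chart_invK phi p : chart_img phi p ->
  phi (chart_inv phi p) = p /\ chart_dom phi (chart_inv phi p).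
Proof. by move=> [x dx <-]; rewrite chart_mapK. Qed.

Lemma chart_inv_ball phi x (O : set M) : chart_dom phi x -> nbhs x O ->
  exists2 r, 0 < r & forall p, `|p - phi x| < r ->
    chart_img phi p /\ O (chart_inv phi p).
Proof.
move=> dx Ox.
have H1 : nbhs (phi x) (chart_img phi).
  by apply: open_nbhs_nbhs; split; [exact: chart_img_open|exists x].
have H2 : nbhs (phi x) (chart_inv phi @^-1` O).
  by apply: (chart_inv_continuous dx); rewrite chart_mapK.
have /nbhs_ballP[r /= r0 rP] : nbhs (phi x)
    (chart_img phi `&` (chart_inv phi @^-1` O)) by exact: filterI.
by exists r => // p pr; apply: rP; rewrite -ball_normE /= distrC.
Qed.

Lemma chart_dom_nbhs phi x : chart_dom phi x -> nbhs x (chart_dom phi).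
Proof. by move=> dx; apply: open_nbhs_nbhs; split; [exact: chart_dom_open|]. Qed.

Lemma chart_near phi x r : chart_dom phi x -> 0 < r ->
  \forall y \near x, chart_dom phi y /\ `|phi y - phi x| < r.
Proof.
move=> dx r0; apply: filterI; first exact: chart_dom_nbhs.
have H : nbhs x (phi @^-1` ball (phi x) r).
  by apply: (chart_map_continuous dx); exact: nbhsx_ballx.
by apply: filterS H => y; rewrite /= -ball_normE /= distrC.
Qed.

Lemma chart_ball_open phi (p : 'rV[R]_n) r :
  open [set y | chart_dom phi y /\ `|phi y - p| < r].
Proof.
rewrite openE => y [dy yr]; rewrite /interior.
have r'0 : 0 < r - `|phi y - p| by rewrite subr_gt0.
apply: filterS (chart_near dy r'0) => y' [dy' yr']; split=> //.
by have := ler_normD (phi y' - phi y) (phi y - p); rewrite subrKA; lra.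
Qed.

Lemma jacobian_id (T : 'rV[R]_n -> 'rV[R]_n) p r : 0 < r ->
  (forall q, `|q - p| < r -> T q = q) -> differentiable T p /\ 'J T p = 1%:M.
Proof.
move=> r0 Tid; apply/differentiable_mxP => e e0; exists r => // h hr.
have E1 : T (p + h) = p + h by apply: Tid; rewrite addrC addKr.
have E2 : T p = p by apply: Tid; rewrite subrr normr0.
rewrite E1 E2 mulmx1 (addrC p) addrK subrr normr0.
by rewrite mulr_ge0// ltW.
Qed.

Lemma dchart_chart_at (x : M) :
  dchart (chart_at x) x = 1%:M /\ dchart_inv (chart_at x) x = 1%:M.
Proof.
have dx := chart_at_dom x.
have [r r0 rP] := chart_inv_ball dx filterT.
suff : differentiable (chart_at x \o chart_inv (chart_at x)) (chart_at x x) /\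
  'J (chart_at x \o chart_inv (chart_at x)) (chart_at x x) = 1%:M by case.
apply: (@jacobian_id _ _ r) => // q qr.
by have [/chart_invK[]] := rP q qr.
Qed.

Lemma is_derive_mx_comp (h : R -> 'rV[R]_n) (T : 'rV[R]_n -> 'rV[R]_n) (t : R) D :
  is_derive t 1 h D -> differentiable T (h t) ->
  is_derive t 1 (T \o h) (D *m 'J T (h t)).
Proof.
move=> [dh hD] dT; have dh' : differentiable h t by exact/derivable1_diffP.
split; first exact/derivable1_diffP/differentiable_comp.
rewrite deriveE; last exact: differentiable_comp.
rewrite diff_comp//= -hD (deriveE _ dh').
by rewrite /jacobian mul_rV_lin1.
Qed.

Section curve.
Variables (gamma : R -> M) (t0 : R).

Lemma C1_curve_near phi : atlas phi -> chart_dom phi (gamma t0) ->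
  C1_curve_at gamma t0 -> \forall s \near t0,
    [/\ chart_dom phi (gamma s), derivable (phi \o gamma) s 1 &
        {for s, continuous gamma}].
Proof.
move=> aphi dphi [cg /(_ phi aphi dphi)[der _]].
have dom : \forall s \near t0, chart_dom phi (gamma s).
  by apply: cg; exact: chart_dom_nbhs.
have dom2 : \forall s \near t0, \forall u \near s, chart_dom phi (gamma u).
  exact: near_join.
near=> s.
have ds : chart_dom phi (gamma s) by near: s.
have dd : derivable (phi \o gamma) s 1 by near: s.
split => //.
have cphi : {for s, continuous (phi \o gamma)}.
  by apply: differentiable_continuous; exact/derivable1_diffP.
have nears : \forall u \near s, chart_dom phi (gamma u) by near: s.
move=> O; rewrite -(chart_mapK ds) => /(chart_inv_continuous ds).
move=> /(cphi); rewrite /nbhs/= => HO.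
have : \forall u \near s, O (chart_inv phi (phi (gamma u))) by exact: HO.
by apply: filterS2 nears => u du; rewrite chart_mapK.
Unshelve. all: by end_near. Qed.

Lemma velocityE phi s : atlas phi -> chart_dom phi (gamma s) ->
  {for s, continuous gamma} -> derivable (phi \o gamma) s 1 ->
  is_derive s 1 (chart_at (gamma s) \o gamma)
    (derive1 (phi \o gamma) s *m dchart_inv phi (gamma s)).
Proof.
move=> aphi dphi cg der.
have [dT _] := atlas_compatible aphi (chart_at_atlas (gamma s)) dphi (chart_at_dom _).
have der' : is_derive s 1 (phi \o gamma) (derive1 (phi \o gamma) s).
  by rewrite derive1E; exact/derivableP.
have := is_derive_mx_comp der' dT.
apply: near_eq_is_derive.
have : \forall u \near s, chart_dom phi (gamma u).
  by apply: cg; exact: chart_dom_nbhs.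
by apply: filterS => u du /=; rewrite chart_mapK.
Qed.
End curve.
End charts.

Lemma near_eq_continuous_at (T U : topologicalType) (f g : T -> U) (t : T) :
  (\forall s \near t, f s = g s) -> {for t, continuous f} -> {for t, continuous g}.
Proof.
move=> fg cf O; rewrite -(nbhs_singleton fg) => /cf fO.
by apply: filterS2 fg fO => s /= ->.
Qed.

Section finsler.
Context {R : realType} {n : nat} {M : finslerManifold R n}.
Notation mu := (@lebesgue_measure R).
Implicit Types (phi psi : chart R n M) (gamma : R -> M).

Lemma fnorm_is_norm (x : M) : is_norm (fnorm x).
Proof.
split; [exact: fnorm_ge0|exact: fnorm_eq0|exact: fnormZ|exact: fnormD].
Qed.

Definition speed gamma t := fnorm (gamma t) (velocity gamma t).

Lemma speed_chart phi gamma s : atlas phi -> chart_dom phi (gamma s) ->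
  {for s, continuous gamma} -> derivable (phi \o gamma) s 1 ->
  speed gamma s =
  fnorm (gamma s) (derive1 (phi \o gamma) s *m dchart_inv phi (gamma s)).
Proof.
move=> aphi dphi cg der; rewrite /speed /velocity [X in fnorm _ X]derive1E.
by have [_ ->] := velocityE aphi dphi cg der.
Qed.

(** Velocities are written in a chart that changes with the parameter. Near [t0] the speed is
    rewritten in the single chart at [gamma t0], where the continuity of the norm on the tangent
    bundle applies. *)
Lemma speed_continuous gamma t0 : C1_curve_at gamma t0 ->
  {for t0, continuous (speed gamma)}.
Proof.
move=> C1; pose phi := chart_at (gamma t0).
have aphi : atlas phi by exact: chart_at_atlas.
have dphi : chart_dom phi (gamma t0) by exact: chart_at_dom.
have [cg /(_ phi aphi dphi)[_ cD]] := C1.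
have nearE : \forall s \near t0,
    fnorm (gamma s) (derive1 (phi \o gamma) s *m dchart_inv phi (gamma s)) = speed gamma s.
  apply: filterS (C1_curve_near aphi dphi C1) => s [ds dd cs].
  by rewrite (speed_chart aphi).
apply: near_eq_continuous_at nearE _.
pose N (q : M * 'rV[R]_n) := fnorm q.1 (q.2 *m dchart_inv phi q.1).
have cN : {for (gamma t0, derive1 (phi \o gamma) t0), continuous N}.
  exact: (fnorm_continuous aphi dphi).
apply: (@continuous_comp _ _ _ (fun s => (gamma s, derive1 (phi \o gamma) s)) N) => //.
by move=> O HO; exact: (cvg_pair cg cD HO).
Qed.

Lemma speed_near_eq gamma gamma' (t : R) :
  (\forall s \near t, gamma s = gamma' s) -> speed gamma t = speed gamma' t.
Proof.
move=> E; rewrite /speed /velocity (nbhs_singleton E); congr (fnorm _ _).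
rewrite !derive1E; apply: near_eq_derive.
by apply: filterS E => s /= ->.
Qed.

Lemma mulmxl_continuous m k (v : 'rV[R]_m) :
  continuous (fun A : 'M[R]_(m, k) => v *m A).
Proof.
apply: (@lipschitz_continuous _ _ _ _ (m%:R * `|v|)) => A B.
by rewrite -mulmxBr; apply: le_trans (norm_mulmx_le _ _) _; rewrite mulrAC.
Qed.

Lemma is_derive_line (q v : 'rV[R]_n) (t : R) : is_derive t 1 (fun s : R => q + s *: v) v.
Proof.
apply: is_derive_epsP => e e0; exists 1 => // s _.
have -> : q + (t + s) *: v - (q + t *: v) - s *: v = 0.
  by apply/rowP => j; rewrite !mxE; ring.
by rewrite normr0 mulr_ge0// ltW.
Qed.

Definition chart_line phi q v : R -> M := fun s => chart_inv phi (q + s *: v).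

Section line.
Variables (phi : chart R n M) (q v : 'rV[R]_n) (t : R).
Hypotheses (aphi : atlas phi) (imgt : chart_img phi (q + t *: v)).
Let g := chart_line phi q v.

Lemma chart_line_near : \forall s \near t, chart_img phi (q + s *: v).
Proof.
apply: (line_continuous (x := t)); apply: open_nbhs_nbhs.
by split; [exact: chart_img_open|].
Qed.

Lemma chart_line_continuous : {for t, continuous g}.
Proof.
have [qE dq] := chart_invK imgt.
apply: continuous_comp; first exact: line_continuous.
by have := chart_inv_continuous dq; rewrite qE.
Qed.

Lemma chart_line_C1 : C1_curve_at g t.
Proof.
split; first exact: chart_line_continuous.
move=> psi apsi dpsi.
have dom : \forall s \near t, chart_dom psi (g s).
  by apply: chart_line_continuous; exact: chart_dom_nbhs.
pose T := psi \o chart_inv phi.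
have der : \forall s \near t,
    is_derive (s : R) 1 (psi \o g) (v *m 'J T (q + s *: v)).
  apply: filterS2 dom chart_line_near => s ds imgs.
  have [qE dq] := chart_invK imgs.
  have [dT _] := atlas_compatible aphi apsi dq ds.
  rewrite qE in dT; exact: (is_derive_mx_comp (is_derive_line q v s) dT).
split; first by apply: filterS der => s [].
have [qE dq] := chart_invK imgt.
have [_ cJ] := atlas_compatible aphi apsi dq dpsi; rewrite qE in cJ.
apply: (@near_eq_continuous_at _ _ (fun s : R => v *m 'J T (q + s *: v))).
  by apply: filterS der => s [_ H]; rewrite derive1E.
apply: (@continuous_comp _ _ _ (fun s : R => 'J T (q + s *: v)) (fun A => v *m A)).
  by apply: (@continuous_comp _ _ _ (fun s : R => q + s *: v)); [exact: line_continuous|].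
exact: mulmxl_continuous.
Qed.

Lemma chart_line_derive : derivable (phi \o g) t 1 /\ derive1 (phi \o g) t = v.
Proof.
have : is_derive t 1 (phi \o g) v.
  apply: near_eq_is_derive (is_derive_line q v t).
  by apply: filterS chart_line_near => s /chart_invK[].
by move=> [d <-]; rewrite derive1E.
Qed.

Lemma speed_chart_line : speed g t = fnorm (g t) (v *m dchart_inv phi (g t)).
Proof.
have [qE dq] := chart_invK imgt; have [d dE] := chart_line_derive.
by rewrite (speed_chart aphi)// ?dE//; exact: chart_line_continuous.
Qed.
End line.

(** Continuity of the norm on the tangent bundle becomes uniform in the direction by compactness of
    the unit sphere, and extends to all vectors by homogeneity. *)
Lemma fnorm_compare (x : M) : \forall y \near x,
  forall w, fnorm y (w *m dchart_inv (chart_at x) y) <= 2 * fnorm x w /\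
            fnorm x w <= 2 * fnorm y (w *m dchart_inv (chart_at x) y).
Proof.
set phi := chart_at x; pose N (y : M) (w : 'rV[R]_n) := fnorm y (w *m dchart_inv phi y).
pose S := [set w : 'rV[R]_n | `|w| = 1].
have cS : compact S by exact: unit_sphere_compact.
have Nx w : N x w = fnorm x w.
  by rewrite /N (dchart_chart_at x).2 mulmx1.
have : \forall y \near x, S `<=` (fun w => N y w <= 2 * fnorm x w /\ fnorm x w <= 2 * N y w).
  move/compact_near_coveringP : cS; apply => w Sw.
  have w0 : w != 0 by apply: contra_eq_neq Sw => ->; rewrite /= normr0 eq_sym oner_eq0.
  have m0 := is_norm_gt0 (fnorm_is_norm x) w0; set m := fnorm x w in m0.
  have cN := fnorm_continuous (v := w) (chart_at_atlas x) (chart_at_dom x).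
  (* With errors below [m / 3] both norms lie between [2 * m / 3] and [4 * m / 3], hence within a
     factor 2 of each other. *)
  have H : \forall q \near (x, w), `|N x w - N q.1 q.2| < m / 3.
    by have /cvgrPdist_lt := cN; apply; rewrite divr_gt0.
  have H2 : \forall w' \near w, `|m - fnorm x w'| < m / 3.
    have /cvgrPdist_lt := @is_norm_continuous _ _ _ (fnorm_is_norm x) w; apply.
    by rewrite divr_gt0.
  rewrite Nx in H; case: H => -[A B] /= [xA wB] AB.
  exists (B `&` [set w' | `|m - fnorm x w'| < m / 3], A).
    by split => //=; exact: filterI.
  move=> [w' y] /= [[Bw' mw'] Ay].
  have := AB (y, w') (conj Ay Bw'); rewrite /= => NN.
  move: mw' NN; rewrite -/m !ltr_norml => /andP[? ?] /andP[? ?].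
  by rewrite -/(N y w'); split; lra.
apply: filterS => y yS w; have [->|w0] := eqVneq w 0.
  by rewrite mul0mx !is_norm0 ?mulr0//; exact: fnorm_is_norm.
have nw : 0 < `|w| by rewrite normr_gt0.
have := yS (`|w|^-1 *: w); rewrite /S/N/= -scalemxAl !fnormZ normfV normr_id.
rewrite normrZ normfV normr_id mulVf ?gt_eqF// => /(_ erefl)[].
by rewrite !(mulrCA 2) !ler_pM2l ?invr_gt0//.
Qed.

Lemma piecewise_C1_lt gamma a b : piecewise_C1 gamma a b -> a < b.
Proof. by elim=> // {}a c {}b _ ac _; exact: lt_trans. Qed.

Lemma speed_measurable gamma a b : piecewise_C1 gamma a b ->
  measurable_fun `[a, b] (speed gamma).
Proof.
elim=> [{}a {}b ab [g gE]|{}a c {}b p1 m1 p2 m2].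
  apply: (@measurable_fun_itv_cc _ _ _ false true).
  apply: open_continuous_measurable_fun; first exact: interval_open.
  move=> t; rewrite inE/= in_itv/= => /andP[at_ tb].
  apply: (@near_eq_continuous_at _ _ (speed g)).
    have : \forall s \near t, \forall u \near s, a < u < b.
      apply: near_join; near=> u; apply/andP.
      by split; near: u; [exact: lt_nbhsr|exact: lt_nbhsl].
    apply: filterS => s Hs; apply: speed_near_eq.
    apply: filterS Hs => u /andP[au ub].
    by have [] := gE u; rewrite ?ltW.
  have [_ C1g] : g t = gamma t /\ C1_curve_at g t.
    by apply: gE; rewrite (ltW at_) (ltW tb).
  exact: speed_continuous.
have ac := piecewise_C1_lt p1; have cb := piecewise_C1_lt p2.
have -> : `[a, b]%classic = `[a, c]%classic `|` `[c, b]%classic :> set R.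
  apply/seteqP; split => t /=; rewrite !in_itv/=.
    by move=> /andP[-> ->]; case: (leP t c) => tc; [left|right; rewrite ltW].
  move=> [/andP[-> tc]|/andP[ct ->]]; first by rewrite (le_trans tc (ltW cb)).
  by rewrite (le_trans (ltW ac) ct).
by apply/measurable_funU.
Unshelve. all: by end_near. Qed.
End finsler.

(** * Concatenation of paths and finiteness of the distance *)

Section distance.
Context {R : realType} {n : nat} {M : finslerManifold R n}.
Notation mu := (@lebesgue_measure R).
Implicit Types (phi psi : chart R n M) (gamma : R -> M).

Lemma piecewise_C1_eq gamma delta a b : piecewise_C1 gamma a b ->
  (forall t, a <= t <= b -> gamma t = delta t) -> piecewise_C1 delta a b.
Proof.
elim=> [{}a {}b ab [g gE] E|{}a c {}b p1 m1 p2 m2 E].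
  apply: piecewise_C1_one => //; exists g => t tab.
  by have [-> C1] := gE t tab; rewrite E.
have ac := piecewise_C1_lt p1; have cb := piecewise_C1_lt p2.
by apply: (@piecewise_C1_cat _ _ _ _ _ c); [apply: m1|apply: m2] => t /andP[? ?];
  apply: E; apply/andP; split; lra.
Qed.

Lemma speed_emeasurable gamma a b (A : set R) : piecewise_C1 gamma a b ->
  measurable A -> A `<=` `[a, b] -> measurable_fun A (EFin \o speed gamma).
Proof.
move=> /speed_measurable m mA sA; apply: (@measurable_funS _ _ _ _ `[a, b]) => //.
exact/measurable_EFinP.
Qed.

Lemma subset_oo_cc (a b : R) : `]a, b[%classic `<=` `[a, b]%classic.
Proof. by move=> t /=; rewrite !in_itv/= => /andP[/ltW-> /ltW->]. Qed.

(** The curves may continue differently outside [[a, b]], so their velocities can differ at the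
    endpoints; the integrals are compared on the open interval. *)
Lemma finsler_length_eq gamma delta a b : piecewise_C1 gamma a b ->
  (forall t, a <= t <= b -> gamma t = delta t) ->
  finsler_length gamma a b = finsler_length delta a b.
Proof.
move=> p E; have p' := piecewise_C1_eq p E.
rewrite /finsler_length.
rewrite integral_itv_bndoo; last first.
  exact: (speed_emeasurable p (measurable_itv _) (@subset_oo_cc a b)).
rewrite [RHS]integral_itv_bndoo; last first.
  exact: (speed_emeasurable p' (measurable_itv _) (@subset_oo_cc a b)).
apply: eq_integral => t; rewrite inE/= in_itv/= => /andP[at_ tb].
congr EFin; apply: (@speed_near_eq _ _ M).
near=> u; apply: E; apply/andP; split; apply: ltW; near: u.
  exact: lt_nbhsr.
exact: lt_nbhsl.
Unshelve. all: by end_near. Qed.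

Lemma length_split gamma (a c b : R) : a <= c -> c <= b ->
  measurable_fun `[a, b] (EFin \o speed gamma) ->
  finsler_length gamma a b =
  (\int[mu]_(t in `[a, c[) (speed gamma t)%:E + finsler_length gamma c b)%E.
Proof.
move=> ac cb m.
have E : `[a, b]%classic = `[a, c[%classic `|` `[c, b]%classic :> set R.
  apply/seteqP; split => t /=; rewrite !in_itv/=.
    by move=> /andP[-> ->]; case: (leP c t) => tc; [right|left].
  move=> [/andP[-> tc]|/andP[ct ->]]; first by rewrite (le_trans (ltW tc) cb).
  by rewrite (le_trans ac ct).
rewrite /finsler_length E ge0_integral_setU//=; first by rewrite -E.
  by move=> t _; rewrite lee_fin fnorm_ge0.
apply/disj_setPS => t /=; rewrite !in_itv/= => -[/andP[_ +] /andP[+ _]].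
by move=> /lt_le_trans h /h; rewrite ltxx.
Qed.

Lemma finsler_length_cat gamma a c b :
  piecewise_C1 gamma a c -> piecewise_C1 gamma c b ->
  finsler_length gamma a b =
  (finsler_length gamma a c + finsler_length gamma c b)%E.
Proof.
move=> p1 p2; have p := piecewise_C1_cat p1 p2.
have ac := piecewise_C1_lt p1; have cb := piecewise_C1_lt p2.
rewrite (@length_split _ _ c) ?ltW//; last exact: (speed_emeasurable p).
rewrite integral_itv_bndo_bndc//; apply: (speed_emeasurable p1) => //.
by move=> t /=; rewrite !in_itv/= => /andP[-> /ltW->].
Qed.

Lemma finsler_length_le gamma a b K : a < b -> piecewise_C1 gamma a b -> 0 <= K ->
  (forall t, a < t < b -> speed gamma t <= K) ->
  (finsler_length gamma a b <= (K * (b - a))%:E)%E.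
Proof.
move=> ab p K0 H; rewrite /finsler_length.
have m := speed_emeasurable p (measurable_itv _) (@subset_oo_cc a b).
rewrite integral_itv_bndoo//.
apply: (@le_trans _ _ (\int[mu]_(t in `]a, b[) (cst K%:E t))%E).
  by apply: ge0_le_integral => // t _; rewrite lee_fin fnorm_ge0.
rewrite integral_cst//= lebesgue_measure_itv/= lte_fin ab.
by rewrite -EFinD -EFinM.
Qed.

Lemma finsler_dist_le (x y : M) gamma a b : piecewise_C1 gamma a b ->
  gamma a = x -> gamma b = y -> (finsler_dist x y <= finsler_length gamma a b)%E.
Proof. by move=> p ga gb; apply: ereal_inf_lbound; exists gamma, a, b. Qed.

Lemma chart_line_piecewise phi q v (a b : R) : atlas phi -> a < b ->
  (forall t, a <= t <= b -> chart_img phi (q + t *: v)) ->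
  piecewise_C1 (chart_line phi q v) a b.
Proof.
move=> aphi ab H; apply: piecewise_C1_one => //.
exists (chart_line phi q v) => t /H h; split => //; exact: chart_line_C1.
Qed.

Lemma finsler_dist_refl (x : M) : (finsler_dist x x <= 0)%E.
Proof.
have H (t : R) : chart_img (chart_at x) (chart_at x x + t *: 0).
  by rewrite scaler0 addr0; exists x => //; exact: chart_at_dom.
pose g : R -> M := chart_line (chart_at x) (chart_at x x) 0.
have gx t : g t = x by rewrite /g /chart_line scaler0 addr0 chart_mapK//; exact: chart_at_dom.
have p : piecewise_C1 g 0 1 by apply: chart_line_piecewise => //; exact: chart_at_atlas.
apply: le_trans (finsler_dist_le p (gx _) (gx _)) _.
have -> : 0%E = (0 * (1 - 0) : R)%:E by rewrite mul0r.
apply: finsler_length_le => // t _.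
rewrite (speed_chart_line (chart_at_atlas x) (H t)) mul0mx is_norm0//.
exact: fnorm_is_norm.
Qed.

(* Append to a path ending at y the chart segment from y to z. *)
Lemma finsler_dist_step (p : M) : exists2 r, 0 < r & forall y z,
  chart_dom (chart_at p) y -> chart_dom (chart_at p) z ->
  `|chart_at p y - chart_at p p| < r -> `|chart_at p z - chart_at p p| < r ->
  forall x, (finsler_dist x z <=
    finsler_dist x y + (2 * fnorm p (chart_at p z - chart_at p y))%:E)%E.
Proof.
set phi := chart_at p.
have aphi : atlas phi by exact: chart_at_atlas.
have [r r0 rP] := chart_inv_ball (chart_at_dom p) (fnorm_compare p).
exists r => // y z dy dz yr zr x; set v := phi z - phi y.
suff H gamma a b : piecewise_C1 gamma a b -> gamma a = x -> gamma b = y ->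
    (finsler_dist x z <= finsler_length gamma a b + (2 * fnorm p v)%:E)%E.
  rewrite -leeBlDr//; apply: le_ereal_inf_tmp => _ [g [a [b [gp ga gb ->]]]].
  by rewrite leeBlDr//; exact: H.
move=> gp ga gb; have ab := piecewise_C1_lt gp.
pose g := chart_line phi (phi y - b *: v) v.
have argE t : phi y - b *: v + t *: v = phi y + (t - b) *: v.
  by apply/rowP => j; rewrite !mxE; ring.
have inb t : b <= t <= b + 1 -> `|phi y - b *: v + t *: v - phi p| < r.
  move=> /andP[? ?]; rewrite argE; apply: segment_in_ball => //.
  by apply/andP; split; lra.
have gb' : g b = y by rewrite /g/chart_line argE subrr scale0r addr0 chart_mapK.
have gb1 : g (b + 1) = z.
  rewrite /g/chart_line argE addrAC subrr add0r scale1r /v.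
  by rewrite addrC subrK chart_mapK.
have img t : b <= t <= b + 1 -> chart_img phi (phi y - b *: v + t *: v).
  by move=> /inb /rP[].
have bb : b < b + 1 by lra.
have p2 : piecewise_C1 g b (b + 1) by exact: chart_line_piecewise.
pose d t := if t <= b then gamma t else g t.
have dE1 t : a <= t <= b -> gamma t = d t by rewrite /d => /andP[_ ->].
have dE2 t : b <= t <= b + 1 -> g t = d t.
  rewrite /d => /andP[bt _]; case: leP => // tb.
  by have -> : t = b; [lra|rewrite gb' gb].
have da : d a = x by rewrite -dE1// lexx ltW.
have db : d (b + 1) = z by rewrite -dE2// lexx ltW.
have p12 := piecewise_C1_cat (piecewise_C1_eq gp dE1) (piecewise_C1_eq p2 dE2).
apply: le_trans (finsler_dist_le p12 da db) _.
rewrite (finsler_length_cat (piecewise_C1_eq gp dE1) (piecewise_C1_eq p2 dE2)).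
rewrite -(finsler_length_eq gp dE1) -(finsler_length_eq p2 dE2) leeD2l//.
have -> : 2 * fnorm p v = 2 * fnorm p v * (b + 1 - b) by ring.
apply: finsler_length_le => //; first by rewrite mulr_ge0 ?fnorm_ge0.
move=> t /andP[/ltW bt /ltW tb].
have Ht : b <= t <= b + 1 by rewrite bt.
rewrite (speed_chart_line aphi (img t Ht)).
by have [_ /(_ v)[]] := rP _ (inb t Ht).
Qed.

(** Around every point there is a neighbourhood in which finiteness passes from any point to any
    other, so the points at finite distance from [x] form an open and closed set. *)
Lemma finsler_dist_fin (M_connected : connected [set: M]) (x y : M) :
  (finsler_dist x y < +oo)%E.
Proof.
suff -> : [set y | (finsler_dist x y < +oo)%E] y by [].
suff -> : [set y | (finsler_dist x y < +oo)%E] = [set: M] by [].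
have step (p : M) : exists2 U : set M, nbhs p U & forall y z, U y -> U z ->
    (finsler_dist x y < +oo)%E -> (finsler_dist x z < +oo)%E.
  have [r r0 rP] := finsler_dist_step p.
  exists (fun z => chart_dom (chart_at p) z /\ `|chart_at p z - chart_at p p| < r).
    exact: (chart_near (chart_at_dom p) r0).
  move=> u w [du ur] [dw wr] fu; apply: le_lt_trans (rP u w _ _ _ _ x) _ => //.
  by rewrite lte_add_pinfty// ltry.
apply: M_connected.
- by exists x => /=; apply: le_lt_trans (finsler_dist_refl x) _; rewrite ltry.
- exists [set y | (finsler_dist x y < +oo)%E]; last by rewrite setTI.
  rewrite openE => p /= fp; rewrite /interior; have [U Up HU] := step p.
  have Upp := nbhs_singleton Up.
  by apply: filterS Up => z Uz; apply: (HU p) => //; exact: Upp.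
- exists [set y | (finsler_dist x y < +oo)%E]; last by rewrite setTI.
  move=> p clp /=; have [U Up HU] := step p; have Upp := nbhs_singleton Up.
  have [z [fz Uz]] := clp U Up.
  by apply: (HU z) => //; exact: Upp.
Qed.
End distance.

(** The supremum of the initial segments on which [P] holds belongs to them by the limit hypothesis,
    and is [b] by the step hypothesis. This is how local estimates, coincidence of lifts and
    existence of lifts are propagated along an interval. *)
Lemma real_induction (R : realType) (P : R -> Prop) (a b : R) : P a ->
  (forall t, a <= t < b -> P t ->
     exists2 d, 0 < d & forall s, t < s < t + d -> s <= b -> P s) ->
  (forall t, a < t <= b -> (forall s, a <= s < t -> P s) -> P t) ->
  forall t, a <= t <= b -> P t.
Proof.
move=> Pa step lim t0 /andP[at0 t0b].
pose E := [set t | a <= t <= b /\ forall s, a <= s <= t -> P s].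
have Ea : E a.
  split=> [|s /andP[a1 a2]]; first by rewrite lexx (le_trans at0).
  by have -> : s = a by apply/le_anti; rewrite a2.
have supE : has_sup E by split; [exists a|exists b => t [/andP[]]].
set T := sup E.
have aT : a <= T by apply: ub_le_sup => //; case: supE.
have Tb : T <= b by apply: ge_sup; [exists a|move=> t [/andP[]]].
have P1 s : a <= s < T -> P s.
  move=> /andP[as_ sT]; have Ts : 0 < T - s by rewrite subr_gt0.
  have [e [_ eP]] := sup_adherent Ts supE.
  by rewrite -/T subKr => se; apply: eP; rewrite as_ ltW.
have PT : P T.
  have [<-//|aneT] := eqVneq a T.
  by apply: lim => //; rewrite lt_neqAle aneT aT.
suff TE : T = b.
  have [->|t0T] := eqVneq t0 T; first exact: PT.
  by apply: P1; rewrite at0 lt_neqAle t0T TE.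
apply/le_anti; rewrite Tb leNgt; apply/negP => ltTb.
have [|d d0 dP] := step T _ PT; first by rewrite aT.
have [e [e0 ed eb]] := exists_pos_lt_sub d0 ltTb.
suff /(ub_le_sup (proj2 supE)) : E (T + e) by rewrite -/T; lra.
split=> [|s /andP[as_ sTe]]; first by apply/andP; split; lra.
have [sT|Ts|->] := ltgtP s T; last exact: PT.
  by apply: P1; rewrite as_.
by apply: dP; first (apply/andP; split); lra.
Qed.

Lemma derivable_eps (R : realType) (W : normedModType R) (g : R -> W) (t e : R) :
  derivable g t 1 -> 0 < e -> exists2 d, 0 < d & forall s, `|s - t| < d ->
    `|g s - g t - (s - t) *: derive1 g t| <= e * `|s - t|.
Proof.
move=> /derivable1_diffP dg e0.
have cdf : continuous ('d g t) by exact: diff_continuous.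
have [d d0 H] := (differentiable_epsP g t cdf).2 (conj dg erefl) e e0.
exists d => // s sd; have := H (s - t) sd; rewrite [t + _]addrC subrK.
suff -> : 'd g t (s - t) = (s - t) *: derive1 g t by [].
by rewrite derive1E deriveE// -[s - t in LHS]mulr1 -linearZ.
Qed.

(** * Short paths stay in chart balls *)

Section close.
Context {R : realType} {n : nat} {M : finslerManifold R n}.
Notation mu := (@lebesgue_measure R).
Variables (phi : chart R n M) (l : M) (c r : R).
Hypotheses (aphi : atlas phi) (c0 : 0 < c).
Hypothesis ball_ge : forall p, `|p - phi l| <= r -> chart_img phi p /\
  forall w, c * `|w| <= fnorm (chart_inv phi p) (w *m dchart_inv phi (chart_inv phi p)).

Let K (rho : R) : set M := [set y | chart_dom phi y /\ `|phi y - phi l| <= rho].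

(** A compact subset of a Hausdorff space is closed. Hence a curve whose coordinates stay in such a
    ball cannot leave the chart domain at a limit parameter. *)
Lemma chart_ball_closed rho : rho <= r -> closed (K rho).
Proof.
move=> rr; pose B := [set p : 'rV[R]_n | `|p - phi l| <= rho].
have BI p : B p -> chart_img phi p.
  by move=> Bp; have [] := ball_ge (le_trans Bp rr).
have -> : K rho = chart_inv phi @` B.
  apply/seteqP; split=> [y [dy yr]|_ [p Bp <-]].
    by exists (phi y) => //; rewrite chart_mapK.
  by have [E dp] := chart_invK (BI _ Bp); split=> //; rewrite E.
apply: compact_closed; first exact: carrier_hausdorff.
apply: continuous_compact.
  apply: continuous_in_subspaceT => p; rewrite inE => /BI /chart_invK[E dp].
  by have := chart_inv_continuous dp; rewrite E.
exact: closed_ball_compact.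
Qed.

(** Just before [t] the coordinates move at a rate close to [|D|] and the speed is close to its
    value at [t], which is at least [c * |D|]. Each approximation costs [e], and
    [(1 + c) * e = eps]. *)
Lemma speed_ge_chart g t eps : K r (g t) -> C1_curve_at g t -> 0 < eps ->
  exists2 d, 0 < d & forall s, t - d < s < t -> 
    measurable_fun `[s, t[ (EFin \o speed g) ->
    chart_dom phi (g s) /\
    ((c * `|phi (g s) - phi (g t)| - eps * (t - s))%:E <=
       \int[mu]_(u in `[s, t[) (speed g u)%:E)%E.
Proof.
move=> [dt rt] C1 eps0; pose e := eps / (1 + c).
have c10 : 0 < 1 + c by rewrite addr_gt0.
have e0 : 0 < e by rewrite divr_gt0.
have [cg /(_ _ aphi dt)[der _]] := C1.
have [d1 d10 H1] := derivable_eps (nbhs_singleton der) e0.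
set D := derive1 _ _ in H1.
have /cvgrPdist_lt/(_ e e0)/nbhs_ballP[d2 /= d20 H2] := speed_continuous C1.
have /nbhs_ballP[d3 /= d30 H3] := C1_curve_near aphi dt C1.
pose d := Num.min d1 (Num.min d2 d3).
have d0 : 0 < d by rewrite !lt_min d10 d20.
have [dd1 dd2 dd3] : [/\ d <= d1, d <= d2 & d <= d3].
  by rewrite /d; split; rewrite !ge_min ?lexx ?orbT.
exists d => // s /andP[sd st] m.
have nst : `|s - t| = t - s by rewrite distrC gtr0_norm ?subr_gt0.
split.
  have : ball t d3 s by rewrite -ball_normE/= distrC nst; lra.
  by move/H3; case.
have sD : c * `|D| <= speed g t.
  rewrite (speed_chart aphi)//; last exact: nbhs_singleton der.
  by have [_] := ball_ge rt; rewrite chart_mapK.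
have H1s : `|phi (g s) - phi (g t)| <= (`|D| + e) * (t - s).
  have : `|s - t| < d1 by rewrite nst; lra.
  move=> /H1; rewrite nst => H.
  have := ler_normD (phi (g s) - phi (g t) - (s - t) *: D) ((s - t) *: D).
  by rewrite subrK normrZ nst => /le_trans; apply; lra.
have epsE : (1 + c) * e = eps by rewrite /e mulrC divfK// gt_eqF.
have k0 : 0 < t - s by rewrite subr_gt0.
apply: (@le_trans _ _ (((speed g t - e) * (t - s))%:E)).
  rewrite lee_fin; have := ler_wpM2l (ltW c0) H1s.
  have := ler_wpM2r (ltW k0) sD.
  rewrite -epsE; nra.
have [sp|sp] := leP 0 (speed g t - e); last first.
  apply: (@le_trans _ _ 0%E); first by rewrite lee_fin nmulr_rle0// ltW.
  by apply: integral_ge0 => u _; rewrite lee_fin fnorm_ge0.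
apply: (@le_trans _ _ (\int[mu]_(u in `[s, t[) (cst (speed g t - e)%:E u))%E).
  by rewrite integral_cst//= lebesgue_measure_itv/= lte_fin st -EFinD -EFinM.
apply: ge0_le_integral => //= u; rewrite in_itv/= => /andP[su ut].
have /H2 : ball t d2 u.
  by rewrite -ball_normE/= gtr0_norm ?subr_gt0//; lra.
by rewrite lee_fin ltr_norml => /andP[? ?]; lra.
Qed.
Lemma finsler_length_mono (g : R -> M) (a t b : R) : a <= t ->
  measurable_fun `[a, b] (EFin \o speed g) ->
  (finsler_length g t b <= finsler_length g a b)%E.
Proof.
move=> at_ m; apply: ge0_subset_integral => //.
  by move=> u _; rewrite lee_fin fnorm_ge0.
by move=> u /=; rewrite !in_itv/= => /andP[tu ->]; rewrite (le_trans at_).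
Qed.

(** Followed backwards from [b], the curve stays in [K r]: while it does, its length dominates [c]
    times the coordinate displacement up to an error of rate [eps], and the last hypothesis turns
    this into membership in [K r]. Limit parameters are reached because [K r] is closed. *)
Lemma C1_length_ge (g : R -> M) (a b L rho eps : R) : a < b ->
  (forall t, a <= t <= b -> C1_curve_at g t) ->
  (finsler_length g a b <= L%:E)%E -> K rho (g b) -> 0 < eps ->
  c * rho + L + eps * (b - a) <= c * r ->
  chart_dom phi (g a) /\ c * `|phi (g a) - phi (g b)| <= L + eps * (b - a).
Proof.
move=> ab C1 gL [db rb] eps0 Lr.
have pg : piecewise_C1 g a b by apply: piecewise_C1_one => //; exists g => t /C1.
have m s t : a <= s -> t <= b ->
    measurable_fun `[s, t] (EFin \o speed g).
  move=> as_ tb; apply: (speed_emeasurable pg) => // u /=; rewrite !in_itv/=.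
  by move=> /andP[su ut]; rewrite (le_trans as_ su) (le_trans ut tb).
have m' s t : a <= s -> t <= b -> measurable_fun `[s, t[ (EFin \o speed g).
  move=> as_ tb; apply: (speed_emeasurable pg) => // u /=; rewrite !in_itv/=.
  by move=> /andP[su ut]; rewrite (le_trans as_ su) (ltW (lt_le_trans ut tb)).
have lenL t : a <= t -> (finsler_length g t b <= L%:E)%E.
  by move=> at_; apply: le_trans (finsler_length_mono at_ (m _ _ _ _)) gL.
pose P t := chart_dom phi (g t) /\
  ((c * `|phi (g t) - phi (g b)| - eps * (b - t))%:E <= finsler_length g t b)%E.
have PK t : a <= t <= b -> P t -> K r (g t) /\
    c * `|phi (g t) - phi (g b)| <= L + eps * (b - a).
  move=> /andP[at_ tb] [dt Pt].
  have := le_trans Pt (lenL t at_); rewrite lee_fin => H.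
  have H1 : c * `|phi (g t) - phi (g b)| <= L + eps * (b - a).
    have : eps * (b - t) <= eps * (b - a) by rewrite ler_pM2l//; lra.
    by lra.
  do 2 split => //; rewrite -(ler_pM2l c0); apply: le_trans _ Lr.
  have : c * `|phi (g b) - phi l| <= c * rho by rewrite ler_pM2l.
  have : c * `|phi (g t) - phi l| <=
      c * (`|phi (g t) - phi (g b)| + `|phi (g b) - phi l|).
    by rewrite ler_pM2l// -[phi (g t) - phi l](subrKA (phi (g b))) ler_normD.
  by rewrite mulrDr; lra.
suff /PK : P a by move=> /(_ _)[|[? _] ?]; [rewrite lexx ltW|].
(* The sign change lets real induction run from [b] down to [a]. *)
suff H : forall u, - b <= u <= - a -> P (- u).
  by rewrite -[a]opprK; apply: H; rewrite lexx lerN2 ltW.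
apply: real_induction.
- rewrite opprK; split=> //; rewrite !subrr normr0 !mulr0 subrr.
  by apply: integral_ge0 => u _; rewrite lee_fin fnorm_ge0.
- move=> u; set t := - u => /andP[bu ua] Pt.
  have at_ : a < t by rewrite /t; lra.
  have tb : t <= b by rewrite /t; lra.
  have [|Kt _] := PK t _ Pt; first by rewrite ltW.
  have [|d d0 dP] := speed_ge_chart Kt (C1 t _) eps0; first by rewrite ltW.
  exists d => // u' /andP[uu' u'd] u'a; set s := - u'.
  have as_ : a <= s by rewrite /s; lra.
  have st : s < t by rewrite /s/t; lra.
  have [|//|ds Hs] := dP s; first by rewrite st andbT /s/t; lra.
    exact: m'.
  split=> //; rewrite (length_split (ltW st) tb (m _ _ as_ (lexx b))).
  have H12 := leeD Hs (proj2 Pt); apply: le_trans _ H12; rewrite -EFinD lee_fin.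
  have : c * `|phi (g s) - phi (g b)| <=
      c * (`|phi (g s) - phi (g t)| + `|phi (g t) - phi (g b)|).
    by rewrite ler_pM2l// -[phi (g s) - phi (g b)](subrKA (phi (g t))) ler_normD.
  by rewrite mulrDr; lra.
- move=> u; set t := - u => /andP[bu ua] Pu.
  have at_ : a <= t by rewrite /t; lra.
  have tb : t < b by rewrite /t; lra.
  have Ps s : t < s <= b -> P s.
    move=> /andP[ts sb]; rewrite -[s]opprK; apply: Pu.
    by rewrite lerN2 sb /= ltrNl.
  have C1t : C1_curve_at g t by apply: C1; rewrite at_ ltW.
  have [cg _] := C1t.
  have gtK : K r (g t).
    apply: (@chart_ball_closed r (lexx r)) => B /cg /nbhs_ballP[d /= d0 dB].
    have [e [e0 ed eb]] := exists_pos_lt_sub d0 tb.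
    exists (g (t + e)); split.
      have /PK[] // : P (t + e) by apply: Ps; apply/andP; split; lra.
      by apply/andP; split; lra.
    by apply: dB; rewrite -ball_normE/= opprD addrA subrr add0r normrN gtr0_norm//; lra.
  have [dt _] := gtK; split=> //.
  have := lenL t at_.
  have : (0 <= finsler_length g t b)%E.
    by apply: integral_ge0 => v _; rewrite lee_fin fnorm_ge0.
  case E : (finsler_length g t b) => [I| |]//= _ _.
  rewrite lee_fin leNgt; apply/negP => gap.
  set X := c * _ - _ in gap.
  (* A coordinate displacement below [del] changes [X] by less than half of the gap between [X] and
     the length. *)
  pose del := (X - I) / (2 * c).
  have del0 : 0 < del by rewrite divr_gt0 ?subr_gt0 ?mulr_gt0.
  have /nbhs_ballP[d /= d0 dB] := cg _ (chart_near dt del0).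
  have [e [e0 ed eb]] := exists_pos_lt_sub d0 tb.
  set s := t + e; have ts : t <= s by rewrite /s; lra.
  have [ds Hs] : P s by apply: Ps; rewrite /s; apply/andP; split; lra.
  have [|_ gs] := dB s.
    by rewrite -ball_normE/= /s opprD addrA subrr add0r normrN gtr0_norm//; lra.
  have := le_trans Hs (finsler_length_mono ts (m _ _ at_ (lexx b))).
  rewrite E lee_fin.
  have : c * `|phi (g t) - phi (g b)| <=
      c * (`|phi (g t) - phi (g s)| + `|phi (g s) - phi (g b)|).
    by rewrite ler_pM2l// -[phi (g t) - phi (g b)](subrKA (phi (g s))) ler_normD.
  rewrite mulrDr (distrC (phi (g t)) (phi (g s))).
  have : c * `|phi (g s) - phi (g t)| < c * del by rewrite ltr_pM2l.
  have -> : c * del = (X - I) / 2 by rewrite /del; field; rewrite gt_eqF.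
  have : eps * (b - s) <= eps * (b - t) by rewrite ler_pM2l//; lra.
  by move: gap; rewrite /X; lra.
Qed.

(** On a C^1 piece the strict inequality leaves room for a positive [eps], which then tends to 0.
    Pieces are treated from the last to the first, each enlarging the radius by its length over
    [c]. *)
Lemma path_length_ge (gamma : R -> M) (a b : R) : piecewise_C1 gamma a b -> forall L rho,
  (finsler_length gamma a b <= L%:E)%E -> K rho (gamma b) ->
  c * rho + L < c * r -> K (rho + L / c) (gamma a).
Proof.
elim=> [{}a {}b ab [g gE]|{}a e {}b p1 H1 p2 H2] L rho gL Kb Lr.
  have gab t : a <= t <= b -> gamma t = g t by move=> /gE[].
  have C1 t : a <= t <= b -> C1_curve_at g t by move=> /gE[].
  have pg : piecewise_C1 gamma a b by apply: piecewise_C1_one => //; exists g.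
  rewrite (finsler_length_eq pg gab) in gL.
  rewrite gab ?lexx ?ltW//; rewrite gab ?lexx ?ltW// in Kb.
  have ba0 : 0 < b - a by rewrite subr_gt0.
  pose e0 := (c * r - (c * rho + L)) / (b - a).
  have e00 : 0 < e0 by rewrite divr_gt0// subr_gt0.
  have H eps : 0 < eps -> eps <= e0 ->
      chart_dom phi (g a) /\ c * `|phi (g a) - phi (g b)| <= L + eps * (b - a).
    move=> eps0 epse; apply: (@C1_length_ge g a b L rho) => //.
    by move: epse; rewrite ler_pdivlMr//; lra.
  have [dom _] := H _ e00 (lexx _); split=> //.
  suff HL : c * `|phi (g a) - phi (g b)| <= L.
    rewrite -(subrKA (phi (g b))); apply: le_trans (ler_normD _ _) _.
    rewrite addrC lerD//; first by case: Kb.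
    by rewrite ler_pdivlMr// mulrC.
  rewrite leNgt; apply/negP => gap.
  pose eps := Num.min e0 ((c * `|phi (g a) - phi (g b)| - L) / 2 / (b - a)).
  have eps0 : 0 < eps by rewrite lt_min e00 !divr_gt0// subr_gt0.
  have epse : eps <= e0 by rewrite /eps ge_min lexx.
  have [_] := H eps eps0 epse.
  have : eps <= (c * `|phi (g a) - phi (g b)| - L) / 2 / (b - a).
    by rewrite /eps ge_min lexx orbT.
  by rewrite ler_pdivlMr//; lra.
rewrite (finsler_length_cat p1 p2) in gL.
have l1 : (0 <= finsler_length gamma a e)%E.
  by apply: integral_ge0 => v _; rewrite lee_fin fnorm_ge0.
have l2 : (0 <= finsler_length gamma e b)%E.
  by apply: integral_ge0 => v _; rewrite lee_fin fnorm_ge0.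
move: gL l1 l2 (H1) (H2).
case: (finsler_length gamma a e) => [L1| |]//; case: (finsler_length gamma e b) => [L2| |]//.
rewrite -EFinD !lee_fin => L12 L10 L20 {}H1 {}H2.
have Ke : K (rho + L2 / c) (gamma e) by apply: H2 => //; lra.
have [|da ra] := H1 L1 _ (lexx _) Ke.
  by rewrite mulrDr mulrCA divff ?gt_eqF// mulr1; lra.
split=> //; apply: le_trans ra _; rewrite -addrA -mulrDl lerD2l.
by rewrite ler_pM2r ?invr_gt0//; lra.
Qed.
End close.

(** Completeness and its limits are expressed by [finsler_dist]; this turns them into statements
    about the topology of [M]. *)
Lemma finsler_dist_nbhs (R : realType) (n : nat) (M : finslerManifold R n)
    (l : M) (V : set M) : nbhs l V ->
  exists2 eps, 0 < eps & forall y, (finsler_dist y l < eps%:E)%E -> V y.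
Proof.
move=> Vl; set phi := chart_at l.
have dl : chart_dom phi l by exact: chart_at_dom.
have [c0 c00 cP] := is_norm_ge (fnorm_is_norm l).
pose c := c0 / 2; have cpos : 0 < c by rewrite divr_gt0.
have [r1 r10 rP] := chart_inv_ball dl (filterI Vl (fnorm_compare l)).
pose r := r1 / 2; have r0 : 0 < r by rewrite divr_gt0.
have rr1 : r < r1 by rewrite /r; lra.
have ball_ge p : `|p - phi l| <= r -> chart_img phi p /\
    forall w, c * `|w| <= fnorm (chart_inv phi p) (w *m dchart_inv phi (chart_inv phi p)).
  move=> /le_lt_trans /(_ rr1)/rP[imgp [_ H]]; split=> // w.
  by have [_] := H w; have := cP w; rewrite /c; lra.
exists (c * r / 2) => [|y]; first by rewrite !mulr_gt0.
move=> /ereal_inf_lt[_ [g [a [b [pg ga gb ->]]]] /ltW gL].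
have [||] := path_length_ge (chart_at_atlas l) cpos ball_ge pg (rho := 0) gL.
- by rewrite gb; split=> //; rewrite subrr normr0.
- by rewrite mulr0 add0r; have := mulr_gt0 cpos r0; lra.
rewrite ga add0r => dy yr.
have /rP[_ [+ _]] : `|phi y - phi l| < r1.
  apply: le_lt_trans yr _; have -> : c * r / 2 / c = r / 2 by field; rewrite gt_eqF.
  by lra.
by rewrite chart_mapK.
Qed.

(** * Local expansion *)

Lemma local_lipschitz_le (R : realType) (h : R -> \bar R) (a b C : R) : a <= b ->
  (forall t, a <= t <= b -> exists2 d, 0 < d & forall s, a <= s <= b ->
     `|s - t| < d -> (h s <= h t + (C * `|s - t|)%:E)%E /\
                     (h t <= h s + (C * `|s - t|)%:E)%E) ->
  (h b <= h a + (C * (b - a))%:E)%E.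
Proof.
move=> ab H.
suff : forall t, a <= t <= b -> (h t <= h a + (C * (t - a))%:E)%E.
  by apply; rewrite ab lexx.
have add (s t u : R) : (h t <= h s + (C * `|s - t|)%:E)%E -> a <= s <= t ->
    (h s <= h a + (C * (s - a))%:E)%E -> (h t <= h a + (C * (t - a))%:E)%E.
  move=> Hts /andP[as_ st] Hs; apply: le_trans Hts _.
  rewrite distrC ger0_norm ?subr_ge0//.
  have -> : C * (t - a) = C * (s - a) + C * (t - s) by ring.
  by rewrite EFinD addeA leeD2r.
apply: real_induction => [|t /andP[at_ tb] Ht|t /andP[at_ tb] Hs].
- by rewrite subrr mulr0 adde0.
- have [|d d0 dP] := H t; first by rewrite at_ ltW.
  exists d => // s /andP[ts sd] sb.
  have [||Hst _] := dP s; first by rewrite sb (le_trans at_ (ltW ts)).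
    by rewrite gtr0_norm ?subr_gt0//; lra.
  by apply: (add t) => //; rewrite ?at_ ?(ltW ts)// distrC.
- have [|d d0 dP] := H t; first by rewrite tb ltW.
  have [e [e0 ed ea]] := exists_pos_lt_sub d0 at_.
  have nE : `|t - e - t| = e by rewrite addrAC subrr add0r normrN gtr0_norm.
  have [||_ Hte] := dP (t - e).
  + by apply/andP; split; lra.
  + by rewrite nE; lra.
  + by apply: (add (t - e)) => //; [|apply: Hs]; apply/andP; split; lra.
Qed.

Lemma ball_differentiable_lipschitz (R : realType) n m (T : 'rV[R]_n -> 'rV[R]_m)
    (p : 'rV[R]_n) (r C : R) :
  (forall q, `|q - p| < r -> differentiable T q /\ `|'J T q| <= C) ->
  forall x y, `|x - p| < r -> `|y - p| < r ->
    `|T x - T y| <= (n%:R * C + 1) * `|x - y|.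
Proof.
move=> HT x y xr yr; pose g s := y + s *: (x - y).
pose h s : \bar R := (`|T (g s) - T y|)%:E.
have g0 : g 0 = y by rewrite /g scale0r addr0.
have g1 : g 1 = x by rewrite /g scale1r addrC subrK.
have gE s t : g s = g t + (s - t) *: (x - y).
  by apply/rowP => j; rewrite !mxE; ring.
have := @local_lipschitz_le R h 0 1 ((n%:R * C + 1) * `|x - y|) ler01.
rewrite /h g0 g1 subrr normr0 add0e subr0 mulr1 lee_fin; apply => t t01.
have gr : `|g t - p| < r by apply: segment_in_ball.
have [dT JC] := HT _ gr.
(* Accuracy 1 is enough: its error is the [+ 1] in the Lipschitz constant. *)
have /differentiable_mxP/(_ 1 ltr01)[d d0 dP] := conj dT (erefl ('J T (g t))).
have K0 : 0 < `|x - y| + 1 by rewrite ltr_wpDl.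
exists (d / (`|x - y| + 1)); first by rewrite divr_gt0.
move=> s _ std.
have : `|(s - t) *: (x - y)| < d.
  rewrite normrZ; apply: (@le_lt_trans _ _ (`|s - t| * (`|x - y| + 1))).
    by rewrite ler_wpM2l// lerDl.
  by rewrite -ltr_pdivlMr.
move=> /dP; rewrite -gE => H.
have D : `|T (g s) - T (g t)| <= (n%:R * C + 1) * `|x - y| * `|s - t|.
  have -> : T (g s) - T (g t) = T (g s) - T (g t) -
    (s - t) *: (x - y) *m 'J T (g t) + (s - t) *: (x - y) *m 'J T (g t).
    by rewrite subrK.
  apply: le_trans (ler_normD _ _) _.
  have := norm_mulmx_le ((s - t) *: (x - y)) ('J T (g t)).
  move: H; rewrite normrZ.
  have : n%:R * `|'J T (g t)| * (`|s - t| * `|x - y|) <=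
         n%:R * C * (`|s - t| * `|x - y|).
    by rewrite ler_wpM2r ?mulr_ge0// ler_wpM2l.
  lra.
have := ler_normD (T (g s) - T (g t)) (T (g t) - T y); rewrite subrKA.
have := ler_normD (T (g t) - T (g s)) (T (g s) - T y); rewrite subrKA.
by rewrite !lee_fin (distrC (T (g t)) (T (g s))); split; lra.
Qed.

(** * Lipschitz maps read in the distinguished charts *)

Section transition.
Context {R : realType} {n : nat} {M : c1Manifold R n}.

Lemma transition_lipschitz (phi psi : chart R n M) x : atlas phi -> atlas psi ->
  chart_dom phi x -> chart_dom psi x -> exists (L r : R), [/\ 0 <= L, 0 < r &
    forall p q, `|p - phi x| < r -> `|q - phi x| < r ->
      `|psi (chart_inv phi p) - psi (chart_inv phi q)| <= L * `|p - q|].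
Proof.
move=> aphi apsi dphi dpsi.
have [_ cJ] := atlas_compatible aphi apsi dphi dpsi.
set T := psi \o chart_inv phi in cJ.
have [r1 r10 H1] := chart_inv_ball dphi (chart_dom_nbhs dpsi).
have /cvgrPdist_lt/(_ 1 ltr01)/nbhs_ballP[r2 /= r20 H2] := cJ.
have [r [r0 rr1 rr2]] := exists_pos_lt2 r10 r20.
exists (n%:R * (`|'J T (phi x)| + 1) + 1), r.
split=> //.
apply: (@ball_differentiable_lipschitz _ _ _ T) => q qr.
have [imq dq] := H1 q (lt_trans qr rr1).
have [E dq'] := chart_invK imq.
have [dT _] := atlas_compatible aphi apsi dq' dq.
rewrite E in dT; split=> //.
have /H2/ltW J1 : ball (phi x) r2 q by rewrite -ball_normE/= distrC; apply: lt_trans rr2.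
have := ler_normD ('J T q - 'J T (phi x)) ('J T (phi x)); rewrite subrK.
by move=> /le_trans; apply; rewrite addrC lerD2l distrC.
Qed.
End transition.

Lemma lipschitz_near_continuous (R : realType) (V W : normedModType R) (F : V -> W)
    (p : V) (r L : R) :
  0 < r -> (forall x y, `|x - p| < r -> `|y - p| < r -> `|F x - F y| <= L * `|x - y|) ->
  {for p, continuous F}.
Proof.
move=> r0 FL; apply/cvgrPdist_lt => e e0.
pose K := `|L| + 1; have K0 : 0 < K by rewrite ltr_wpDl.
have [d [d0 dr de]] := exists_pos_lt2 r0 (divr_gt0 e0 K0).
apply/nbhs_ballP; exists d => //= q; rewrite -ball_normE/= => qd.
apply: le_lt_trans (FL _ _ _ _) _; first by rewrite subrr normr0.
  by rewrite distrC; exact: lt_trans dr.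
apply: (@le_lt_trans _ _ (K * `|p - q|)).
  rewrite ler_wpM2r// /K; have := ler_norm L; lra.
by rewrite mulrC -ltr_pdivlMr//; exact: lt_trans de.
Qed.

Section local_lipschitz.
Context {R : realType} {m n : nat} {M : c1Manifold R m} {N : c1Manifold R n}.
Variables (f : M -> N) (x : M).
Hypothesis fl : lipschitz_near f x.
Let phi := chart_at x.
Let psi := chart_at (f x).

Lemma lipschitz_near_ball : exists (phi' : chart R m M) (psi' : chart R n N) (L r : R),
  [/\ atlas phi', atlas psi', chart_dom phi' x, f @` chart_dom phi' `<=` chart_dom psi' &
  0 < r /\ forall p q, `|p - phi' x| < r -> `|q - phi' x| < r ->
    `|local_rep f phi' psi' p - local_rep f phi' psi' q| <= L * `|p - q|].
Proof.
have [phi' [psi' [a1 a2 d1 d2 [fd [W /nbhs_ballP[r /= r0 rW] [K [_ KL]]]]]]] := fl.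
exists phi', psi', (K + 1), r; split => //; split => // p q pr qr.
have K1 : K < K + 1 by lra.
by apply: (KL _ K1 (p, q)); split; apply: rW; rewrite -ball_normE/= distrC.
Qed.

Lemma lipschitz_near_continuousM : {for x, continuous f}.
Proof.
have [phi' [psi' [L [r [a1 a2 d1 fd [r0 FL]]]]]] := lipschitz_near_ball.
have cF := lipschitz_near_continuous r0 FL.
set F := local_rep f phi' psi' in cF.
apply: (@near_eq_continuous_at _ _ (fun y => chart_inv psi' (F (phi' y)))).
  apply: filterS (chart_dom_nbhs d1) => y dy; rewrite /F /local_rep /= chart_mapK// chart_mapK//.
  by apply: fd; exists y.
apply: (@continuous_comp _ _ _ (fun y => F (phi' y)) (chart_inv psi')).
  by apply: continuous_comp; [exact: chart_map_continuous|].
rewrite /F /local_rep /= chart_mapK//; apply: chart_inv_continuous.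
by apply: fd; exists x.
Qed.

(** [lipschitz_near] provides some pair of charts, while the Clarke differential is computed in the
    distinguished ones; the transition maps, being C^1, are Lipschitz near the point. *)
Lemma local_rep_lipschitz : exists (L r : R), [/\ 0 <= L, 0 < r &
  forall p q, `|p - phi x| < r -> `|q - phi x| < r ->
    `|local_rep f phi psi p - local_rep f phi psi q| <= L * `|p - q|].
Proof.
have [phi' [psi' [L0 [r0 [a1 a2 d1 fd [r00 FL]]]]]] := lipschitz_near_ball.
have dpsi' : chart_dom psi' (f x) by apply: fd; exists x.
have [L1 [r1 [L10 r10 H1]]] := transition_lipschitz (chart_at_atlas x) a1 (chart_at_dom x) d1.
have [L2 [r2 [L20 r20 H2]]] :=
  transition_lipschitz a2 (chart_at_atlas (f x)) dpsi' (chart_at_dom _).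
have near2 : \forall y \near x, chart_dom psi' (f y) /\ `|psi' (f y) - psi' (f x)| < r2.
  by have := lipschitz_near_continuousM (chart_near dpsi' r20).
have [r3 r30 H3] := chart_inv_ball (chart_at_dom x) (filterI (chart_near d1 r00) near2).
have [r [rpos rr1 rr3]] := exists_pos_lt2 r10 r30.
exists (L2 * (`|L0| * L1)), r; split=> //; first by rewrite !mulr_ge0.
move=> p q pr qr.
have [_ [[dp pr0] [dfp pr2]]] := H3 p (lt_trans pr rr3).
have [_ [[dq qr0] [dfq qr2]]] := H3 q (lt_trans qr rr3).
rewrite /local_rep /= -(chart_mapK dfp) -(chart_mapK dfq).
apply: le_trans (H2 _ _ pr2 qr2) _; rewrite -!mulrA ler_wpM2l//.
have := FL _ _ pr0 qr0; rewrite /local_rep /= !chart_mapK// => /le_trans; apply.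
apply: (@le_trans _ _ (`|L0| * `|phi' (chart_inv phi p) - phi' (chart_inv phi q)|)).
  by rewrite ler_wpM2r// ler_norm.
rewrite ler_wpM2l//; apply: H1; first exact: lt_trans rr1.
exact: lt_trans rr1.
Qed.
End local_lipschitz.

Definition has_local_section (X Y : topologicalType) (f : X -> Y) (x : X) :=
  exists (U : set X) (V : set Y) (g : Y -> X),
  [/\ open U /\ U x, open V /\ V (f x), (forall y, U y -> V (f y) /\ g (f y) = y) &
    forall w, V w -> [/\ U (g w), f (g w) = w & {for w, continuous g}]].

(** * Expansion and local inverses at a point with positive co-norm *)

Section local_inverse.
Context {R : realType} {n : nat} {M N : finslerManifold R n}.
Variables (f : M -> N) (x : M) (c : R).
Hypotheses (fl : lipschitz_near f x) (c0 : 0 < c) (cx : (c%:E < conorm f x)%E).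
Let phi := chart_at x.
Let psi := chart_at (f x).
Let F := local_rep f phi psi.

Lemma clarke_ge_conorm (k : R) A v : (k%:E <= conorm f x)%E -> clarke F (phi x) A ->
  k * fnorm x v <= fnorm (f x) (v *m A).
Proof.
move=> kx FA; have [->|v0] := eqVneq v 0.
  by rewrite mul0mx !is_norm0 ?mulr0//; exact: fnorm_is_norm.
have a0 := is_norm_gt0 (fnorm_is_norm x) v0.
pose u := (fnorm x v)^-1 *: v.
have H : (k%:E <= (fnorm (f x) (u *m A))%:E)%E.
  apply: le_trans kx _; apply: le_trans (ereal_inf_lbound _) _.
    exists A; last reflexivity.
    exists A => //; rewrite (dchart_chart_at x).1 (dchart_chart_at (f x)).2.
    by rewrite mul1mx mulmx1.
  apply: ereal_inf_lbound; exists u => //=.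
  by rewrite fnormZ normfV gtr0_norm// mulVf// gt_eqF.
move: H; rewrite lee_fin /u -scalemxAl fnormZ normfV gtr0_norm// mulrC.
by rewrite ler_pdivlMr.
Qed.

Lemma local_expansion_chart : exists d theta : R,
  [/\ 0 < d /\ 0 < theta,
    forall p, `|p - phi x| < d -> chart_img phi p /\ chart_dom psi (f (chart_inv phi p)),
    forall p q, `|p - phi x| < d -> `|q - phi x| < d ->
      c * fnorm x (q - p) <= fnorm (f x) (F q - F p),
    forall p q, `|p - phi x| < d -> `|q - phi x| < d ->
      theta * `|q - p| <= `|F q - F p| &
    forall rho, 0 < rho -> rho < d -> exists2 delta, 0 < delta &
      forall y, `|y - F (phi x)| < delta -> exists2 p, `|p - phi x| < rho & F p = y].
Proof.
(* The co-norm may be [+oo], in which case any finite [k] above [c] serves. *)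
have [k ck kx] : exists2 k, c < k & (k%:E <= conorm f x)%E.
  move: cx; case: (conorm f x) => [k| |]//=; first by rewrite lte_fin => ck; exists k.
  by move=> _; exists (c + 1); [lra|rewrite leey].
(* The loss from [k] to [c1] pays for enlarging the Clarke differential to a convex neighbourhood,
   the loss from [c1] to [c] for the strict separation in [lower_lipschitz]. *)
pose c1 := (c + k) / 2; have c1k : c1 < k by rewrite /c1; lra.
have cc1 : 0 <= c < c1 by rewrite (ltW c0) /c1 /=; lra.
have [L [r [L0 r0 FL]]] := local_rep_lipschitz fl.
have na := fnorm_is_norm x; have nb := fnorm_is_norm (f x).
have [S [d1 [K [/andP[d10 d1r] cS SK Sge FS]]]] :=
  clarke_convex_neighborhood r0 L0 FL na nb c1k (fun A v => clarke_ge_conorm v kx).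
have dom : \forall y \near x, chart_dom psi (f y).
  by apply: (lipschitz_near_continuousM fl); apply/chart_dom_nbhs/chart_at_dom.
have [d2 d20 Hd2] := chart_inv_ball (chart_at_dom x) dom.
have [d [d0 dd1 dd2]] := exists_pos_lt2 d10 d20.
have FL' p q : `|p - phi x| < d -> `|q - phi x| < d -> `|F p - F q| <= L * `|p - q|.
  by move=> pd qd; apply: FL; apply: lt_le_trans d1r; exact: lt_trans dd1.
have FS' q : `|q - phi x| < d -> differentiable F q -> S ('J F q).
  by move=> qd; apply: FS; exact: lt_trans dd1.
have low p q : `|p - phi x| < d -> `|q - phi x| < d ->
    c * fnorm x (q - p) <= fnorm (f x) (F q - F p).
  move=> pd qd; exact: (lower_lipschitz L0 na nb FL' cS SK Sge FS' cc1 pd qd).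
have [C C0 bC] := is_norm_le nb; have [e e0 ae] := is_norm_ge na.
pose theta := c * e / C; have theta0 : 0 < theta by rewrite divr_gt0// mulr_gt0.
have lowF p q : `|p - phi x| < d -> `|q - phi x| < d ->
    theta * `|q - p| <= `|F q - F p|.
  move=> pd qd; have H := low p q pd qd.
  rewrite /theta mulrAC ler_pdivrMr// mulrC.
  have := bC (F q - F p); have := ler_wpM2l (ltW c0) (ae (q - p)); lra.
exists d, theta; split=> // [p pd|rho rho0 rhod].
  by apply: Hd2; exact: lt_trans dd2.
have c10 : 0 < c1 by rewrite /c1; lra.
apply: (clarke_surjective L0 na nb FL' cS SK Sge FS' c10 theta0) => [p pd|].
  by apply: lowF; rewrite // subrr normr0.
by rewrite rho0.
Qed.

Lemma local_expansion : exists2 r, 0 < r & forall y z,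
  chart_dom phi y -> chart_dom phi z -> `|phi y - phi x| < r -> `|phi z - phi x| < r ->
  c * fnorm x (phi z - phi y) <= fnorm (f x) (psi (f z) - psi (f y)).
Proof.
have [d [theta [[d0 _] _ H _ _]]] := local_expansion_chart; exists d => // y z dy dz yd zd.
by have := H _ _ yd zd; rewrite /F /local_rep /= !chart_mapK.
Qed.

(** Surjectivity onto a small ball supplies the inverse [G] in charts; the lower bound [theta] makes
    it unique and Lipschitz with constant [theta^-1]. *)
Lemma local_section : continuous f -> has_local_section f x.
Proof.
move=> cf; have [d [theta [[d0 theta0] img _ lowF surj]]] := local_expansion_chart.
have [rho [rho0 rhod _]] := exists_pos_lt2 d0 d0.
have [delta delta0 Hd] := surj rho rho0 rhod.
have [t [t0 td tV]] : exists t, [/\ 0 < t, t <= delta & forall p, `|p - psi (f x)| < t ->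
    chart_img psi p].
  have [t t0 tV] := chart_inv_ball (chart_at_dom (f x)) filterT.
  exists (Num.min t delta); rewrite lt_min t0 delta0 ge_min lexx orbT.
  by split=> // p; rewrite lt_min => /andP[/tV[]].
have Fx : F (phi x) = psi (f x) by rewrite /F /local_rep /= chart_mapK//; exact: chart_at_dom.
rewrite Fx in Hd.
have /choice[G GP] : forall q, exists p, `|q - psi (f x)| < delta ->
    `|p - phi x| < rho /\ F p = q.
  move=> q; have [/Hd[p pr pE]|nq] := pselect (`|q - psi (f x)| < delta).
    by exists p.
  by exists 0.
pose V : set N := [set w | chart_dom psi w /\ `|psi w - psi (f x)| < t].
have Vt w : V w -> `|psi w - psi (f x)| < delta by move=> [_ h]; exact: lt_le_trans h td.
pose U : set M := [set y | (chart_dom phi y /\ `|phi y - phi x| < rho) /\ V (f y)].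
have oV : open V by exact: chart_ball_open.
pose g w := chart_inv phi (G (psi w)).
have imgU p : `|p - phi x| < rho -> chart_img phi p /\ chart_dom psi (f (chart_inv phi p)).
  by move=> pr; apply: img; exact: lt_trans rhod.
have gP w : V w -> U (g w) /\ f (g w) = w.
  move=> Vw; have [dw _] := Vw; have [Gr FG] := GP _ (Vt w Vw).
  have [/chart_invK[E dG] dfG] := imgU _ Gr.
  have fg : f (g w) = w.
    by rewrite -[RHS](chart_mapK dw) -FG /F /local_rep /= chart_mapK.
  by split=> //; split; [split=> //; rewrite E|rewrite fg].
have gU y : U y -> g (f y) = y.
  move=> [[dy yr] Vfy]; have [[[dg gr] _] fg] := gP _ Vfy.
  rewrite -[LHS](chart_mapK dg) -[RHS](chart_mapK dy); congr (chart_inv phi _).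
  have := lowF _ _ (lt_trans yr rhod) (lt_trans gr rhod).
  rewrite /F /local_rep /= !chart_mapK// fg subrr normr0 pmulr_rle0//.
  by rewrite normr_le0 subr_eq0 => /eqP.
exists U, V, g; split.
- split; last first.
    split; last by split; [exact: chart_at_dom|rewrite subrr normr0].
    by split; [exact: chart_at_dom|rewrite subrr normr0].
  by apply: openI; [exact: chart_ball_open|apply: open_comp => // y _; exact: cf].
- split=> //; split; [exact: chart_at_dom|by rewrite subrr normr0].
- by move=> y Uy; split; [case: Uy|exact: gU].
- move=> w Vw; have [Ugw fgw] := gP w Vw; split=> //.
  have [dw _] := Vw.
  apply/(continuous_comp (f := psi) (g := chart_inv phi \o G)).
    exact: chart_map_continuous.
  have [Gr FG] := GP _ (Vt w Vw).
  have [imG _] := imgU _ Gr; have [E dG] := chart_invK imG.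
  apply: (@continuous_comp _ _ _ G (chart_inv phi)); last first.
    by have := chart_inv_continuous dG; rewrite E.
  have s0 : 0 < delta - `|psi w - psi (f x)| by rewrite subr_gt0; exact: Vt.
  apply: (@lipschitz_near_continuous _ _ _ _ _ _ theta^-1 s0) => p q pr qr.
  have inV u : `|u - psi w| < delta - `|psi w - psi (f x)| -> `|u - psi (f x)| < delta.
    by move=> ur; have := ler_normD (u - psi w) (psi w - psi (f x)); rewrite subrKA; lra.
  have [Gp Fp] := GP _ (inV _ pr); have [Gq Fq] := GP _ (inV _ qr).
  have := lowF _ _ (lt_trans Gq rhod) (lt_trans Gp rhod).
  by rewrite Fp Fq mulrC -ler_pdivlMr// mulrC.
Qed.
End local_inverse.

(** * From the divergent integral to a divergent series *)

Lemma trunc_itv_bigcup (R : realType) :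
  `[0, +oo[%classic = \bigcup_(k : nat) (`[k%:R, k.+1%:R[%classic : set R).
Proof.
apply/seteqP; split=> t /=; rewrite in_itv/= andbT.
  move=> t0; exists (Num.truncn t) => //=; rewrite in_itv/=.
  exact: truncn_itv.
by move=> [k _]; rewrite /= in_itv/= => /andP[kt _]; apply: le_trans kt.
Qed.

(** Half of the integral test: on [[k, k + 1[] a nonincreasing [m] is at most [m k]. *)
Lemma integral_le_sum (R : realType) (m : R -> R) (B : R) :
  (forall t, 0 <= m t) -> (forall s t, s <= t -> m t <= m s) ->
  (forall K : nat, \sum_(k < K) m k%:R <= B) ->
  (\int[@lebesgue_measure R]_(t in `[0%R, +oo[%classic) (m t)%:E <= B%:E)%E.
Proof.
move=> m0 mm mB.
have mmeas (D : set R) : measurable D -> measurable_fun D (EFin \o m).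
  by move=> mD; apply/measurable_EFinP; apply: nonincreasing_measurable.
rewrite trunc_itv_bigcup ge0_integral_bigcup//; last first.
- apply/trivIsetP => i j _ _ ij; apply/seteqP; split=> // t /=.
  rewrite !in_itv/= => -[/andP[it ti] /andP[jt tj]]; case/negP: ij.
  have := le_lt_trans it tj; have := le_lt_trans jt ti.
  by rewrite !ltr_nat !ltnS => ? ?; rewrite eqn_leq; apply/andP.
- by move=> t _; rewrite lee_fin.
- by apply: (mmeas); apply: bigcupT_measurable => k.
apply: (@le_trans _ _ (\sum_(0 <= k <oo) (m k%:R)%:E)%E).
  apply: lee_nneseries => k _; first by move=> _; apply: integral_ge0 => t _; rewrite lee_fin.
  apply: (@le_trans _ _ (\int[@lebesgue_measure R]_(t in `[k%:R, k.+1%:R[) (cst (m k%:R)%:E t))%E).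
    apply: ge0_le_integral => //; first by move=> t _; rewrite lee_fin.
      exact: mmeas.
    by move=> t /=; rewrite in_itv/= => /andP[kt _]; rewrite lee_fin mm.
  rewrite integral_cst//= lebesgue_measure_itv/= lte_fin ltr_nat ltnSn.
  by rewrite -EFinB -natrB// subSnn mule1.
apply: lime_le; first by apply: is_cvg_nneseries => k _ _; rewrite lee_fin.
by near=> K; rewrite sumEFin lee_fin big_mkord.
Unshelve. all: by end_near. Qed.

Section profile.
Context {R : realType} {n : nat} {M N : finslerManifold R n}.
Variables (f : M -> N).
Hypothesis fl : locally_lipschitz f.

Lemma clarke_diff_of_clarke x A :
  clarke (local_rep f (chart_at x) (chart_at (f x))) (chart_at x x) A -> clarke_diff f x A.
Proof.
move=> cA; exists A => //.
by rewrite (dchart_chart_at x).1 (dchart_chart_at (f x)).2 mul1mx mulmx1.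
Qed.

Lemma clarke_diff_nonempty x : clarke_diff f x !=set0.
Proof.
have [L [r [L0 r0 FL]]] := local_rep_lipschitz (fl x).
set F := local_rep _ _ _ in FL; set p := chart_at x x in FL.
have [d /andP[d0 dr] H] := jacobian_near_clarke r0 L0 FL ltr01.
have [q qr dq] : exists2 q, `|q - p| < d & differentiable F q.
  (* Without a point of differentiability, the hypothesis of the mean value inequality would hold
     vacuously for [s = 1] and the zero covector, and its conclusion would read [1 <= 0]. The vector
     [v] vanishes only in dimension 0, where every map is differentiable. *)
  apply: contrapT => nd; pose v : 'rV[R]_n := const_mx (d / 2).
  have [v0|v0] := eqVneq v 0; last first.
    have vr : `|p + v - p| < d.
      rewrite addrC addKr; apply: (@le_lt_trans _ _ (d / 2)); last by lra.
      apply: mx_norm_le => [|i j]; first by lra.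
      by rewrite mxE gtr0_norm ?divr_gt0.
    have FL' y z : `|y - p| < d -> `|z - p| < d -> `|F y - F z| <= L * `|y - z|.
      by move=> yd zd; apply: FL; exact: lt_le_trans dr.
    have FS q : `|q - p| < d -> differentiable F q -> 1 <= (v *m 'J F q *m (0 : 'cV_n)) 0 0.
      by move=> qd dq; case: nd; exists q.
    have pd : `|p - p| < d by rewrite subrr normr0.
    by have := mean_value_local L0 FL' v0 FS pd vr; rewrite mulmx0 mxE ler10.
  case: nd; exists p; first by rewrite subrr normr0.
  apply: (proj1 ((differentiable_mxP F p 0).1 _)) => e e0; exists 1 => // h _.
  have -> : h = 0.
    apply/rowP => j; have /rowP/(_ j) := v0; rewrite !mxE => /eqP.
    by rewrite gt_eqF ?divr_gt0.
  by rewrite addr0 subrr mul0mx subrr normr0 mulr0.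
have [A cA _] := H q qr dq; exists A; exact: clarke_diff_of_clarke.
Qed.

Lemma conorm_ge0 x : (0 <= conorm f x)%E.
Proof.
apply/ereal_infP => _ [B _ <-]; apply/ereal_infP => _ [v _ <-].
by rewrite lee_fin fnorm_ge0.
Qed.

Lemma conorm_lt_pinfty x : (0 < n)%N -> (conorm f x < +oo)%E.
Proof.
move=> n0; have [B fB] := clarke_diff_nonempty x.
pose v : 'rV[R]_n := const_mx 1.
have v0 : v != 0.
  apply/eqP => /rowP /(_ (Ordinal n0)); rewrite !mxE => /eqP.
  by rewrite oner_eq0.
have a0 := is_norm_gt0 (fnorm_is_norm x) v0.
pose u := (fnorm x v)^-1 *: v.
apply: (@le_lt_trans _ _ (fnorm (f x) (u *m B))%:E); last by rewrite ltry.
apply: le_trans (ereal_inf_lbound _) _; first by exists B; [exact: fB|reflexivity].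
apply: ereal_inf_lbound; exists u => //=.
by rewrite fnormZ normfV gtr0_norm// mulVf// gt_eqF.
Qed.

Lemma conorm_dim0 x : n = 0 -> conorm f x = +oo%E.
Proof.
move=> n0; apply/eqP; rewrite -leye_eq; apply/ereal_infP => _ [B _ <-].
apply/ereal_infP => _ [v /= v1 <-]; exfalso; move: v1.
have -> : v = 0 by apply/rowP => j; exfalso; move: (ltn_ord j); rewrite [X in (_ < X)%N]n0.
by rewrite (is_norm0 (fnorm_is_norm x)) => /eqP; rewrite eq_sym oner_eq0.
Qed.

(** The sequence is [m k / 2], the half making the last inequality strict. It is positive because
    [m] is nonincreasing: a zero at [k] would persist and leave the partial sums bounded. *)
Lemma conorm_profile (x0 : M) :
  (\int[@lebesgue_measure R]_(t in `[0%R, +oo[%classic)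
     ereal_inf [set conorm f x | x in finsler_closed_ball x0 t] = +oo)%E ->
  exists mu : nat -> R, [/\ forall k, 0 < mu k,
    forall B, exists K : nat, B < \sum_(k < K) mu k &
    forall (k : nat) x, (finsler_dist x0 x <= k%:R%:E)%E -> ((mu k)%:E < conorm f x)%E].
Proof.
move=> int_oo.
have [n0|npos] := posnP n.
  exists (fun=> 1); split=> // [B|k x _]; last by rewrite conorm_dim0// ltry.
  exists (Num.truncn B).+1; rewrite big_const_ord iter_addr_0.
  exact: truncnS_gt.
pose mE t := ereal_inf [set conorm f x | x in finsler_closed_ball x0 t].
have mE0 t : (0 <= mE t)%E by apply/ereal_infP => _ [x _ <-]; exact: conorm_ge0.
have mE_le s t : s <= t -> (mE t <= mE s)%E.
  move=> st; apply: le_ereal_inf => _ [x xs <-]; exists x => //.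
  by apply: le_trans xs _; rewrite lee_fin.
have mEfin t : 0 <= t -> mE t \is a fin_num.
  move=> t0; rewrite ge0_fin_numE//.
  apply: le_lt_trans (ereal_inf_lbound _) (conorm_lt_pinfty x0 npos).
  by exists x0 => //; apply: le_trans (finsler_dist_refl x0) _; rewrite lee_fin.
(* For negative [t] the ball is empty and its infimum is [+oo]; truncation at 0 keeps [m] finite and
   monotone on the whole line. *)
pose m t := fine (mE (Num.max t 0)).
have max0 (t : R) : 0 <= Num.max t 0 by rewrite le_max lexx orbT.
have mEm t : 0 <= t -> mE t = (m t)%:E.
  by move=> t0; rewrite /m (max_idPl t0) fineK// mEfin.
have m0 t : 0 <= m t by rewrite /m fine_ge0.
have m_le s t : s <= t -> m t <= m s.
  move=> st; rewrite /m fine_le ?mEfin//; apply: mE_le.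
  by rewrite ge_max !le_max st lexx orbT.
have unb B : exists K : nat, B < \sum_(k < K) m k%:R.
  apply: contrapT => noK.
  have : (\int[@lebesgue_measure R]_(t in `[0%R, +oo[%classic) (m t)%:E <= B%:E)%E.
    apply: integral_le_sum => // K; rewrite leNgt; apply/negP => BK.
    by apply: noK; exists K.
  suff -> : (\int[@lebesgue_measure R]_(t in `[0%R, +oo[%classic) (m t)%:E = +oo)%E.
    by rewrite leye_eq.
  rewrite -int_oo; apply: eq_integral => t; rewrite inE/= in_itv/= andbT => t0.
  by rewrite -mEm.
have mpos k : 0 < m k%:R.
  rewrite lt_def m0 andbT; apply/negP => /eqP mk0.
  have tail j : (k <= j)%N -> m j%:R = 0.
    move=> kj; apply/le_anti; rewrite m0 andbT -mk0; apply: m_le.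
    by rewrite ler_nat.
  have [K] := unb (\sum_(i < k) m i%:R).
  rewrite ltNge => /negP; apply.
  elim: K => [|K IH]; first by rewrite big_ord0 sumr_ge0.
  rewrite big_ord_recr/=; have [kK|Kk] := leqP k K; first by rewrite tail// addr0.
  rewrite -(big_ord_recr K (fun i => m i%:R)) /= -!(big_mkord xpredT (fun i => m i%:R)).
  by rewrite (@big_cat_nat _ _ _ K.+1 0 k)//= lerDl sumr_ge0.
exists (fun k => m k%:R / 2); split=> [k|B|k x xk].
- by rewrite divr_gt0.
- by have [K BK] := unb (2 * B); exists K; rewrite -mulr_suml; lra.
- apply: (@lt_le_trans _ _ (m k%:R)%:E).
    by rewrite lte_fin; have := mpos k; lra.
  by rewrite -mEm//; apply: ereal_inf_lbound; exists x.
Qed.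
End profile.

(** * Lifting of chart segments *)

(** Continuity relative to [[a, b]], with no condition on the values outside. Lifts can therefore be
    restricted, and glued from pieces that are arbitrary elsewhere. *)
Definition continuous_on (R : realType) (X : topologicalType) (a b : R) (s : R -> X) :=
  forall t, a <= t <= b -> forall O, nbhs (s t) O ->
  exists2 d, 0 < d & forall u, a <= u <= b -> `|u - t| < d -> O (s u).

Lemma continuous_on_sub (R : realType) (X : topologicalType) (a b a' b' : R) (s : R -> X) :
  a <= a' -> b' <= b -> continuous_on a b s -> continuous_on a' b' s.
Proof.
move=> aa bb cs t /andP[at_ tb] O Ot.
have [|d d0 dO] := cs t _ O Ot; first by rewrite (le_trans aa) ?(le_trans tb).
exists d => // u /andP[au ub]; apply: dO.
by rewrite (le_trans aa) ?(le_trans ub).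
Qed.

Lemma continuous_at_on (R : realType) (X : topologicalType) (a b : R) (s : R -> X) :
  (forall t, a <= t <= b -> {for t, continuous s}) -> continuous_on a b s.
Proof.
move=> cs t tab O /(cs t tab)/nbhs_ballP[d /= d0 dO]; exists d => // u _ ud.
by apply: dO; rewrite -ball_normE/= distrC.
Qed.

Lemma hausdorff_eq (X : topologicalType) (p q : X) : hausdorff_space X ->
  (forall A B, nbhs p A -> nbhs q B -> A `&` B !=set0) -> p = q.
Proof. by move=> hX H; apply: hX => A B; exact: H. Qed.

Section lift_unique.
Context {R : realType} {X Y : topologicalType}.
Variable f : X -> Y.
Hypothesis hX : hausdorff_space X.
Hypothesis linj : forall x : X, exists2 U, nbhs x U & forall y z, U y -> U z -> f y = f z -> y = z.

(** Agreement passes beyond [t] by local injectivity of [f], and to limit parameters because [X] is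
    Hausdorff. *)
Lemma lift_unique (a b : R) (s s' : R -> X) : a <= b ->
  continuous_on a b s -> continuous_on a b s' ->
  (forall t, a <= t <= b -> f (s t) = f (s' t)) -> s a = s' a ->
  forall t, a <= t <= b -> s t = s' t.
Proof.
move=> ab cs cs' E Ea; apply: real_induction => // t /andP[at_ tb] Ht.
  have tab : a <= t <= b by rewrite at_ ltW.
  have [U Ut inj] := linj (s t).
  have [d d0 dU] := cs t tab U Ut; rewrite Ht in Ut.
  have [d' d'0 d'U] := cs' t tab U Ut.
  exists (Num.min d d'); first by rewrite lt_min d0.
  move=> u /andP[tu ud] ub; have uab : a <= u <= b by rewrite ub (le_trans at_ (ltW tu)).
  have : `|u - t| < Num.min d d' by rewrite gtr0_norm ?subr_gt0//; lra.
  by rewrite lt_min => /andP[? ?]; apply: inj; [apply: dU|apply: d'U|apply: E].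
have tab : a <= t <= b by rewrite (ltW at_).
apply: hausdorff_eq => // A B At Bt.
have [d d0 dA] := cs t tab A At; have [d' d'0 d'B] := cs' t tab B Bt.
have [m [m0 md md']] := exists_pos_lt2 d0 d'0.
have [e [e0 em ea]] := exists_pos_lt_sub m0 at_.
have uab : a <= t - e <= b by apply/andP; split; lra.
have te : `|t - e - t| = e by rewrite addrAC subrr add0r normrN gtr0_norm.
exists (s (t - e)); split; first by apply: dA; rewrite // te (lt_trans em).
by rewrite Ht; [apply: d'B; rewrite // te (lt_trans em)|apply/andP; split; lra].
Qed.
End lift_unique.

(* For r to rise from the level k to k + 1 takes at least the time mu (k + 1) / C,
   and these times have a divergent sum. *)
Lemma local_growth_bounded (R : realType) (mu : nat -> R) (r : R -> R) (T C : R) :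
  (forall k, 0 < mu k) -> (forall B, exists K : nat, B < \sum_(k < K) mu k) -> 0 < C ->
  (forall u (k : nat), 0 <= u < T -> r u <= k%:R -> exists2 d, 0 < d &
     forall v, 0 <= v < T -> `|v - u| < d -> `|r v - r u| <= C / mu k * `|v - u|) ->
  exists K : nat, forall u, 0 <= u < T -> r u <= K%:R.
Proof.
move=> mu0 mu_oo C0 H.
have [T0|T0] := leP T 0.
  by exists 0%N => u /andP[u0 uT]; move: (le_lt_trans u0 uT); rewrite ltNge T0.
have r_le u : exists k : nat, r u <= k%:R.
  by exists (Num.truncn (r u)).+1; apply/ltW; exact: truncnS_gt.
have [k0 k0P] := r_le 0.
(* A lower bound for the time needed to reach the level [k0 + k]. Between the levels [k0 + j] and
   [k0 + j + 1] the rate is governed by the upper one, whence the successor. *)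
pose tau (k : nat) := \sum_(j < k) mu (k0 + j).+1 / C.
have tau0 k : 0 <= tau k by apply: sumr_ge0 => j _; rewrite ltW// divr_gt0.
have key k u : 0 <= u < T -> u <= tau k -> r u <= (k0 + k)%:R.
  elim: k u => [|k IH] u /andP[u0 uT].
    rewrite /tau big_ord0 => ule0; have -> : u = 0 by apply/le_anti; rewrite ule0.
    by rewrite addn0.
  have [uk _|ku] := leP u (tau k).
    by apply: le_trans (IH u _ uk) _; [rewrite u0|rewrite ler_nat addnS].
  rewrite {1}/tau big_ord_recr/= -/(tau k) => utau.
  set m := mu (k0 + k).+1 in utau.
  have m0 : 0 < m by exact: mu0.
  have le1 v : v <= u -> C / m * (v - tau k) <= 1.
    move=> vu; rewrite mulrAC ler_pdivrMr// mul1r mulrC -ler_pdivlMr//; lra.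
  have inT v : tau k <= v -> v <= u -> 0 <= v < T.
    by move=> kv vu; rewrite (le_trans (tau0 k) kv) (le_lt_trans vu uT).
  suff Q : forall v, tau k <= v <= u -> r v <= (k0 + k)%:R + C / m * (v - tau k).
    have := Q u; rewrite lexx (ltW ku) => /(_ isT) Qu.
    by apply: le_trans Qu _; rewrite addnS -natr1 lerD2l le1.
  apply: real_induction => [|v /andP[kv vu] Qv|v /andP[kv vu] Qv].
  - by rewrite subrr mulr0 addr0 IH// inT// ltW.
  - have rv : r v <= (k0 + k).+1%:R.
      by apply: le_trans Qv _; rewrite -natr1 lerD2l le1// ltW.
    have [d d0 dP] := H v _ (inT _ kv (ltW vu)) rv; exists d => // s /andP[vs sd] su.
    have := dP s (inT _ (le_trans kv (ltW vs)) su).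
    rewrite gtr0_norm ?subr_gt0// -/m => /(_ _); rewrite ltrBlDl => /(_ sd) H1.
    have := ler_norm (r s - r v).
    move: H1 Qv; set p := C / m; lra.
  (* Here [kv'] is any level above [r v]; the local bound at [v] serves only as continuity from the
     left. *)
  - have [kv' rv] := r_le v.
    have [d d0 dP] := H v kv' (inT _ (ltW kv) vu) rv.
    set p := C / m; set q := C / mu kv' in dP.
    have p0 : 0 < p by rewrite divr_gt0.
    have q0 : 0 < q by rewrite divr_gt0.
    rewrite leNgt; apply/negP; set B := _ + _ => gap.
    have G0 : 0 < (r v - B) / (2 * q) by rewrite divr_gt0 ?subr_gt0// mulr_gt0.
    have [e1 [e10 ed1 ea1]] := exists_pos_lt_sub d0 kv.
    have [e [e0 ee1 eg]] := exists_pos_lt2 e10 G0.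
    have kve : tau k <= v - e by lra.
    have vev : v - e <= u by lra.
    have nE : `|v - e - v| = e by rewrite addrAC subrr add0r normrN gtr0_norm.
    have := dP (v - e) (inT _ kve vev); rewrite nE => /(_ _).
    have -> : e < d by lra.
    move=> /(_ isT); rewrite distrC => h1.
    have := ler_norm (r v - r (v - e)).
    have := Qv (v - e); rewrite kve gtrBl e0 => /(_ isT); rewrite -/p => h2.
    have q20 : 0 < 2 * q by rewrite mulr_gt0.
    move: eg; rewrite (ltr_pdivlMr _ _ q20).
    have : p * (v - e - tau k) <= p * (v - tau k) by rewrite ler_pM2l//; lra.
    move: h1 h2 gap; rewrite /B -/p; lra.
(* The sum defining [tau] starts at index [k0 + 1], so the first [k0 + 1] terms are added to the
   bound to ensure that [tau K] exceeds [T]. *)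
have [K KT] := mu_oo (C * T + \sum_(j < k0.+1) mu j).
exists (k0 + K)%N => u uT; have /andP[_ uT'] := uT; apply: (key K u uT).
apply: (le_trans (ltW uT')).
rewrite /tau -big_distrl/= ler_pdivlMr// mulrC ltW//.
have : \sum_(j < K) mu j <= \sum_(j < k0.+1 + K) mu j.
  rewrite addnC big_split_ord/= lerDl sumr_ge0// => j _; exact: ltW.
rewrite big_split_ord/=; move: KT; lra.
Qed.

Section finsler_distance_real.
Context {R : realType} {n : nat} {M : finslerManifold R n}.

Lemma finsler_dist_ge0 (x y : M) : (0 <= finsler_dist x y)%E.
Proof.
apply/ereal_infP => _ [g [a [b [_ _ _ ->]]]].
by apply: integral_ge0 => t _; rewrite lee_fin fnorm_ge0.
Qed.

Lemma finsler_dist_fineE (M_connected : connected [set: M]) (x y : M) :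
  (fine (finsler_dist x y))%:E = finsler_dist x y.
Proof.
rewrite fineK// ge0_fin_numE; first exact: finsler_dist_fin.
exact: finsler_dist_ge0.
Qed.
End finsler_distance_real.

Lemma local_lipschitz_ge (R : realType) (h : R -> \bar R) (a b C : R) : a <= b ->
  (forall t, a <= t <= b -> exists2 d, 0 < d & forall s, a <= s <= b ->
     `|s - t| < d -> (h s <= h t + (C * `|s - t|)%:E)%E /\
                     (h t <= h s + (C * `|s - t|)%:E)%E) ->
  (h a <= h b + (C * (b - a))%:E)%E.
Proof.
move=> ab H.
have := @local_lipschitz_le R (h \o -%R) (- b) (- a) C.
rewrite /= !opprK addrC lerN2 addrC => /(_ ab); rewrite [- a + b]addrC.
apply => t /andP[bt ta].
have [|d d0 dP] := H (- t); first by apply/andP; split; lra.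
exists d => // s /andP[bs sa] sd.
have nE : `|- s - - t| = `|s - t| by rewrite -opprD normrN.
have := dP (- s); rewrite nE; apply => //; apply/andP; split; lra.
Qed.

Lemma continuous_on_eq (R : realType) (X : topologicalType) (a b : R) (s s' : R -> X) :
  (forall t, a <= t <= b -> s t = s' t) -> continuous_on a b s -> continuous_on a b s'.
Proof.
move=> E cs t tab O; rewrite -E// => /(cs t tab)[d d0 dO].
by exists d => // u uab /(dO u uab); rewrite E.
Qed.

Lemma continuous_on_comp (R : realType) (X Y : topologicalType) (a b : R) (s : R -> X)
    (g : X -> Y) :
  continuous_on a b s -> (forall t, a <= t <= b -> {for s t, continuous g}) ->
  continuous_on a b (g \o s).
Proof. by move=> cs cg t tab O /(cg t tab)/(cs t tab). Qed.

(** The constant is the maximal speed plus 1. The differentiability error is taken at accuracy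
    [K^-1], where [K] bounds the norm at [c u] by the sup norm, so that it accounts for the 1. *)
Lemma chart_line_lip (R : realType) n (N : finslerManifold R n) (phi : chart R n N)
    (q v : 'rV[R]_n) : atlas phi ->
  (forall t, 0 <= t <= 1 -> chart_img phi (q + t *: v)) ->
  exists2 C, 0 < C & let c := chart_line phi q v in
  forall u, 0 <= u <= 1 -> exists2 d, 0 < d &
    forall w, 0 <= w <= 1 -> `|w - u| < d ->
      fnorm (c u) (chart_at (c u) (c w) - chart_at (c u) (c u)) <= C * `|w - u|.
Proof.
move=> aphi img; set c := chart_line phi q v.
have C1 t : 0 <= t <= 1 -> C1_curve_at c t by move=> /img; exact: chart_line_C1.
have [|m _ mP] := @EVT_max R (speed c) 0 1 ler01.
  apply: continuous_in_subspaceT => t; rewrite inE/= in_itv/= => /C1.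
  exact: speed_continuous.
exists (speed c m + 1); first by rewrite ltr_wpDl// fnorm_ge0.
move=> /= u u01; have [_ /(_ _ (chart_at_atlas (c u)) (chart_at_dom _))[der _]] := C1 u u01.
have nb := fnorm_is_norm (c u); have [K K0 KP] := is_norm_le nb.
have Kinv : 0 < K^-1 by rewrite invr_gt0.
have [d d0 dP] := derivable_eps (nbhs_singleton der) Kinv.
exists d => // w _ /dP H; rewrite -/(velocity c u) in H.
set X := chart_at (c u) (c w) - chart_at (c u) (c u).
have XE : X = (X - (w - u) *: velocity c u) + (w - u) *: velocity c u by rewrite subrK.
rewrite XE; apply: le_trans (fnormD _ _ _) _; rewrite fnormZ.
have h1 := KP (X - (w - u) *: velocity c u).
have h2 : K * `|X - (w - u) *: velocity c u| <= `|w - u|.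
  by have := ler_wpM2l (ltW K0) H; rewrite mulrA mulfV ?gt_eqF// mul1r.
have h3 : speed c u * `|w - u| <= speed c m * `|w - u|.
  by rewrite ler_wpM2r// mP// in_itv.
by move: h3; rewrite {1}/speed; lra.
Qed.

(** * Existence of lifts *)

Section lifting.
Context {R : realType} {n : nat} {M N : finslerManifold R n}.
Variables (f : M -> N) (x0 : M) (mu : nat -> R).
Hypotheses (fl : locally_lipschitz f) (M_connected : connected [set: M]).
Hypothesis M_complete : finsler_complete M.
Hypotheses (mu0 : forall k, 0 < mu k).
Hypothesis mu_oo : forall B, exists K : nat, B < \sum_(k < K) mu k.
Hypothesis mu_conorm : forall (k : nat) x,
  (finsler_dist x0 x <= k%:R%:E)%E -> ((mu k)%:E < conorm f x)%E.

Section lift_distance.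
Variables (c : R -> N) (C0 : R).
Hypothesis C00 : 0 < C0.
Hypothesis cc : continuous_on 0 1 c.
Hypothesis c_lip : forall u, 0 <= u <= 1 -> exists2 d, 0 < d &
  forall v, 0 <= v <= 1 -> `|v - u| < d ->
    fnorm (c u) (chart_at (c u) (c v) - chart_at (c u) (c u)) <= C0 * `|v - u|.

(** Near [s u] the map expands by at least [mu k], while [c] moves at rate at most [C0]; converting
    chart displacement into distance costs the factor 2. The point [p] is free: [x0] gives the
    growth estimate, and points of the lift give the Lipschitz estimate. *)
Lemma lift_distance_local (A : R -> Prop) (s : R -> M) (u : R) (k : nat) :
  (forall v, A v -> 0 <= v <= 1 /\ f (s v) = c v) -> A u ->
  (forall O, nbhs (s u) O -> exists2 d, 0 < d & forall v, A v -> `|v - u| < d -> O (s v)) ->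
  (finsler_dist x0 (s u) <= k%:R%:E)%E ->
  exists2 d, 0 < d & forall v, A v -> `|v - u| < d -> forall p,
    (finsler_dist p (s v) <= finsler_dist p (s u) + (2 * C0 / mu k * `|v - u|)%:E)%E /\
    (finsler_dist p (s u) <= finsler_dist p (s v) + (2 * C0 / mu k * `|v - u|)%:E)%E.
Proof.
move=> As Au cs xk; have [u01 fu] := As u Au.
have [r1 r10 H1] := local_expansion (fl (s u)) (mu0 k) (mu_conorm xk).
have [r2 r20 H2] := finsler_dist_step (s u).
set phi := chart_at (s u) in H1 H2.
have du : chart_dom phi (s u) by exact: chart_at_dom.
have r0 : 0 < Num.min r1 r2 by rewrite lt_min r10.
have [d1 d10 dO] := cs _ (chart_near du r0).
have [d2 d20 dc] := c_lip u01.
exists (Num.min d1 d2) => [|v Av]; first by rewrite lt_min d10.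
rewrite lt_min => /andP[vd1 vd2] p; have [v01 fv] := As v Av.
have [dv] := dO v Av vd1; rewrite lt_min => /andP[vr1 vr2].
have B : 2 * fnorm (s u) (phi (s v) - phi (s u)) <= 2 * C0 / mu k * `|v - u|.
  have := H1 _ _ du dv; rewrite subrr normr0 fu fv => /(_ r10 vr1) h.
  have := le_trans h (dc v v01 vd2).
  by rewrite mulrC -ler_pdivlMr//; lra.
have B' : 2 * fnorm (s u) (phi (s u) - phi (s v)) <= 2 * C0 / mu k * `|v - u|.
  by rewrite -opprB is_normN//; exact: fnorm_is_norm.
split.
  apply: le_trans (H2 _ _ du dv _ vr2 p) _; first by rewrite subrr normr0.
  by rewrite leeD2l// lee_fin.
apply: le_trans (H2 _ _ dv du vr2 _ p) _; first by rewrite subrr normr0.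
by rewrite leeD2l// lee_fin.
Qed.

Lemma lift_limit (t : R) (s : R -> M) : 0 < t <= 1 ->
  (forall u, 0 <= u < t -> f (s u) = c u) ->
  (forall u, 0 <= u < t -> continuous_on 0 u s) ->
  exists2 l, f l = c t & forall V, nbhs l V ->
    exists2 d, 0 < d & forall u, 0 <= u < t -> t - d < u -> V (s u).
Proof.
move=> /andP[t0 t1] fs cs.
pose A u := 0 <= u < t.
have A01 v : A v -> 0 <= v <= 1 /\ f (s v) = c v.
  move=> Av; split; last exact: fs.
  by case/andP: Av => -> /ltW/le_trans ->.
have csA u : A u -> forall O, nbhs (s u) O ->
    exists2 d, 0 < d & forall v, A v -> `|v - u| < d -> O (s v).
  (* Continuity is known on each [[0, w]] with [w < t]; a [w] beyond [u] turns it into continuity at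
     [u] relative to [[0, t[]. *)
  move=> /andP[u0 ut] O Ou; pose w := (u + t) / 2.
  have uw : u < w by rewrite /w; lra.
  have w0t : 0 <= w < t by apply/andP; split; rewrite /w; lra.
  have [|d d0 dO] := cs w w0t u _ O Ou; first by rewrite u0 ltW.
  exists (Num.min d (w - u)); first by rewrite lt_min d0 subr_gt0.
  move=> v /andP[v0 vt]; rewrite lt_min => /andP[vd vw]; apply: dO => //.
  by rewrite v0/=; have := ler_norm (v - u); lra.
pose r u := fine (finsler_dist x0 (s u)).
have rE u : finsler_dist x0 (s u) = (r u)%:E by rewrite /r finsler_dist_fineE.
have C20 : 0 < 2 * C0 by rewrite mulr_gt0.
have [K KP] : exists K : nat, forall u, 0 <= u < t -> r u <= K%:R.
  apply: (local_growth_bounded mu0 mu_oo C20) => u k ut uk.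
  have xk : (finsler_dist x0 (s u) <= k%:R%:E)%E by rewrite rE lee_fin.
  have [d d0 dP] := lift_distance_local A01 ut (csA u ut) xk.
  exists d => // v vt vd; have := dP v vt vd x0; rewrite !rE !lee_fin => -[? ?].
  by rewrite ler_norml; apply/andP; split; lra.
set L := 2 * C0 / mu K.
have L0 : 0 < L by rewrite divr_gt0.
have sL u v : 0 <= u -> u <= v -> v < t ->
    (finsler_dist (s u) (s v) <= (L * (v - u))%:E)%E /\
    (finsler_dist (s v) (s u) <= (L * (v - u))%:E)%E.
  move=> u0 uv vt.
  have H p : forall w, u <= w <= v -> exists2 d, 0 < d & forall w', u <= w' <= v ->
      `|w' - w| < d ->
      (finsler_dist p (s w') <= finsler_dist p (s w) + (L * `|w' - w|)%:E)%E /\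
      (finsler_dist p (s w) <= finsler_dist p (s w') + (L * `|w' - w|)%:E)%E.
    move=> w /andP[uw wv].
    have wA : A w by rewrite /A (le_trans u0 uw) (le_lt_trans wv vt).
    have xk : (finsler_dist x0 (s w) <= K%:R%:E)%E by rewrite rE lee_fin KP.
    have [d d0 dP] := lift_distance_local A01 wA (csA w wA) xk.
    exists d => // w' /andP[uw' w'v] wd; apply: dP => //.
    by rewrite /A (le_trans u0 uw') (le_lt_trans w'v vt).
  split.
    apply: le_trans (local_lipschitz_le uv (H (s u))) _.
    by apply: le_trans (leeD2r _ (finsler_dist_refl _)) _; rewrite add0e.
  apply: le_trans (local_lipschitz_ge uv (H (s v))) _.
  by apply: le_trans (leeD2r _ (finsler_dist_refl _)) _; rewrite add0e.
pose u_ (k : nat) := t - t * k.+1%:R^-1.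
have ukt k : 0 <= u_ k < t.
  have k0 : 0 < k.+1%:R^-1 :> R by rewrite invr_gt0.
  have k1 : k.+1%:R^-1 <= 1 :> R by rewrite invf_le1// ler1n.
  apply/andP; split; last by rewrite /u_ gtrBl mulr_gt0.
  by rewrite /u_ subr_ge0 ler_piMr// ltW.
have u_inc i j : (i <= j)%N -> u_ i <= u_ j.
  move=> ij; rewrite lerD2l lerN2 ler_pM2l// lef_pV2 ?posrE//.
  by rewrite ler_nat ltnS.
have u_small e : 0 < e -> exists k : nat, L * (t - u_ k) < e.
  move=> e0; have [k kP] := exists_invSn_lt (divr_gt0 e0 (mulr_gt0 L0 t0)).
  exists k; rewrite /u_ opprB addrCA subrr addr0 mulrA.
  by move: kP; rewrite (ltr_pdivlMr _ _ (mulr_gt0 L0 t0)) mulrC.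
have [e e0|l lP] := M_complete (u := s \o u_).
  have [k kP] := u_small e e0; exists k => i j ki kj /=.
  have [/andP[i0 it] /andP[j0 jt]] := (ukt i, ukt j).
  apply: (@le_lt_trans _ _ (L * (t - u_ k))%:E); last by rewrite lte_fin.
  have [ij|/ltW ij] := leP (u_ i) (u_ j).
    apply: le_trans (proj1 (sL _ _ i0 ij jt)) _; rewrite lee_fin ler_pM2l//.
    by have := u_inc _ _ ki; lra.
  apply: le_trans (proj2 (sL _ _ j0 ij it)) _; rewrite lee_fin ler_pM2l//.
  by have := u_inc _ _ kj; lra.
(* Completeness gives a limit along the sequence [u_] only. The Lipschitz estimate carries it to all
   [u] tending to [t], through a term [s (u_ k)] that is close to [l] both in the chart and in
   time. *)
have sl V : nbhs l V -> exists2 d, 0 < d & forall u, 0 <= u < t -> t - d < u -> V (s u).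
  move=> Vl; have [e e0 eV] := finsler_dist_nbhs Vl.
  have [r2 r20 H2] := finsler_dist_step l; set phi := chart_at l in H2.
  have dl : chart_dom phi l by exact: chart_at_dom.
  have [C Cpos CP] := is_norm_le (fnorm_is_norm l).
  (* With [e / (4 * C)], the chart segment from [s (u_ k)] to [l] adds at most [e / 2] to the
     distance. *)
  have q0 : 0 < Num.min r2 (e / (4 * C)) by rewrite lt_min r20 divr_gt0// mulr_gt0.
  have [e' e'0 e'O] := finsler_dist_nbhs (chart_near dl q0).
  have [k1 k1P] := lP e' e'0.
  have [k2 k2P] := u_small _ (divr_gt0 e0 (ltr0Sn R 1)).
  pose k := maxn k1 k2; have [/andP[uk0 ukt'] uk2] := (ukt k, u_inc _ _ (leq_maxr k1 k2)).
  exists (t - u_ k) => [|v /andP[v0 vt]]; first by rewrite subr_gt0.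
  rewrite subKr => ukv; apply: eV.
  have [dk] := e'O _ (k1P k (leq_maxl _ _)).
  rewrite lt_min /= => /andP[kr2 kC].
  apply: (le_lt_trans (H2 _ _ dk dl kr2 _ (s v))); first by rewrite subrr normr0.
  apply: (@le_lt_trans _ _ ((L * (v - u_ k))%:E + (e / 2)%:E)%E).
    apply: leeD; first by have [] := sL _ _ uk0 (ltW ukv) vt.
    rewrite lee_fin; have := CP (phi l - phi (s (u_ k))); rewrite distrC.
    have : C * `|phi (s (u_ k)) - phi l| <= C * (e / (4 * C)) by rewrite ler_pM2l// ltW.
    have -> : C * (e / (4 * C)) = e / 4 by field; rewrite gt_eqF.
    lra.
  rewrite -EFinD lte_fin.
  have : L * (v - u_ k) <= L * (t - u_ k2) by rewrite ler_pM2l//; rewrite -/k in uk2; lra.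
  by lra.
exists l => //; apply: (hausdorff_eq (@carrier_hausdorff _ _ N)) => O1 O2 O1l O2t.
have [d d0 dP] := sl _ (lipschitz_near_continuousM (fl l) O1l).
have t01 : 0 <= t <= 1 by rewrite t1 ltW.
have [d' d'0 d'P] := cc t01 O2t.
have [m [m0 md md']] := exists_pos_lt2 d0 d'0.
have [e [e0 em et]] := exists_pos_lt2 m0 t0.
have ut : 0 <= t - e < t by apply/andP; split; lra.
exists (c (t - e)); split.
  by rewrite -fs//; apply: dP => //; lra.
apply: d'P; first by apply/andP; split; lra.
by rewrite addrAC subrr add0r normrN gtr0_norm//; lra.
Qed.
End lift_distance.

Lemma locally_lipschitz_continuous : continuous f.
Proof. by move=> x; exact: lipschitz_near_continuousM. Qed.

Lemma conorm_pos (x : M) : exists2 c, 0 < c & (c%:E < conorm f x)%E.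
Proof.
pose k := (Num.truncn (fine (finsler_dist x0 x))).+1; exists (mu k) => //.
apply: mu_conorm; rewrite -(finsler_dist_fineE M_connected) lee_fin ltW//.
exact: truncnS_gt.
Qed.

Lemma section_at (x : M) : has_local_section f x.
Proof.
have [c c0 cx] := conorm_pos x.
exact: local_section (fl x) c0 cx locally_lipschitz_continuous.
Qed.

Lemma locally_injective (x : M) : exists2 U, nbhs x U &
  forall y z, U y -> U z -> f y = f z -> y = z.
Proof.
have [U [V [g [[oU Ux] _ gU _]]]] := section_at x.
exists U => [|y z /gU[_ gy] /gU[_ gz] E]; last by rewrite -gy E gz.
exact: open_nbhs_nbhs.
Qed.

Definition lift (c : R -> N) (y : M) (T : R) (s : R -> M) :=
  [/\ s 0 = y, continuous_on 0 T s & forall t, 0 <= t <= T -> f (s t) = c t].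

Lemma lift_eq c y T T' s s' : lift c y T s -> lift c y T' s' ->
  forall t, 0 <= t -> t <= T -> t <= T' -> s t = s' t.
Proof.
move=> [s0 cs fs] [s'0 cs' fs'] t t0 tT tT'.
apply: (lift_unique (@carrier_hausdorff _ _ M) locally_injective t0) => //.
- exact: continuous_on_sub tT cs.
- exact: continuous_on_sub tT' cs'.
- move=> u /andP[u0 ut]; rewrite fs ?fs' ?u0//=; first exact: le_trans tT'.
  exact: le_trans tT.
- by rewrite s0 s'0.
- by rewrite t0 lexx.
Qed.

Lemma lift_exists (phi : chart R n N) (q v : 'rV[R]_n) (y : M) : atlas phi ->
  (forall t, 0 <= t <= 1 -> chart_img phi (q + t *: v)) ->
  f y = chart_inv phi q -> exists s, lift (chart_line phi q v) y 1 s.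
Proof.
move=> aphi img fy; have [C0 C00 c_lip] := chart_line_lip aphi img.
set c := chart_line phi q v in c_lip *.
have c0 : c 0 = f y by rewrite /c/chart_line scale0r addr0.
have cc : continuous_on 0 1 c.
  by apply: continuous_at_on => t /img; exact: chart_line_continuous.
suff : forall T, 0 <= T <= 1 -> exists s, lift c y T s.
  by apply; rewrite lexx ler01.
apply: real_induction => [|t /andP[t0 t1] [s [s0 cs fs]]|t /andP[t0 t1] H].
- exists (fun=> y); split=> // t; last first.
    by rewrite -c0 => /le_anti ->.
  by move=> _ O Oy; exists 1 => // u _ _; exact: nbhs_singleton.
- have tt : 0 <= t <= t by rewrite t0 lexx.
  have t01 : 0 <= t <= 1 by rewrite t0 ltW.
  have [U [V [g [[_ Us] [oV Vt] gU gV]]]] := section_at (s t).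
  have gct : g (c t) = s t by have [_] := gU _ Us; rewrite fs.
  rewrite fs// in Vt.
  have [d d0 dV] := cc t t01 V (open_nbhs_nbhs (conj oV Vt)).
  exists d => // r /andP[tr rd] r1.
  have Vc u : t <= u -> u <= r -> V (c u).
    move=> tu ur; apply: dV; first by rewrite (le_trans t0 tu) (le_trans ur).
    by rewrite ger0_norm ?subr_ge0//; lra.
  (* Beyond [t] the local section at [s t] carries the base curve back to [M]; the branches meet
     because [g (c t) = s t]. *)
  pose s' u := if u <= t then s u else g (c u).
  exists s'; split.
  + by rewrite /s' t0.
  + move=> w /andP[w0 wr] O Ow.
    have w01 : 0 <= w <= 1 by rewrite w0 (le_trans wr).
    have right : t <= w -> exists2 d1, 0 < d1 & forall u, 0 <= u <= r -> `|u - w| < d1 ->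
        t <= u -> O (g (c u)).
      move=> tw; have [_ _ cg] := gV _ (Vc w tw wr).
      have Ow' : nbhs (g (c w)) O.
        move: Ow; rewrite /s'; case: leP => // wt.
        by have -> : w = t; [apply/le_anti; rewrite wt|rewrite gct].
      have [d1 d10 d1P] := cc w w01 _ (cg _ Ow').
      exists d1 => // u /andP[u0 ur] ud _; apply: d1P => //.
      by rewrite u0 (le_trans ur).
    have left : w <= t -> exists2 d1, 0 < d1 & forall u, 0 <= u <= r -> `|u - w| < d1 ->
        u <= t -> O (s u).
      move=> wt; rewrite /s' wt in Ow; have [|d1 d10 d1P] := cs w _ O Ow.
        by rewrite w0.
      by exists d1 => // u /andP[u0 ur] ud ut; apply: d1P => //; rewrite u0.
    have [wt|tw|wt] := ltgtP w t.
    * have [d1 d10 d1P] := left (ltW wt); exists (Num.min d1 (t - w)).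
        by rewrite lt_min d10 subr_gt0.
      move=> u ur; rewrite lt_min => /andP[ud1 ud]; rewrite /s'.
      have ut : u <= t by have := ler_norm (u - w); lra.
      by rewrite ut; apply: d1P.
    * have [d1 d10 d1P] := right (ltW tw); exists (Num.min d1 (w - t)).
        by rewrite lt_min d10 subr_gt0.
      move=> u ur; rewrite lt_min => /andP[ud1 ud]; rewrite /s'.
      have ut : t < u by have := ler_norm (w - u); rewrite distrC; lra.
      by rewrite leNgt ut/=; apply: d1P => //; exact: ltW.
    * have [|d1 d10 d1P] := left _; first by rewrite wt.
      have [|d2 d20 d2P] := right _; first by rewrite wt.
      exists (Num.min d1 d2); first by rewrite lt_min d10.
      move=> u ur; rewrite lt_min => /andP[ud1 ud2]; rewrite /s'.
      by case: leP => [ut|/ltW tu]; [apply: d1P|apply: d2P].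
  + move=> u /andP[u0 ur]; rewrite /s'; case: leP => [ut|/ltW tu].
      by rewrite fs// u0.
    by have [] := gV _ (Vc u tu ur).
- have t01 : 0 < t <= 1 by rewrite t0.
  have /choice[S SP] : forall r, exists s, 0 <= r < t -> lift c y r s.
    move=> r; have [/H[s sP]|nr] := pselect (0 <= r < t); first by exists s.
    by exists (fun=> y).
  (* Lifts over different intervals agree by uniqueness, so the diagonal restricts to a lift over
     every [[0, r]] with [r < t]. *)
  pose s u := S u u.
  have sS r : 0 <= r < t -> forall u, 0 <= u <= r -> S r u = s u.
    move=> rt u /andP[u0 ur]; have ut : 0 <= u < t.
      by rewrite u0 (le_lt_trans ur)//; case/andP: rt.
    exact: (lift_eq (SP r rt) (SP u ut) u0 ur (lexx u)).
  have fs u : 0 <= u < t -> f (s u) = c u.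
    by move=> ut; have [_ _ ->//] := SP u ut; rewrite lexx andbT; case/andP: ut.
  have cs u : 0 <= u < t -> continuous_on 0 u s.
    by move=> ut; have [_ /(continuous_on_eq (sS u ut))] := SP u ut.
  have [l fl_ lP] := lift_limit C00 cc c_lip t01 fs cs.
  pose s' u := if u < t then s u else l.
  exists s'; split.
  + have tt : 0 <= (0 : R) < t by rewrite lexx t0.
    by rewrite /s' t0; have [] := SP 0 tt.
  + move=> w /andP[w0 wt] O; rewrite /s'; case: ltP => [ltwt|tw] Ow.
      pose w' := (w + t) / 2; have [ww' w't] : w < w' /\ w' < t by rewrite /w'; split; lra.
      have w'0 : 0 <= w' < t by rewrite w't (le_trans w0 (ltW ww')).
      have [|d d0 dO] := cs w' w'0 w _ O Ow; first by rewrite w0 ltW.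
      exists (Num.min d (w' - w)); first by rewrite lt_min d0 subr_gt0.
      move=> u /andP[u0 ut]; rewrite lt_min => /andP[ud uw].
      have uw' : u < w' by have := ler_norm (u - w); lra.
      by rewrite (lt_trans uw' w't); apply: dO => //; rewrite u0 ltW.
    have [d d0 dO] := lP O Ow; exists d => // u /andP[u0 ut] ud.
    case: ltP => [ltut|_]; last exact: nbhs_singleton.
    have wE : w = t by apply/le_anti; rewrite wt.
    apply: dO; first by rewrite u0.
    by move: ud; rewrite wE distrC => ud; have := ler_norm (t - u); lra.
  + move=> u /andP[u0 ut]; rewrite /s'; case: ltP => [ltut|tu].
      by apply: fs; rewrite u0.
    by rewrite fl_; congr c; apply/le_anti; rewrite tu ut.
Qed.

Lemma lift_rev c y s : lift c y 1 s ->
  lift (fun t => c (1 - t)) (s 1) 1 (fun t => s (1 - t)).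
Proof.
move=> [s0 cs fs]; split; first by rewrite subr0.
  move=> t /andP[t0 t1] O; have t01 : 0 <= 1 - t <= 1 by apply/andP; split; lra.
  move=> /(cs _ t01)[d d0 dO]; exists d => // u /andP[u0 u1] ud; apply: dO.
    by apply/andP; split; lra.
  by have -> : 1 - u - (1 - t) = - (u - t); [ring|rewrite normrN].
by move=> t /andP[t0 t1]; apply: fs; apply/andP; split; lra.
Qed.

(** * The sheets over a chart ball *)

Section sheets.
Variables (phi : chart R n N) (z : N) (r : R).
Hypotheses (aphi : atlas phi) (dz : chart_dom phi z) (r0 : 0 < r).
Hypothesis img : forall p, `|p - phi z| < r -> chart_img phi p.

Let seg (v : 'rV[R]_n) : R -> N := chart_line phi (phi z) v.

Lemma segment_img v t : `|v| < r -> 0 <= t <= 1 -> chart_img phi (phi z + t *: v).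
Proof.
move=> vr /andP[t0 t1]; apply: img; rewrite addrC addKr normrZ ger0_norm//.
by apply: le_lt_trans vr; rewrite ler_piMl.
Qed.

Lemma segment_continuous v0 t (V : set N) : `|v0| < r -> 0 <= t <= 1 ->
  nbhs (seg v0 t) V -> exists2 d, 0 < d & forall v u, 0 <= u <= 1 ->
    `|v - v0| < d -> `|u - t| < d -> V (seg v u).
Proof.
move=> vr t01 Vt; have [E dx] := chart_invK (segment_img vr t01).
have [rho rho0 H] := chart_inv_ball dx Vt.
have k0 : 0 < 1 + `|v0| by rewrite ltr_wpDr.
exists (rho / (1 + `|v0|)) => [|v u /andP[u0 u1] vd ud]; first by rewrite divr_gt0.
have [] // := H (phi z + u *: v).
rewrite E opprD addrACA subrr add0r.
have -> : u *: v - t *: v0 = u *: (v - v0) + (u - t) *: v0.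
  by apply/rowP => j; rewrite !mxE; ring.
apply: le_lt_trans (ler_normD _ _) _; rewrite !normrZ (ger0_norm u0).
have h1 : u * `|v - v0| <= `|v - v0| by rewrite ler_piMl.
have h2 : `|u - t| * `|v0| <= rho / (1 + `|v0|) * `|v0| by rewrite ler_wpM2r// ltW.
have : rho / (1 + `|v0|) * (1 + `|v0|) = rho by rewrite divfK// gt_eqF.
by rewrite mulrDr mulr1; lra.
Qed.

Variable S : M -> 'rV[R]_n -> R -> M.
Hypothesis SP : forall y v, f y = z -> `|v| < r -> lift (seg v) y 1 (S y v).

Lemma lift_end y v : f y = z -> `|v| < r ->
  [/\ f (S y v 1) = chart_inv phi (phi z + v), chart_dom phi (f (S y v 1)) &
    phi (f (S y v 1)) - phi z = v].
Proof.
move=> fy vr; have [_ _ fS] := SP fy vr.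
have fS1 : f (S y v 1) = chart_inv phi (phi z + v).
  by rewrite fS ?lexx ?ler01// /seg /chart_line scale1r.
have [|E dE] := @chart_invK _ _ _ phi (phi z + v).
  by apply: img; rewrite addrC addKr.
by rewrite fS1; split; rewrite // E addrC addKr.
Qed.

(* Where the lift over v0 meets a local section of f, so do the lifts over nearby
   v; hence continuity in v at v0 propagates along the parameter. *)
Lemma lift_end_continuous y v0 (O : set M) : f y = z -> `|v0| < r -> nbhs (S y v0 1) O ->
  exists2 d, 0 < d & forall v, `|v - v0| < d -> `|v| < r -> O (S y v 1).
Proof.
move=> fy v0r.
pose A t := forall O, nbhs (S y v0 t) O ->
  exists2 d, 0 < d & forall v, `|v - v0| < d -> `|v| < r -> O (S y v t).
suff : forall t, 0 <= t <= 1 -> A t by apply; rewrite lexx ler01.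
have [s00 cs0 fs0] := SP fy v0r.
have cseg v : `|v| < r -> continuous_on 0 1 (seg v).
  by move=> vr; apply: continuous_at_on => t /(segment_img vr); exact: chart_line_continuous.
(* One radius serves all pairs [s1 <= s2] around [t], which covers both cases of real induction:
   [s1 = t] for going beyond [t], and [s2 = t] for reaching it. *)
have key t : 0 <= t <= 1 -> exists2 d, 0 < d & forall s1 s2,
    0 <= s1 -> s1 <= s2 -> s2 <= 1 -> `|s1 - t| < d -> `|s2 - t| < d -> A s1 -> A s2.
  move=> t01; have [U [V [g [[oU Ut] [oV Vt] gU gV]]]] := section_at (S y v0 t).
  rewrite fs0// in Vt.
  have [d1 d10 H1] := segment_continuous v0r t01 (open_nbhs_nbhs (conj oV Vt)).
  have [d2 d20 H2] := cs0 t t01 _ (open_nbhs_nbhs (conj oU Ut)).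
  exists (Num.min d1 d2); first by rewrite lt_min d10.
  move=> s1 s2 s10 s12 s21; rewrite !lt_min => /andP[s1d1 s1d2] /andP[s2d1 s2d2] As1.
  have s101 : 0 <= s1 <= 1 by rewrite s10 (le_trans s12).
  have s201 : 0 <= s2 <= 1 by rewrite s21 (le_trans s10).
  have [d3 d30 H3] := As1 U (open_nbhs_nbhs (conj oU (H2 _ s101 s1d2))).
  have Vseg v u : `|v - v0| < d1 -> s1 <= u -> u <= s2 -> V (seg v u).
    move=> vd su us; apply: H1 => //; first by rewrite (le_trans s10) ?(le_trans us).
    move: s1d1 s2d1; rewrite !ltr_norml => /andP[? ?] /andP[? ?].
    by apply/andP; split; lra.
  have SE v : `|v - v0| < d1 -> `|v - v0| < d3 -> `|v| < r -> S y v s2 = g (seg v s2).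
    move=> vd1 vd3 vr; have [sv0 csv fsv] := SP fy vr.
    apply: (lift_unique (s' := g \o seg v) (@carrier_hausdorff _ _ M) locally_injective s12).
    - exact: continuous_on_sub csv.
    - apply: continuous_on_comp; first exact: continuous_on_sub (cseg v vr).
      by move=> u /andP[su us]; have [] := gV _ (Vseg v u vd1 su us).
    - move=> u /andP[su us]; rewrite fsv; last by rewrite (le_trans s10) ?(le_trans us).
      by have [_ ->] := gV _ (Vseg v u vd1 su us).
    - by have [_] := gU _ (H3 v vd3 vr); rewrite fsv.
    - by rewrite s12 lexx.
  have dm0 : `|v0 - v0| < Num.min d1 d3 by rewrite subrr normr0 lt_min d10.
  move=> O'; rewrite SE; first last => //; try by move: dm0; rewrite lt_min => /andP[].
  have [_ _ cg] : [/\ U (g (seg v0 s2)), f (g (seg v0 s2)) = seg v0 s2 &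
    {for seg v0 s2, continuous g}].
    by apply: gV; apply: Vseg => //; move: dm0; rewrite lt_min => /andP[].
  move=> /cg gO; have [d4 d40 H4] := segment_continuous v0r s201 gO.
  exists (Num.min (Num.min d1 d3) d4); first by rewrite !lt_min d10 d30.
  move=> v; rewrite !lt_min => /andP[/andP[vd1 vd3] vd4] vr; rewrite SE//.
  by apply: H4 => //; rewrite subrr normr0.
apply: real_induction.
- move=> O' Oy; exists 1 => // v _ vr.
  have [-> _ _] := SP fy vr; rewrite s00 in Oy; exact: nbhs_singleton.
- move=> t /andP[t0 t1] At; have [|d d0 dP] := key t; first by rewrite t0 ltW.
  exists d => // s /andP[ts sd] s1; apply: (dP t) => //; first exact: ltW.
    by rewrite subrr normr0.
  by rewrite gtr0_norm ?subr_gt0//; lra.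
- move=> t /andP[t0 t1] At; have [|d d0 dP] := key t; first by rewrite t1 ltW.
  have [e [e0 ed et]] := exists_pos_lt2 d0 t0.
  have Ate : A (t - e) by apply: At; apply/andP; split; lra.
  have h : `|t - e - t| < d by rewrite addrAC subrr add0r normrN gtr0_norm//; lra.
  have h0 : 0 <= t - e by lra.
  apply: (dP (t - e)) => //; last by rewrite subrr normr0.
  by lra.
Qed.

(** The image of the endpoint determines [v]; the reversed lifts then start at the same point over
    the same segment, so they end at the same point. *)
Lemma lift_end_inj y y' v v' : f y = z -> f y' = z -> `|v| < r -> `|v'| < r ->
  S y v 1 = S y' v' 1 -> y = y' /\ v = v'.
Proof.
move=> fy fy' vr v'r E.
have vE : v = v'.
  by have [_ _ <-] := lift_end fy vr; have [_ _ <-] := lift_end fy' v'r; rewrite E.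
split=> //; have l1 := SP fy vr; have l2 := SP fy' v'r; rewrite -vE in l2 E.
have := lift_rev l2; rewrite -E => /(lift_eq (lift_rev l1))/(_ 1 ler01 (lexx 1) (lexx 1)).
by rewrite subrr; have [-> _ _] := l1; have [-> _ _] := l2.
Qed.

(** Lift the radius backwards from [x]: it ends in the fibre over [z], and the reversed lift is by
    uniqueness the chosen one from that point. *)
Lemma lift_end_surj x : chart_dom phi (f x) -> `|phi (f x) - phi z| < r ->
  exists2 y, f y = z & S y (phi (f x) - phi z) 1 = x.
Proof.
move=> dx; set v := _ - _ => vr.
have vE : phi z + v = phi (f x) by rewrite /v addrC subrK.
have lineE t : phi z + v + t *: - v = phi z + (1 - t) *: v.
  by apply/rowP => j; rewrite !mxE; ring.
have [t t01||s ls] := @lift_exists phi (phi z + v) (- v) x aphi.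
- rewrite lineE; apply: segment_img => //.
  by move: t01 => /andP[? ?]; apply/andP; split; lra.
- by rewrite vE chart_mapK.
have [s0 _ fs] := ls.
have fs1 : f (s 1) = z.
  by rewrite fs ?lexx ?ler01// /chart_line lineE subrr scale0r addr0 chart_mapK.
have := lift_rev ls.
have -> : (fun t => chart_line phi (phi z + v) (- v) (1 - t)) = seg v.
  by apply/funext => t; rewrite /seg /chart_line lineE subKr.
move=> /(lift_eq (SP fs1 vr))/(_ 1 ler01 (lexx 1) (lexx 1)).
by rewrite subrr s0 => SE; exists (s 1).
Qed.

Let sheet (i : {y | f y = z}) : set M := [set S (sval i) v 1 | v in [set v | `|v| < r]].

(** A point [x'] near the endpoint and the end of the lift over [v'] have the same image and lie in
    a common set on which [f] is injective, so they coincide. *)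
Lemma sheet_open i : open (sheet i).
Proof.
case: i => y fy; rewrite openE => _ [v /= vr <-]; rewrite /interior.
have [fS dfS fSv] := lift_end fy vr.
have [U [V [g [[oU Ux] _ gU _]]]] := section_at (S y v 1).
have nU := open_nbhs_nbhs (conj oU Ux).
have [d d0 dU] := lift_end_continuous fy vr nU.
have d0' : 0 < Num.min d (r - `|v|) by rewrite lt_min d0 subr_gt0.
have := locally_lipschitz_continuous (chart_near dfS d0').
apply: filterS2 nU => x' Ux' /= [dx']; rewrite lt_min => /andP[xd xr].
set v' := phi (f x') - phi z.
have vv : phi (f x') - phi (f (S y v 1)) = v' - v.
  by rewrite -{2}fSv /v' opprB addrA subrK.
rewrite vv in xd xr.
have v'r : `|v'| < r by have := ler_normD (v' - v) v; rewrite subrK; lra.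
exists v' => //=; have Us := dU v' xd v'r.
have [fS' _ _] := lift_end fy v'r.
have [_ <-] := gU _ Us; have [_ <-] := gU _ Ux'.
by rewrite fS' /v' addrC subrK chart_mapK.
Qed.

Lemma sheet_homeomorphic i :
  homeomorphic_onto f (sheet i) [set w | chart_dom phi w /\ `|phi w - phi z| < r].
Proof.
case: i => y fy; split.
  exact: (continuous_subspaceT locally_lipschitz_continuous).
exists (fun w => S y (phi w - phi z) 1); split.
- apply: continuous_in_subspaceT => w; rewrite inE => -[dw wr] O Ow.
  have [d d0 dO] := lift_end_continuous fy wr Ow.
  have d0' : 0 < Num.min d (r - `|phi w - phi z|) by rewrite lt_min d0 subr_gt0.
  apply: filterS (chart_near dw d0') => w' [dw'].
  rewrite lt_min => /andP[wd wr']; apply: dO.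
    by rewrite opprB addrA subrK.
  by have := ler_normD (phi w' - phi w) (phi w - phi z); rewrite subrKA; lra.
- move=> _ [v /= vr <-]; by have [_ dfS fSv] := lift_end fy vr; rewrite /= fSv.
- move=> w [dw wr]; split; first by exists (phi w - phi z).
  by have [-> _ _] := lift_end fy wr; rewrite addrC subrK chart_mapK.
Qed.

Lemma sheet_trivIset : trivIset setT sheet.
Proof.
move=> [y fy] [y' fy'] _ _ [_ [[v /= vr <-] [v' /= v'r E]]].
have [yy _] := lift_end_inj fy' fy v'r vr E; subst y'.
by congr exist; exact: Prop_irrelevance.
Qed.

Lemma sheet_cover :
  f @^-1` [set w | chart_dom phi w /\ `|phi w - phi z| < r] = \bigcup_i sheet i.
Proof.
apply/seteqP; split=> [x [dx xr]|x [[y fy] _ [v vr <-]]].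
  have [y fy SE] := lift_end_surj dx xr.
  by exists (exist _ y fy) => //; exists (phi (f x) - phi z).
have [_ [g [_ H _]]] := sheet_homeomorphic (exist _ y fy).
by have [|] := H (S y v 1); first by exists v.
Qed.
End sheets.

Lemma covering_of_profile : covering_map f.
Proof.
split; first exact: locally_lipschitz_continuous.
move=> z; set phi := chart_at z; have dz : chart_dom phi z by exact: chart_at_dom.
have aphi : atlas phi by exact: chart_at_atlas.
have [r r0 rP] := chart_inv_ball dz filterT.
have img p : `|p - phi z| < r -> chart_img phi p by move=> /rP[].
exists [set w | chart_dom phi w /\ `|phi w - phi z| < r].
  split; last by split; [|rewrite subrr normr0].
  exact: chart_ball_open.
(* One lift is fixed for every fibre point and radius; elsewhere the choice is arbitrary. *)
have /choice[S SP] : forall yv : M * 'rV[R]_n, exists s, f yv.1 = z -> `|yv.2| < r ->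
    lift (chart_line phi (phi z) yv.2) yv.1 1 s.
  move=> [y v] /=; have [fy|nfy] := pselect (f y = z); last by exists (fun=> y).
  have [vr|nvr] := boolP (`|v| < r); last by exists (fun=> y).
  have [t t01||s ls] := @lift_exists phi (phi z) v y aphi; last by exists s.
    exact: (segment_img img vr t01).
  by rewrite fy chart_mapK.
have SP' y v : f y = z -> `|v| < r -> lift (chart_line phi (phi z) v) y 1 (S (y, v)).
  exact: (SP (y, v)).
exists {y | f y = z},
  (fun i : {y | f y = z} => [set S (sval i, v) 1 | v in [set v | `|v| < r]]); split.
- exact: (sheet_open img SP').
- exact: (sheet_trivIset img SP').
- exact: (sheet_cover aphi dz img SP').
- exact: (sheet_homeomorphic img SP').
Qed.
End lifting.

Theorem theorem4p3 (R : realType) (n : nat) (M N : finslerManifold R n)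
    (M_connected : connected [set: M]) (N_connected : connected [set: N])
    (M_complete : finsler_complete M)
    (f : M -> N) (f_lipschitz : locally_lipschitz f)
    (f_rank : forall x : M, maximal_rank f x)
    (f_integral : exists x0 : M,
       (\int[@lebesgue_measure R]_(t in `[0%R, +oo[%classic)
          ereal_inf [set conorm f x | x in finsler_closed_ball x0 t] = +oo)%E) :
  covering_map f.
Proof.
have [x0 /(conorm_profile f_lipschitz)[mu [mu0 mu_oo mu_conorm]]] := f_integral.
exact: (covering_of_profile f_lipschitz M_connected M_complete mu0 mu_oo mu_conorm).
Qed.
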